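(* Let $B$ be a closed, connected, oriented manifold of dimension $2n$, let $\pi\colon M\to B$ be a principal $S^1$-bundle with real Euler class $e\in H^2_{\mathrm{dR}}(B)$, with $M$ carrying the corresponding orientation, and let $\xi$ be an $S^1$-invariant, cooriented, positive contact structure on $M$. Write $\xi=\ker\alpha$ with $\alpha$ an $S^1$-invariant contact form defining the coorientation, choose a connection $1$-form $\psi$ on $M$, and write $\alpha=\beta+u\psi$ with $u=\alpha(\partial_\theta)$, so that $u$ and $\beta$ descend to a function and a $1$-form on $B$. Let $\Gamma=\{p\in B: u(p)=0\}$ be the dividing set, $B_\pm=\{p\in B: \pm u(p)\ge 0\}$, and $\beta_0=\beta|_{T\Gamma}$ (a contact form on $\Gamma$ inducing the orientation of $\Gamma$ as the boundary of $B_+$). Then there are symplectic forms $\omega_+$ on $B_+$ and $\omega_-$ on $-B_-$ (where $-B_-$ denotes $B_-$ with reversed orientation) such that (i) $\mp[\omega_\pm/2\pi]=e|_{B_\pm}$ in $H^2_{\mathrm{dR}}(B_\pm)$; (ii) if $\Gamma$ is non-empty, then $(B_+,\omega_+)$ and $(-B_-,\omega_-)$ are weak fillings of $(\Gamma,\ker\beta_0)$.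
   Context: Conventions on principal $S^1$-bundles $\pi\colon M\to B$: $\partial_\theta$ is the vector field on $M$ generating the $S^1$-action. A connection $1$-form is an $S^1$-invariant $1$-form $\psi$ on $M$ with $\psi(\partial_\theta)\equiv 1$. Then $d\psi=\pi^*\omega$ for a closed $2$-form $\omega$ on $B$, the curvature form; the real Euler class is $e=-[\omega/2\pi]\in H^2_{\mathrm{dR}}(B)$. A form on $M$ is horizontal if its contraction with $\partial_\theta$ vanishes; $S^1$-invariant horizontal forms on $M$ are identified with forms on $B$. If $B$ is oriented, $M$ is oriented so that $\psi\wedge\pi^*\mathrm{vol}_B>0$. A contact structure $\xi=\ker\alpha$ on the $(2n+1)$-manifold $M$ is positive if $\alpha\wedge(d\alpha)^n>0$. An $S^1$-invariant cooriented contact structure always has an $S^1$-invariant contact form (by averaging). A symplectic form on an oriented manifold is understood to induce the given orientation. Weak filling: let $(W,\omega)$ be a compact symplectic manifold of dimension $2n$, oriented by $\omega$, and $\eta=\ker\beta_0$ a cooriented contact structure on $\partial W$ inducing the boundary orientation (i.e. $\beta_0\wedge(d\beta_0)^{n-1}>0$); $\eta$ is oriented by $(d\beta_0)^{n-1}|_\eta$. Then $(W,\omega)$ is a weak filling of $(\partial W,\eta)$ if $(d\beta_0)^k\wedge\omega^{n-1-k}|_\eta>0$ for all $k=0,\dots,n-1$. *)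

(* Defs.v *)
From HB Require Import structures.
From mathcomp Require Import all_boot all_order all_fingroup all_algebra.
From mathcomp Require Import all_classical all_reals all_analysis.
Set Implicit Arguments.
Unset Strict Implicit.
Unset Printing Implicit Defensive.
Import Order.TTheory GRing.Theory Num.Theory.
Import numFieldNormedType.Exports.
Local Open Scope classical_set_scope.
Local Open Scope ring_scope.

Section Covectors.
Context {R : realType} {V : lmodType R}.

(* Alternating k-linear maps are functions on k-families of vectors; the
   predicate [alternating] below carries the axioms. *)
Definition covector (k : nat) : Type := ('I_k -> V) -> R.

Definition alternating (k : nat) (a : covector k) : Prop :=
  (forall (v : 'I_k -> V) (i : 'I_k) (c : R) (x y : V),
     a (fun j => if j == i then c *: x + y else v j) =
     c * a (fun j => if j == i then x else v j) +
     a (fun j => if j == i then y else v j)) /\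
  (forall (v : 'I_k -> V) (i j : 'I_k), i != j -> v i = v j -> a v = 0).

(* Normalised so that (a /\ b)(x, y) = a x * b y - a y * b x for a and b of
   degree 1; this is the normalisation for which [ext_d] below satisfies the
   Leibniz rule without numerical factors. *)
Definition wedge (k l : nat) (a : covector k) (b : covector l) :
    covector (k + l) := fun v =>
  (k`! * l`!)%N%:R^-1 *
  \sum_(s : 'S_(k + l))
    (-1) ^+ s * (a (fun i => v (s (lshift l i))) *
                 b (fun j => v (s (rshift k j)))).

Fixpoint wedge_exp (d : nat) (a : covector d) (k : nat) : covector (k * d) :=
  match k return covector (k * d) with
  | 0 => fun _ => 1
  | k'.+1 => wedge a (@wedge_exp d a k')
  end.

(* Evaluation on a list of vectors (intended for lists of length k); it avoids
   transporting covectors along equations between degrees. *)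
Definition eval_cov (k : nat) (a : covector k) (s : seq V) : R :=
  a (fun i => nth 0 s i).

(* b > 0 on the subspace P, where P has dimension k and is oriented by the
   top-degree covector a|P. *)
Definition positive_on (P : set V) (k l : nat) (a : covector k)
    (b : covector l) : Prop :=
  forall s : seq V, size s = k -> (forall x, x \in s -> P x) ->
    0 < eval_cov a s -> 0 < eval_cov b s.

End Covectors.
Arguments covector {R} V k.
Arguments wedge_exp {R V d} a k.

Section Smoothness.
Context {R : realType} {V W : normedModType R}.

Fixpoint Ck_on (k : nat) (U : set V) (f : V -> W) : Prop :=
  match k with
  | 0 => forall x, U x -> {for x, continuous f}
  | k'.+1 => (forall x, U x -> differentiable f x) /\
             (forall v, Ck_on k' U (fun x => 'D_v f x))
  end.

(* Only meant for open U. *)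
Definition smooth_on (U : set V) (f : V -> W) : Prop := forall k, Ck_on k U f.

End Smoothness.

(* The two maps are total functions; they carry information only on the
   domain, resp. the codomain. *)
Record chart (R : realType) (m : nat) (T : topologicalType) := Chart {
  chart_dom : set T;
  chart_cod : set 'rV[R]_m;
  chart_fwd : T -> 'rV[R]_m;
  chart_bwd : 'rV[R]_m -> T;
  chart_dom_open : open chart_dom;
  chart_cod_open : open chart_cod;
  chart_fwd_cod : forall p, chart_dom p -> chart_cod (chart_fwd p);
  chart_bwd_dom : forall x, chart_cod x -> chart_dom (chart_bwd x);
  chart_fwdK : forall p, chart_dom p -> chart_bwd (chart_fwd p) = p;
  chart_bwdK : forall x, chart_cod x -> chart_fwd (chart_bwd x) = x;
  chart_fwd_cont : forall p, chart_dom p -> {for p, continuous chart_fwd};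
  chart_bwd_cont : forall x, chart_cod x -> {for x, continuous chart_bwd}
}.

(* A smooth m-manifold without boundary. Each point p has a preferred chart
   [chart_at p] in the atlas, and the tangent space at p is R^m, read in this
   chart. The atlas need not be maximal. *)
Record smooth_manifold (R : realType) (m : nat) (T : topologicalType) :=
  SmoothManifold {
  atlas : set (chart R m T);
  chart_at : T -> chart R m T;
  chart_at_atlas : forall p, atlas (chart_at p);
  chart_at_dom : forall p, chart_dom (chart_at p) p;
  atlas_compat : forall c c', atlas c -> atlas c' ->
    smooth_on (chart_cod c `&` chart_bwd c @^-1` chart_dom c')
      (chart_fwd c' \o chart_bwd c);
  manifold_hausdorff : hausdorff_space T;
  manifold_second_countable : @second_countable T
}.

Section Calculus.
Context {R : realType} {m : nat} {T : topologicalType}.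
Variable X : smooth_manifold R m T.

Definition smooth_fun (O : set T) (f : T -> R) : Prop :=
  forall c, atlas X c ->
    smooth_on (chart_cod c `&` chart_bwd c @^-1` O) (f \o chart_bwd c).

Definition differential (f : T -> R) (p : T) (v : 'rV[R]_m) : R :=
  'D_v (f \o chart_bwd (chart_at X p)) (chart_fwd (chart_at X p) p).

(* The tangent vector at p whose coordinates in the chart c are v. *)
Definition tangent_of_chart (c : chart R m T) (p : T) (v : 'rV[R]_m) :
    'rV[R]_m :=
  'D_v (chart_fwd (chart_at X p) \o chart_bwd c) (chart_fwd c p).

(* Fields of k-covectors; smoothness and alternation are imposed by
   [smooth_form]. *)
Definition dform (k : nat) : Type := T -> covector 'rV[R]_m k.

Definition form_in_chart (k : nat) (c : chart R m T) (w : dform k)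
    (x : 'rV[R]_m) : covector 'rV[R]_m k :=
  fun v => w (chart_bwd c x)
             (fun i => tangent_of_chart c (chart_bwd c x) (v i)).

Definition smooth_form (O : set T) (k : nat) (w : dform k) : Prop :=
  (forall p, O p -> alternating (w p)) /\
  (forall c, atlas X c -> forall v : 'I_k -> 'rV[R]_m,
     smooth_on (chart_cod c `&` chart_bwd c @^-1` O)
       (fun x => form_in_chart c w x v)).

(* Exterior derivative, by the usual formula in the preferred chart at p. *)
Definition ext_d (k : nat) (w : dform k) : dform k.+1 := fun p v =>
  let c := chart_at X p in
  \sum_(i < k.+1) (-1) ^+ i *
    'D_(v i) (fun x => form_in_chart c w x (fun j => v (lift i j)))
      (chart_fwd c p).

(* Smooth forms on a subset W that need not be open (below: a compact domain
   with smooth boundary) are those which extend smoothly to a neighbourhood of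
   W; only the values of w at points of W matter. On a domain with boundary,
   [ext_d w] at a boundary point is determined by w on W, by continuity. *)
Definition form_on (W : set T) (k : nat) (w : dform k) : Prop :=
  exists O : set T, [/\ open O, W `<=` O & smooth_form O w].

Definition closed_form_on (W : set T) (k : nat) (w : dform k) : Prop :=
  form_on W w /\ (forall p, W p -> forall v, ext_d w p v = 0).

Definition cohomologous_on (W : set T) (k : nat) (w w' : dform k.+1) : Prop :=
  exists2 l : dform k, form_on W l &
    forall p, W p -> forall v, w p v - w' p v = ext_d l p v.

(* A class in H^(k+1)_dR(W), as the set of its representatives. *)
Definition deRham_class (W : set T) (k : nat) (w : dform k.+1) :
    set (dform k.+1) :=
  [set w' | closed_form_on W w' /\ cohomologous_on W w' w].

Definition restrict_class (W : set T) (k : nat) (e : set (dform k.+1)) :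
    set (dform k.+1) :=
  [set w' | closed_form_on W w' /\
            exists2 w, e w & cohomologous_on W w' w].

Definition form_scale (k : nat) (a : R) (w : dform k) : dform k :=
  fun p v => a * w p v.

Definition form_wedge (k l : nat) (w : dform k) (w' : dform l) : dform (k + l) :=
  fun p => wedge (w p) (w' p).

Definition form_exp (d : nat) (w : dform d) (k : nat) : dform (k * d) :=
  fun p => wedge_exp (w p) k.

(* An orientation of X is given by a nowhere vanishing top-degree form. *)
Definition volume_form (vol : dform m) : Prop :=
  smooth_form setT vol /\ (forall p, exists v, vol p v != 0).

(* f is a defining function for W, as a domain with smooth boundary, near its
   boundary point p. *)
Definition boundary_defining (W : set T) (p : T) (f : T -> R) : Prop :=
  exists O : set T,
    [/\ open O, O p, smooth_fun O f, W `&` O = [set q | O q /\ 0 <= f q] &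
        f p = 0 /\ exists v, differential f p v != 0].

Definition boundary (W : set T) : set T := W `\` interior W.

(* Domain with smooth boundary: a codimension 0 submanifold with boundary that
   is a closed subset. *)
Definition regular_domain (W : set T) : Prop :=
  closed W /\ (forall p, boundary W p -> exists f, boundary_defining W p f).

Definition boundary_tangent (W : set T) (p : T) : set 'rV[R]_m :=
  [set v | exists2 f, boundary_defining W p f & differential f p v = 0].

Definition outward (W : set T) (p : T) : set 'rV[R]_m :=
  [set v | exists2 f, boundary_defining W p f & differential f p v < 0].

End Calculus.
Arguments dform {R} m T k.
Arguments form_exp {R m T d} w k.

Section Symplectic.
Context {R : realType} {n : nat} {T : topologicalType}.
Variable X : smooth_manifold R (n * 2) T.

(* w is a symplectic form on W inducing the orientation vol. *)
Definition symplectic_on (W : set T) (vol : dform (n * 2) T (n * 2))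
    (w : dform (n * 2) T 2) : Prop :=
  [/\ closed_form_on X W w,
      (forall p, W p -> forall x : 'rV[R]_(n * 2), x != 0 ->
         exists y, eval_cov (w p) [:: x; y] != 0) &
      (forall p, W p -> positive_on setT (vol p) (form_exp w n p))].

(* (W, w) is a weak filling of (G, ker b0), where b0 is the restriction to the
   tangent spaces of G of the 1-form b defined near G (so that d b0 is the
   restriction of d b), and G = boundary W has the boundary orientation, with
   the outward normal first. Here W has dimension 2n. *)
Definition weak_filling (W : set T) (vol : dform (n * 2) T (n * 2))
    (w : dform (n * 2) T 2) (G : set T) (b : dform (n * 2) T 1) : Prop :=
  [/\ compact W /\ regular_domain X W,
      G = boundary W,
      symplectic_on W vol w,
      form_on X G b /\
      (forall p, G p -> forall nu, outward X W p nu ->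
         forall s : seq 'rV[R]_(n * 2), (size s).+1 = (n * 2)%N ->
           (forall x, x \in s -> boundary_tangent X W p x) ->
           0 < eval_cov (vol p) (nu :: s) ->
           0 < eval_cov (form_wedge b (form_exp (ext_d X b) n.-1) p) s) &
      (forall p, G p -> forall k, (k < n)%N ->
         positive_on
           [set x | boundary_tangent X W p x /\ eval_cov (b p) [:: x] = 0]
           (form_exp (ext_d X b) n.-1 p)
           (form_wedge (form_exp (ext_d X b) k) (form_exp w (n.-1 - k)) p))].

End Symplectic.

Section Maps.
Context {R : realType} {m m' : nat} {T T' : topologicalType}.
Variables (X : smooth_manifold R m T) (Y : smooth_manifold R m' T').

Definition smooth_map (O : set T) (F : T -> T') : Prop :=
  (forall p, O p -> {for p, continuous F}) /\
  (forall c c', atlas X c -> atlas Y c' ->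
     smooth_on
       (chart_cod c `&` chart_bwd c @^-1` (O `&` F @^-1` chart_dom c'))
       (chart_fwd c' \o F \o chart_bwd c)).

Definition tangent_map (F : T -> T') (p : T) (v : 'rV[R]_m) : 'rV[R]_m' :=
  'D_v (chart_fwd (chart_at Y (F p)) \o F \o chart_bwd (chart_at X p))
    (chart_fwd (chart_at X p) p).

Definition pullback_form (k : nat) (F : T -> T') (w : dform m' T' k) :
    dform m T k :=
  fun p v => w (F p) (fun i => tangent_map F p (v i)).

End Maps.

Section CircleAction.
Context {R : realType} {m : nat} {T : topologicalType}.
Variable X : smooth_manifold R m T.

(* A smooth action of S^1 = R / (2 pi Z), written as a 2 pi-periodic smooth
   action of R. Joint smoothness is stated in coordinates (t, x) of R x R^m. *)
Definition circle_action (Phi : R -> T -> T) : Prop :=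
  [/\ forall p, Phi 0 p = p,
      forall s t p, Phi (s + t) p = Phi s (Phi t p),
      forall p, Phi (2 * pi) p = p,
      continuous (fun tp : R * T => Phi tp.1 tp.2) &
      forall c c', atlas X c -> atlas X c' ->
        smooth_on
          [set y : 'rV[R]_(1 + m) | chart_cod c (rsubmx y) /\
             chart_dom c' (Phi (lsubmx y 0 0) (chart_bwd c (rsubmx y)))]
          (fun y => chart_fwd c'
                      (Phi (lsubmx y 0 0) (chart_bwd c (rsubmx y))))].

Definition generator (Phi : R -> T -> T) (p : T) : 'rV[R]_m :=
  derive1 (fun t : R => chart_fwd (chart_at X p) (Phi t p)) 0.

Definition invariant_form (Phi : R -> T -> T) (k : nat) (w : dform m T k) :
    Prop :=
  forall t p v, pullback_form X X (Phi t) w p v = w p v.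

Definition connection_form (Phi : R -> T -> T) (psi : dform m T 1) : Prop :=
  [/\ smooth_form X setT psi,
      invariant_form Phi psi &
      forall p, eval_cov (psi p) [:: generator Phi p] = 1].

End CircleAction.

Section CircleBundle.
Context {R : realType} {m m' : nat} {TM TB : topologicalType}.
Variables (M : smooth_manifold R m TM) (B : smooth_manifold R m' TB).

(* The local trivialisation over U is the equivariant diffeomorphism
   (q, exp(it)) |-> Phi t (sigma q) from U x S^1 onto the preimage of U; its
   inverse is p |-> (prj p, (c p, s p)), with S^1 the unit circle of R^2. *)
Definition principal_circle_bundle (prj : TM -> TB) (Phi : R -> TM -> TM) :
    Prop :=
  [/\ smooth_map M B setT prj,
      circle_action M Phi,
      forall t p, prj (Phi t p) = prj p &
      forall b : TB, exists (U : set TB) (sigma : TB -> TM) (c s : TM -> R),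
        [/\ open U /\ U b,
            smooth_map B M U sigma /\ (forall q, U q -> prj (sigma q) = q),
            smooth_fun M (prj @^-1` U) c /\ smooth_fun M (prj @^-1` U) s,
            (forall q, U q -> forall t,
               c (Phi t (sigma q)) = cos t /\ s (Phi t (sigma q)) = sin t) &
            (forall p, U (prj p) -> exists t, p = Phi t (sigma (prj p)))]].

Definition curvature_form (prj : TM -> TB) (psi : dform m TM 1)
    (w : dform m' TB 2) : Prop :=
  closed_form_on B setT w /\
  (forall p v, ext_d M psi p v = pullback_form M B prj w p v).

Definition real_euler_class (prj : TM -> TB) (Phi : R -> TM -> TM)
    (e : set (dform m' TB 2)) : Prop :=
  exists (psi : dform m TM 1) (w : dform m' TB 2),
    [/\ connection_form M Phi psi,
        curvature_form prj psi w &
        e = deRham_class B setT (form_scale (- (2 * pi)^-1) w)].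

End CircleBundle.

Section ContactForms.
Context {R : realType} {n : nat} {T : topologicalType}.
Variable X : smooth_manifold R (n * 2).+1 T.

Definition positive_contact_form (vol : dform (n * 2).+1 T (n * 2).+1)
    (a : dform (n * 2).+1 T 1) : Prop :=
  smooth_form X setT a /\
  (forall p, positive_on setT (vol p)
               (form_wedge a (form_exp (ext_d X a) n) p)).

End ContactForms.

(* Main.v *)
(* On B the contact condition reads u W^n + n W^(n-1) beta du > 0 for
   W = d beta + u omega, omega being the curvature of psi. For a function v > 0
   with dv = du,
     (omega + d (beta / v))^n =
       v^-(n+1) (v (d beta + v omega)^n + n (d beta + v omega)^(n-1) beta du),
   so for v = u + c the right-hand side is a small perturbation of the contact
   condition. By compactness it stays positive for small c, also where u = 0,
   and omega + d (beta / (u + c)) is symplectic on B_+ and cohomologous to omega.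
   On ker beta over the dividing set this form restricts to
   (d beta + c omega) / c, which gives the weak filling inequalities, again for c
   small. On B_- take c < 0 and change the sign of the form. The cohomology class
   e may come from another connection psi'; psi - psi' is the pull-back of a form
   lambda on B, and omega = omega' + d lambda. *)

(* Where u is nonzero, alpha / u = psi + beta / u is again a connection form, and it is a contact
   form exactly when its curvature omega + d (beta / u) is non-degenerate. This is the origin of the
   primitive beta / v; replacing u by u + c moves its pole off the half of B under consideration.
   Two obstacles shape the proof. The tangent space at a point is read in the preferred chart of
   that point, and this chart may jump from point to point: smoothness of d w, the identity d d w =
   0 and every continuity argument must first be carried over to one fixed chart. The filling
   inequalities live on the hyperplanes ker beta of the dividing set, of codimension two in B;
   multiplied by beta /\ du they become positivity statements for top-degree forms on B, so that one
   compactness argument serves both them and the symplectic condition. *)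
Require Import Defs.
From HB Require Import structures.
From mathcomp Require Import all_boot all_order all_fingroup all_algebra.
From mathcomp Require Import all_classical all_reals all_analysis.
From mathcomp Require Import ring lra zify.
Import Order.TTheory GRing.Theory Num.Theory.
Import numFieldNormedType.Exports.
(* MathComp shadows some names of Defs (alternating, wedge). *)
Require Import Defs.
Set Implicit Arguments.
Unset Strict Implicit.
Unset Printing Implicit Defensive.
Local Open Scope classical_set_scope.
Local Open Scope ring_scope.

(** * The signed shuffle algebra of functions on lists of vectors *)

(* Forms of all degrees live in this one ring, so that products of powers need
   no transport along equations between degrees. *)
Definition shuffle_alg (R : comNzRingType) (V : Type) : Type := seq V -> R^o.

HB.instance Definition _ (R : comNzRingType) (V : Type) :=
  GRing.Lmodule.copy (shuffle_alg R V) (seq V -> R^o).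

Section ShuffleAlgebra.
Context {R : comNzRingType} {V : Type}.
Local Notation ext := (shuffle_alg R V).
Implicit Types (a b c : ext) (x y : V) (s t : seq V).

Definition ext_contract x a : ext := fun t => a (x :: t).

Definition grade a : ext := fun t => (-1) ^+ size t * a t.

(* The contraction [ext_contract x] is an antiderivation; read as a
   recursion on the list of arguments, that rule defines the product. *)
Fixpoint shuffle s a b : R :=
  match s with
  | [::] => a [::] * b [::]
  | x :: s' => shuffle s' (ext_contract x a) b + shuffle s' (grade a) (ext_contract x b)
  end.

Definition ext_mul a b : ext := fun s => shuffle s a b.

Definition ext_one : ext := fun s => (nilp s)%:R.

Lemma ext_addE a b s : (a + b) s = a s + b s. Proof. by []. Qed.
Lemma ext_oppE a s : (- a) s = - a s. Proof. by []. Qed.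
Lemma ext_scaleE (k : R) a s : (k *: a) s = k * a s. Proof. by []. Qed.
Lemma ext0E s : (0 : ext) s = 0. Proof. by []. Qed.

Lemma ext_eqP a b : (forall s, a s = b s) -> a = b.
Proof. exact: funext. Qed.

Lemma contractD x a b : ext_contract x (a + b) = ext_contract x a + ext_contract x b.
Proof. by []. Qed.

Lemma contractZ x k a : ext_contract x (k *: a) = k *: ext_contract x a.
Proof. by []. Qed.

Lemma gradeD a b : grade (a + b) = grade a + grade b.
Proof. by apply: ext_eqP => s; rewrite /grade !ext_addE mulrDr. Qed.

Lemma gradeZ k a : grade (k *: a) = k *: grade a.
Proof. by apply: ext_eqP => s; rewrite /grade !ext_scaleE mulrCA. Qed.

Lemma gradeK : involutive grade.
Proof.
by move=> a; apply: ext_eqP => s; rewrite /grade mulrA -exprD addnn -signr_odd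
  odd_double mul1r.
Qed.

Lemma contract_grade x a : ext_contract x (grade a) = - grade (ext_contract x a).
Proof.
by apply: ext_eqP => s; rewrite /ext_contract /grade ext_oppE /= exprS mulN1r mulNr.
Qed.

Lemma shuffleDl s a b c : shuffle s (a + b) c = shuffle s a c + shuffle s b c.
Proof.
elim: s a b c => [|x s IHs] a b c /=; first by rewrite mulrDl.
by rewrite contractD gradeD !IHs addrACA.
Qed.

Lemma shuffleDr s a b c : shuffle s a (b + c) = shuffle s a b + shuffle s a c.
Proof.
elim: s a b c => [|x s IHs] a b c /=; first by rewrite mulrDr.
by rewrite contractD !IHs addrACA.
Qed.

Lemma shuffleZl s k a b : shuffle s (k *: a) b = k * shuffle s a b.
Proof.
elim: s a b => [|x s IHs] a b /=; first by rewrite mulrA.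
by rewrite contractZ gradeZ !IHs mulrDr.
Qed.

Lemma shuffleZr s k a b : shuffle s a (k *: b) = k * shuffle s a b.
Proof.
elim: s a b => [|x s IHs] a b /=; first by rewrite mulrCA.
by rewrite contractZ !IHs mulrDr.
Qed.

Lemma shuffleNl s a b : shuffle s (- a) b = - shuffle s a b.
Proof. by rewrite -scaleN1r shuffleZl mulN1r. Qed.

Lemma shuffleNr s a b : shuffle s a (- b) = - shuffle s a b.
Proof. by rewrite -scaleN1r shuffleZr mulN1r. Qed.

Lemma contract_ext_mul x a b : ext_contract x (ext_mul a b) =
  ext_mul (ext_contract x a) b + ext_mul (grade a) (ext_contract x b).
Proof. by []. Qed.

Lemma grade_ext_mul a b : grade (ext_mul a b) = ext_mul (grade a) (grade b).
Proof.
apply: ext_eqP => s; rewrite /ext_mul; elim: s a b => [|x s IHs] a b.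
  by rewrite /grade /= !mul1r.
rewrite /= !contract_grade shuffleNl shuffleNr -!IHs /grade /= exprS.
by rewrite mulN1r mulNr mulrDr opprD.
Qed.

Lemma ext_mulDl : left_distributive ext_mul +%R.
Proof. by move=> a b c; apply: ext_eqP => s; apply: shuffleDl. Qed.

Lemma ext_mulDr : right_distributive ext_mul +%R.
Proof. by move=> a b c; apply: ext_eqP => s; apply: shuffleDr. Qed.

(** Both sides obey the same contraction rule, because [grade] is multiplicative; induction on the
    arguments then compares them. *)
Lemma ext_mulA : associative ext_mul.
Proof.
move=> a b c; apply: ext_eqP => s.
elim: s a b c => [|x s IHs] a b c; first by rewrite /ext_mul /= mulrA.
rewrite -[LHS]/(ext_contract x (ext_mul a (ext_mul b c)) s).
rewrite -[RHS]/(ext_contract x (ext_mul (ext_mul a b) c) s).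
rewrite !contract_ext_mul grade_ext_mul ext_mulDl ext_mulDr.
by rewrite [LHS]ext_addE [RHS]ext_addE !(ext_addE (ext_mul _ _)) !IHs addrA.
Qed.

Lemma grade_one : grade ext_one = ext_one :> ext.
Proof. by apply: ext_eqP => -[|x s]; rewrite /grade /ext_one /= ?mul1r ?mulr0. Qed.

Lemma contract_one x : ext_contract x ext_one = 0 :> ext.
Proof. by []. Qed.

Lemma shuffle0l s a : shuffle s 0 a = 0.
Proof. by rewrite -(scale0r 0) shuffleZl mul0r. Qed.

Lemma shuffle0r s a : shuffle s a 0 = 0.
Proof. by rewrite -(scale0r 0) shuffleZr mul0r. Qed.

Lemma ext_mul1l : left_id ext_one ext_mul.
Proof.
move=> a; apply: ext_eqP; rewrite /ext_mul => s.
elim: s a => [|x s IHs] a /=; first by rewrite mul1r.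
by rewrite contract_one shuffle0l grade_one IHs add0r.
Qed.

Lemma ext_mul1r : right_id ext_one ext_mul.
Proof.
move=> a; apply: ext_eqP; rewrite /ext_mul => s.
elim: s a => [|x s IHs] a /=; first by rewrite mulr1.
by rewrite contract_one shuffle0r IHs addr0.
Qed.

Lemma ext_one_neq0 : ext_one != 0 :> ext.
Proof.
apply/negP => /eqP /(congr1 (fun a : ext => a [::])) /eqP.
by rewrite ext0E oner_eq0.
Qed.

HB.instance Definition _ := GRing.Zmodule_isNzRing.Build ext
  ext_mulA ext_mul1l ext_mul1r ext_mulDl ext_mulDr ext_one_neq0.

Lemma ext_scalerAl (k : R) a b : k *: (a * b) = k *: a * b.
Proof. by apply: ext_eqP => s; rewrite ext_scaleE -shuffleZl. Qed.

HB.instance Definition _ := GRing.Lmodule_isLalgebra.Build R ext ext_scalerAl.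

Lemma ext_scalerAr (k : R) a b : k *: (a * b) = a * (k *: b).
Proof. by apply: ext_eqP => s; rewrite ext_scaleE -shuffleZr. Qed.

HB.instance Definition _ := GRing.Lalgebra_isAlgebra.Build R ext ext_scalerAr.

Lemma ext_mulE a b s : (a * b) s = shuffle s a b. Proof. by []. Qed.

Lemma contractM x a b :
  ext_contract x (a * b) = ext_contract x a * b + grade a * ext_contract x b.
Proof. by []. Qed.

Lemma contract1 x : ext_contract x 1 = 0 :> ext. Proof. by []. Qed.

(** Commutation depends only on the parity of a. A contraction reverses this parity, so the even and
    the odd case need each other in the induction. *)
Lemma shuffle_supercomm s a b :
  (grade a = a -> shuffle s a b = shuffle s b a) /\
  (grade a = - a -> shuffle s a b = shuffle s (grade b) a).
Proof.
elim: s a b => [|x s IHs] a b /=.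
  by split=> _; rewrite /grade /= ?expr0 ?mul1r mulrC.
split=> ga.
- have gx : grade (ext_contract x a) = - ext_contract x a.
    by rewrite -[in RHS]ga contract_grade opprK.
  by rewrite ga (IHs _ _).2 // (IHs a _).1 // addrC.
- have gx : grade (ext_contract x a) = ext_contract x a.
    by apply: oppr_inj; rewrite -contract_grade ga.
  by rewrite ga shuffleNl (IHs _ _).1 // (IHs a _).2 // contract_grade
    shuffleNl gradeK addrC.
Qed.

Lemma even_comm a b : grade a = a -> a * b = b * a.
Proof. by move=> ga; apply: ext_eqP => s; apply: (shuffle_supercomm s a b).1. Qed.

Lemma odd_comm a b : grade a = - a -> a * b = grade b * a.
Proof. by move=> ga; apply: ext_eqP => s; apply: (shuffle_supercomm s a b).2. Qed.

End ShuffleAlgebra.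

Section Degree.
Context {R : comNzRingType} {V : Type}.
Local Notation ext := (shuffle_alg R V).
Implicit Types (a b c : ext) (x y : V) (s t : seq V).

Definition degree (k : nat) a : Prop := forall s, size s != k -> a s = 0.

Lemma degree_contract k x a : degree k.+1 a -> degree k (ext_contract x a).
Proof. by move=> da s sk; apply: da. Qed.

Lemma degree0_contract x a : degree 0 a -> ext_contract x a = 0.
Proof. by move=> da; apply: ext_eqP => s; apply: da. Qed.

Lemma degree_grade k a : degree k a -> grade a = (-1) ^+ k *: a.
Proof.
move=> da; apply: ext_eqP => s; rewrite ext_scaleE /grade.
by case: (eqVneq (size s) k) => [->|/da ->] //; rewrite !mulr0.
Qed.

Lemma degreeZ k (c : R) a : degree k a -> degree k (c *: a).
Proof. by move=> da s sk; rewrite ext_scaleE da // mulr0. Qed.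

Lemma degreeD k a b : degree k a -> degree k b -> degree k (a + b).
Proof. by move=> da db s sk; rewrite ext_addE da // db // addr0. Qed.

Lemma degreeM k l a b : degree k a -> degree l b -> degree (k + l) (a * b).
Proof.
move=> da db s; rewrite ext_mulE; elim: s k l a b da db => [|x s IHs] k l a b da db.
  case: k da => [|k] da; last by rewrite /= da ?mul0r.
  by case: l db => [|l] db; rewrite //= db ?mulr0.
move=> /= sk; rewrite (degree_grade da) shuffleZl.
case: k da sk => [|k] da sk.
  rewrite (degree0_contract x da) shuffle0l add0r.
  case: l db sk => [|l] db sk; first by rewrite (degree0_contract x db) shuffle0r mulr0.
  by rewrite (IHs 0%N l) ?mulr0 //; apply: degree_contract.
rewrite (IHs k l) ?add0r //; last exact: degree_contract.
case: l db sk => [|l] db sk; first by rewrite (degree0_contract x db) shuffle0r mulr0.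
rewrite (IHs k.+1 l) ?mulr0 //; first exact: degree_contract.
by move: sk; rewrite addnS.
Qed.

Lemma degree1 : degree 0 (1 : ext).
Proof. by case. Qed.

Lemma degree_exp d a k : degree d a -> degree (k * d) (a ^+ k).
Proof.
move=> da; elim: k => [|k IHk]; first by rewrite expr0; apply: degree1.
by rewrite exprS mulSn; apply: degreeM.
Qed.

Lemma degree2_comm a b : degree 2 a -> a * b = b * a.
Proof. by move=> da; apply: even_comm; rewrite (degree_grade da) -signr_odd scale1r. Qed.

Lemma degree1_anticomm a b : degree 1 a -> degree 1 b -> a * b = - (b * a).
Proof.
move=> da db; rewrite odd_comm ?(degree_grade da) ?scaleN1r //.
by rewrite (degree_grade db) scaleN1r mulNr.
Qed.

(** Swaps of neighbours generate all permutations, and in this form the condition passes through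
    inductions on the list. *)
Definition skew a : Prop :=
  forall s x y t, a (s ++ x :: y :: t) = - a (s ++ y :: x :: t).

Lemma skew_contract x a : skew a -> skew (ext_contract x a).
Proof. by move=> ka s; apply: (ka (x :: s)). Qed.

Lemma skew_contract2 x y a : skew a ->
  ext_contract x (ext_contract y a) = - ext_contract y (ext_contract x a).
Proof. by move=> ka; apply: ext_eqP => s; apply: (ka [::]). Qed.

Lemma skewZ (k : R) a : skew a -> skew (k *: a).
Proof. by move=> ka s x y t; rewrite !ext_scaleE ka mulrN. Qed.

Lemma skewD a b : skew a -> skew b -> skew (a + b).
Proof. by move=> ka kb s x y t; rewrite !ext_addE ka kb opprD. Qed.

Lemma skew_grade a : skew a -> skew (grade a).
Proof. by move=> ka s x y t; rewrite /grade ka !size_cat /= mulrN. Qed.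

Lemma skewM a b : skew a -> skew b -> skew (a * b).
Proof.
move=> ka kb s x y t; rewrite !ext_mulE.
elim: s a b ka kb => [|z s IHs] a b ka kb /=; last first.
  by rewrite !IHs ?opprD //; do ?[exact: skew_contract | exact: skew_grade].
(* Contraction with x and y gives four terms. Those with both contractions on one factor change sign
   by skewness; the two mixed terms are exchanged, with the sign from [contract_grade]. *)
rewrite (skew_contract2 x y ka) (skew_contract2 x y kb) !contract_grade.
by rewrite !(shuffleNl, shuffleNr) gradeK; ring.
Qed.

Lemma skew1 : skew 1.
Proof. by move=> [|? ?] x y t; rewrite oppr0. Qed.

Lemma skew_exp a k : skew a -> skew (a ^+ k).
Proof.
move=> ka; elim: k => [|k IHk]; first by rewrite expr0; apply: skew1.
by rewrite exprS; apply: skewM.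
Qed.

Lemma skew_deg1 a : degree 1 a -> skew a.
Proof. by move=> da s x y t; rewrite !da ?oppr0 // size_cat !addnS. Qed.

(* Contracting a degree-k factor with each argument in turn counts every shuffle
   k times; this is what cancels the factorials in [wedge]. *)
Lemma sum_contract k a b s v0 : skew a -> degree k a ->
  \sum_(i < size s)
     (-1) ^+ i * shuffle (take i s ++ drop i.+1 s) (ext_contract (nth v0 s i) a) b =
  k%:R * shuffle s a b.
Proof.
elim: s k a b => [|x s IHs] k a b ka da.
  by rewrite big_ord0; case: k da => [|k] da; rewrite ?mul0r //= da ?mul0r ?mulr0.
rewrite big_ord_recl /= drop0 expr0 mul1r.
under eq_bigr => i _.
  rewrite /bump /= add1n add0n exprS mulN1r mulNr.
  rewrite (skew_contract2 _ _ ka) shuffleNl -[grade _]opprK -contract_grade.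
  rewrite shuffleNl -opprD mulrN opprK mulrDr.
  over.
rewrite big_split /= (IHs k _ _ (skew_grade ka)); last first.
  by rewrite (degree_grade da); apply: degreeZ.
case: k da => [|k] da.
  rewrite (degree0_contract x da) shuffle0l !mul0r add0r addr0.
  by rewrite big1 // => i _; rewrite shuffle0l mulr0.
rewrite (IHs k); [|exact: skew_contract|exact: degree_contract].
by rewrite -natr1; ring.
Qed.

End Degree.

Section Multilinear.
Context {R : comNzRingType} {V : lmodType R}.
Local Notation ext := (shuffle_alg R V).
Implicit Types (a b : ext) (x y : V) (s t : seq V).

Definition multilin a : Prop := forall s (k : R) x y t,
  a (s ++ (k *: x + y) :: t) = k * a (s ++ x :: t) + a (s ++ y :: t).

Lemma multilin_contract x a : multilin a -> multilin (ext_contract x a).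
Proof. by move=> ma s; apply: (ma (x :: s)). Qed.

Lemma multilinD a b : multilin a -> multilin b -> multilin (a + b).
Proof. by move=> ma mb s k x y t; rewrite !ext_addE ma mb; ring. Qed.

Lemma multilinZ (c : R) a : multilin a -> multilin (c *: a).
Proof. by move=> ma s k x y t; rewrite !ext_scaleE ma; ring. Qed.

Lemma multilin_grade a : multilin a -> multilin (grade a).
Proof. by move=> ma s k x y t; rewrite /grade ma !size_cat /=; ring. Qed.

Lemma contract_lin k x y a : multilin a ->
  ext_contract (k *: x + y) a = k *: ext_contract x a + ext_contract y a.
Proof. by move=> ma; apply: ext_eqP => s; apply: (ma [::]). Qed.

Lemma multilinM a b : multilin a -> multilin b -> multilin (a * b).
Proof.
move=> ma mb s k x y t; rewrite !ext_mulE.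
elim: s a b ma mb => [|z s IHs] a b ma mb /=; last first.
  by rewrite !IHs; do ?[exact: multilin_contract | exact: multilin_grade | done]; ring.
by rewrite !contract_lin // !(shuffleDl, shuffleDr) !shuffleZl !shuffleZr; ring.
Qed.

Lemma multilin1 : multilin 1.
Proof. by move=> [|? ?] k x y t; rewrite mulr0 addr0. Qed.

Lemma multilin_exp a k : multilin a -> multilin (a ^+ k).
Proof.
move=> ma; elim: k => [|k IHk]; first by rewrite expr0; apply: multilin1.
by rewrite exprS; apply: multilinM.
Qed.

End Multilinear.

(** * Comparison of the recursive product with sums over permutations *)

Section AlternatingSum.
Context {R : comNzRingType} {V : zmodType}.
Local Notation ext := (shuffle_alg R V).
Implicit Types (a b : ext) (s t : seq V).

Definition alt_sum n a s : R :=
  \sum_(p : 'S_n) (-1) ^+ p * a [seq s`_(p i) | i <- enum 'I_n].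

(** Laplace expansion along the first argument: a permutation of n + 1 indices amounts to the image
    i of 0 and a permutation of the other indices, and its sign is (-1)^i times the sign of the
    latter. *)
Lemma alt_sum_recl n a s : size s = n.+1 ->
  alt_sum n.+1 a s =
  \sum_(i < n.+1)
    (-1) ^+ i * alt_sum n (ext_contract s`_i a) (take i s ++ drop i.+1 s).
Proof.
move=> sz; under [RHS]eq_bigr do rewrite /alt_sum big_distrr.
rewrite pair_bigA /= /alt_sum.
pose h (q : 'I_n.+1 * 'S_n) : 'S_n.+1 := lift_perm ord0 q.1 q.2.
have inj_h : injective h.
  move=> [i p] [j q] /permP e; have := e ord0; rewrite /h !lift_perm_id /= => ij.
  move: e; rewrite -{}ij => e; congr (_, _); apply/permP => k.
  by have := e (lift ord0 k); rewrite !lift_perm_lift => /lift_inj.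
have bij_h : bijective h.
  by apply: inj_card_bij => //; rewrite card_prod !card_Sn card_ord factS.
rewrite (reindex h) /=; last exact: onW_bij.
apply: eq_bigr => -[i p] _ /=; rewrite /h mulrA odd_lift_perm signr_addb.
rewrite signr_odd; congr (_ * _).
rewrite enum_ordSl /= lift_perm_id /ext_contract; congr (a (_ :: _)).
rewrite -map_comp; apply: eq_map => j /=; rewrite lift_perm_lift /=.
have szi : size (take i s) = i by rewrite size_takel // sz ltnW.
rewrite nth_cat szi; case: ltnP => pj.
  by rewrite nth_take // /bump leqNgt pj.
by rewrite nth_drop /bump pj add1n addSn subnKC.
Qed.

Lemma alt_sumZ n k a s : alt_sum n (k *: a) s = k * alt_sum n a s.
Proof.
rewrite /alt_sum big_distrr; apply: eq_bigr => p _.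
by rewrite ext_scaleE mulrCA.
Qed.

Lemma size_del (T : Type) i n (s : seq T) : size s = n.+1 -> (i < n.+1)%N ->
  size (take i s ++ drop i.+1 s) = n.
Proof. by move=> sz ltin; rewrite size_cat size_drop size_take sz; case: ifP; lia. Qed.

Lemma alt_sum_skew l b s : skew b -> degree l b -> size s = l ->
  alt_sum l b s = l`!%:R * b s.
Proof.
elim: l b s => [|l IHl] b s kb db sz.
  rewrite /alt_sum (big_pred1 1%g) => [|p]; last first.
    by apply/esym/eqP/permP => -[].
  rewrite odd_perm1 expr0 (size0nil sz) !mul1r.
  by case: (enum 'I_0) (size_enum_ord 0).
rewrite alt_sum_recl // factS [(l.+1 * _)%N]mulnC natrM -mulrA.
(* With second factor 1, [sum_contract] turns the sum over the first argument into the factor l +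
   1. *)
have := @sum_contract _ _ l.+1 b 1 s 0 kb db; rewrite sz -ext_mulE mulr1 => <-.
rewrite big_distrr; apply: eq_bigr => i _.
rewrite IHl ?(size_del sz) //; [|exact: skew_contract|exact: degree_contract].
by rewrite -ext_mulE mulr1 mulrCA.
Qed.

(** Links the recursive product to the sum over permutations in [wedge]. Each expansion along an
    argument of a lowers k by one and costs the factor k of [sum_contract]; once a is a scalar, b
    contributes l!. *)
Lemma alt_sum_shuffle k l a b s : skew a -> degree k a -> skew b -> degree l b ->
  size s = (k + l)%N ->
  alt_sum (k + l) (fun t => a (take k t) * b (drop k t) : R^o) s =
  (k`! * l`!)%:R * shuffle s a b.
Proof.
move=> + + kb db; elim: k a s => [|k IHk] a s ka da sz.
  have -> : (fun t => a (take 0 t) * b (drop 0 t) : R^o) = (a [::] : R) *: (b : ext).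
    by apply/funext => t; rewrite take0 drop0.
  have {2}-> : a = (a [::] : R) *: (1 : ext).
    apply: ext_eqP => t; rewrite ext_scaleE; case: t => [|x t]; first by rewrite mulr1.
    by rewrite da // mulr0.
  rewrite alt_sumZ (alt_sum_skew kb db sz) shuffleZl -ext_mulE mul1r mul1n.
  by rewrite mulrCA.
rewrite alt_sum_recl ?sz // factS -mulnA [(k.+1 * _)%N]mulnC natrM -mulrA.
have := @sum_contract _ _ k.+1 a b s 0 ka da; rewrite sz => <-.
rewrite big_distrr; apply: eq_bigr => i _.
rewrite [ext_contract _ _](_ : _ = (fun t => ext_contract s`_i a (take k t) * b (drop k t))) //.
rewrite IHk ?(size_del sz) //; [|exact: skew_contract|exact: degree_contract].
by rewrite mulrCA.
Qed.

End AlternatingSum.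

Section CovectorAlgebra.
Context {R : realType} {V : lmodType R}.
Local Notation ext := (shuffle_alg R V).

(** [eval_cov] fills missing arguments with 0 and ignores surplus ones; the cut-off at length k
    makes the result homogeneous of degree k. *)
Definition cov_ext k (a : covector V k) : ext :=
  fun s => if size s == k then eval_cov a s else 0.

Lemma cov_extE k (a : covector V k) s : size s = k -> cov_ext a s = eval_cov a s.
Proof. by rewrite /cov_ext => ->; rewrite eqxx. Qed.

Lemma degree_cov k (a : covector V k) : degree k (cov_ext a).
Proof. by move=> s /negbTE; rewrite /cov_ext => ->. Qed.

Lemma multilin_cov k (a : covector V k) : alternating a -> multilin (cov_ext a).
Proof.
move=> [lin_a _] s c x y t; rewrite /cov_ext !size_cat /=.
case: eqP => [sz|_]; last by rewrite mulr0 addr0.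
have ltk : (size s < k)%N by rewrite -sz addnS ltnS leq_addr.
(* Linearity in [alternating] concerns one entry of a family indexed by ['I_k]; the family used here
   is the list with 0 as a placeholder at position [size s]. *)
have val z : eval_cov a (s ++ z :: t) =
    a (fun j => if j == Ordinal ltk then z else (s ++ 0 :: t)`_j).
  rewrite /eval_cov; congr (a _); apply/funext => j; rewrite !nth_cat.
  rewrite -val_eqE /=; case: ltngtP => // [|->]; last by rewrite subnn.
  by move=> ltj; case: (j - size s)%N (subn_gt0 (size s) j) => //; rewrite ltj.
by rewrite !val lin_a.
Qed.

(** Polarisation: the value with both neighbouring arguments equal to x + y is 0 and expands into
    four terms, two of which vanish. *)
Lemma skew_cov k (a : covector V k) : alternating a -> skew (cov_ext a).
Proof.
move=> alt_a s x y t; have ml := multilin_cov alt_a.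
have diag z : cov_ext a (s ++ z :: z :: t) = 0.
  rewrite /cov_ext; case: eqP => // sz; rewrite size_cat /= in sz.
  have i_lt : (size s < k)%N by rewrite -sz addnS ltnS leq_addr.
  have j_lt : ((size s).+1 < k)%N by rewrite -sz !addnS !ltnS leq_addr.
  apply: (alt_a.2 _ (Ordinal i_lt) (Ordinal j_lt)).
    by rewrite -val_eqE /= neq_ltn ltnSn.
  by rewrite /= !nth_cat ltnn ltnNge leqnSn /= subnn subSnn.
have addl p q z : cov_ext a (s ++ (p + q) :: z :: t) =
    cov_ext a (s ++ p :: z :: t) + cov_ext a (s ++ q :: z :: t).
  by have := ml s 1 p q (z :: t); rewrite scale1r mul1r.
have addr p q z : cov_ext a (s ++ z :: (p + q) :: t) =
    cov_ext a (s ++ z :: p :: t) + cov_ext a (s ++ z :: q :: t).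
  by have := ml (s ++ [:: z]) 1 p q t; rewrite scale1r mul1r -!catA.
have := diag (x + y); rewrite addl !addr !diag addr0 add0r => /eqP.
by rewrite addr_eq0 => /eqP.
Qed.

(** The factor k! l! of [alt_sum_shuffle] cancels the normalisation of [wedge]. This transfers wedge
    products and powers to the ring. *)
Lemma cov_ext_wedge k l (a : covector V k) (b : covector V l) :
  skew (cov_ext a) -> skew (cov_ext b) ->
  cov_ext (wedge a b) = cov_ext a * cov_ext b.
Proof.
move=> ka kb; apply: ext_eqP => s.
have [sz|sz] := eqVneq (size s) (k + l)%N; last first.
  rewrite [RHS](degreeM (degree_cov a) (degree_cov b)) //.
  by rewrite /cov_ext (negbTE sz).
rewrite cov_extE // /eval_cov /wedge ext_mulE.
have fact_neq0 : (k`! * l`!)%:R != 0 :> R by rewrite pnatr_eq0 -lt0n muln_gt0 !fact_gt0.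
rewrite -[RHS](mulKf fact_neq0).
rewrite -(alt_sum_shuffle ka (degree_cov a) kb (degree_cov b) sz).
congr (_ * _); apply: eq_bigr => p _.
congr (_ * _); set f := fun i => _; set L := map _ _.
have szL : size L = (k + l)%N by rewrite size_map size_enum_ord.
have nthL i : L`_(nat_of_ord i) = s`_(p i).
  by rewrite (nth_map i) ?size_enum_ord // nth_ord_enum.
rewrite !cov_extE /eval_cov ?size_takel ?size_drop ?szL ?leq_addr ?addKn //.
by congr (a _ * b _); apply/funext => i;
   rewrite ?/f -nthL ?nth_take // ?nth_drop.
Qed.

Lemma cov_ext_exp d (a : covector V d) k :
  skew (cov_ext a) -> cov_ext (wedge_exp a k) = cov_ext a ^+ k.
Proof.
move=> ka; elim: k => [|k IHk].
  by rewrite expr0; apply: ext_eqP => -[|x s].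
by rewrite exprS -IHk -cov_ext_wedge // IHk; apply: skew_exp.
Qed.

Lemma cov_extZ k (a : covector V k) (c : R) :
  cov_ext (fun v => c * a v) = c *: cov_ext a.
Proof.
apply: ext_eqP => s; rewrite ext_scaleE /cov_ext.
by case: ifP => // _; rewrite mulr0.
Qed.

End CovectorAlgebra.

(** * Algebra of one-forms and of the contact condition *)

Section DegreeOne.
Context {R : comNzRingType} {V : Type}.
Local Notation ext := (shuffle_alg R V).
Implicit Types (a b c w : ext) (x y : V) (s t : seq V).

Lemma contract_deg1 a x : degree 1 a -> ext_contract x a = (a [:: x] : R) *: (1 : ext).
Proof.
move=> da; apply: ext_eqP => -[|y s]; rewrite ext_scaleE.
  by rewrite mulr1.
by rewrite [RHS]mulr0; apply: da.
Qed.

Lemma deg1_mul_cons a b x s : degree 1 a ->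
  (a * b) (x :: s) = a [:: x] * b s - (a * ext_contract x b) s.
Proof.
move=> da; rewrite -[LHS]/(ext_contract x (a * b) s) contractM ext_addE.
rewrite (contract_deg1 _ da) (degree_grade da) scaleN1r mulNr.
by rewrite -scalerAl mul1r.
Qed.

(** Every term of the product evaluates a on some argument. Membership is [List.In] because V is a
    bare type here. *)
Lemma deg1_mul_kill a b s : degree 1 a -> (forall x, List.In x s -> a [:: x] = 0) ->
  (a * b) s = 0.
Proof.
move=> da; elim: s b => [|x s IHs] b ks; first by rewrite ext_mulE /= da // mul0r.
rewrite deg1_mul_cons // ks; last by left.
by rewrite IHs ?subr0 ?mul0r // => y sy; apply: ks; right.
Qed.

(** Evaluates a form divisible by a b on a frame whose vectors after the first two lie in both
    kernels. With beta and du as the two factors it relates inequalities on ker beta inside the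
    dividing set to inequalities between top-degree forms. *)
Lemma deg1_mul2_cons2 a b c x y s : degree 1 a -> degree 1 b ->
  (forall z, List.In z s -> a [:: z] = 0) ->
  (forall z, List.In z s -> b [:: z] = 0) ->
  (a * b * c) (x :: y :: s) = (a [:: x] * b [:: y] - a [:: y] * b [:: x]) * c s.
Proof.
move=> da db ka kb; rewrite -mulrA deg1_mul_cons // deg1_mul_cons //.
rewrite deg1_mul_kill // subr0 deg1_mul_cons // (deg1_mul_kill _ da ka) // subr0.
rewrite -[ext_contract x (b * c) s]/((b * c) (x :: s)) deg1_mul_cons //.
rewrite (deg1_mul_kill _ db kb) // subr0; ring.
Qed.

End DegreeOne.

Section ContactAlgebra.
Context {R : numFieldType} {V : Type}.
Local Notation ext := (shuffle_alg R V).
Implicit Types (a b c w : ext) (x y : V) (s t : seq V).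

Lemma deg1_sqr0 a : degree 1 a -> a * a = 0.
Proof.
move=> da; have /eqP := degree1_anticomm da da.
by rewrite -addr_eq0 -mulr2n -scaler_nat scaler_eq0 pnatr_eq0 /= => /eqP.
Qed.

Lemma deg1_prod_sqr0 a b : degree 1 a -> degree 1 b -> (a * b) * (a * b) = 0.
Proof.
move=> da db; rewrite mulrA -[a * b * a]mulrA (degree1_anticomm db da) mulrN mulrA.
by rewrite (deg1_sqr0 da) mul0r oppr0 mul0r.
Qed.

(** The binomial expansion stops after the linear term, since c has square zero and commutes with w.
    For n = 0 the exponent [n.-1] is 0 as well, but its coefficient vanishes. *)
Lemma exp_add_sqr0 w c (k : R) n : degree 2 w -> c * c = 0 ->
  (w + k *: c) ^+ n = w ^+ n + (k *+ n) *: (w ^+ n.-1 * c).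
Proof.
move=> dw cc; elim: n => [|n IHn]; first by rewrite !expr0 mulr0n scale0r addr0.
rewrite exprSr {}IHn mulrDl !mulrDr -exprSr -!addrA; congr (_ + _).
rewrite -!scalerAl -!scalerAr -[_ * c * c]mulrA cc mulr0 !scaler0 addr0.
case: n => [|n]; first by rewrite !expr0 !mul1r mulr0n scale0r addr0 mulr1n.
rewrite /= -[w ^+ n * c * w]mulrA -(degree2_comm _ dw) mulrA -exprSr -scalerDl.
by rewrite -mulrS.
Qed.

(* With w = d beta + u omega, this is the contraction of alpha /\ (d alpha)^n
   with the generator of the action (see [contract_contact_form]), and also, up
   to a power of u, the n-th power of omega + d (beta / u) (see
   [exp_exact_perturbation]). *)
Definition contact_top n (u : R) (w b du : ext) : ext :=
  u *: w ^+ n + n%:R *: (w ^+ n.-1 * (b * du)).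

(** Here w stands for omega and e for d beta, so that the 2-form inside [contact_top] is e + v w.
    Taking out v^-1 leaves a perturbation by v^-1 b du, whose square is zero. *)
Lemma exp_exact_perturbation n (v : R) (w e b du : ext) :
  v != 0 -> degree 2 w -> degree 2 e -> degree 1 b -> degree 1 du ->
  (w + (v^-1 *: e + v ^- 2 *: (b * du))) ^+ n =
  v ^- n.+1 *: contact_top n v (e + v *: w) b du.
Proof.
move=> v0 dw de db ddu.
have -> : w + (v^-1 *: e + v ^- 2 *: (b * du)) =
    v^-1 *: ((e + v *: w) + v^-1 *: (b * du)).
  rewrite !scalerDr !scalerA mulVf // scale1r addrA [w + _]addrC.
  by rewrite -invfM -expr2.
have dew : degree 2 (e + v *: w) by exact/degreeD/degreeZ.
rewrite exprZn exp_add_sqr0 //; last exact: deg1_prod_sqr0.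
rewrite /contact_top !scalerDr !scalerA exprS invfM -exprVn.
rewrite mulrAC mulVf // mul1r; congr (_ + _ *: _).
by rewrite mulr_natr mulrnAr mulrC.
Qed.

Lemma contract_even_exp x w n : degree 2 w -> ext_contract x w = 0 ->
  ext_contract x (w ^+ n) = 0.
Proof.
move=> dw kw; elim: n => [|n IHn]; first by rewrite expr0 contract1.
by rewrite exprS contractM kw IHn mul0r mulr0 addr0.
Qed.

(** In the application x generates the circle action and w + du psi is d alpha. Besides the terms of
    [contact_top] the antiderivation rule yields n u w^(n-1) (du psi + psi du), which is zero. *)
Lemma contract_contact_form x n (u : R) (w b du psi : ext) :
  degree 2 w -> degree 1 b -> degree 1 du -> degree 1 psi ->
  ext_contract x w = 0 -> b [:: x] = 0 -> du [:: x] = 0 -> psi [:: x] = 1 ->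
  ext_contract x ((b + u *: psi) * (w + du * psi) ^+ n) = contact_top n u w b du.
Proof.
move=> dw db ddu dpsi kw kb kdu kpsi.
have dwk : degree (n.-1 * 2) (w ^+ n.-1) by apply: degree_exp.
have gw : grade (w ^+ n.-1) = w ^+ n.-1.
  by rewrite (degree_grade dwk) mulnC exprM sqrrN !expr1n scale1r.
have wC c : w ^+ n.-1 * c = c * w ^+ n.-1.
  by apply: commr_sym; apply: commrX; apply: commr_sym; apply: degree2_comm.
have cb : ext_contract x b = 0 by rewrite contract_deg1 // kb scale0r.
have cdu : ext_contract x du = 0 by rewrite contract_deg1 // kdu scale0r.
have cpsi : ext_contract x psi = 1 by rewrite contract_deg1 // kpsi scale1r.
rewrite -[du * psi]scale1r exp_add_sqr0 //; last exact: deg1_prod_sqr0.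
rewrite contractM contractD contractZ cb cpsi add0r.
rewrite contractD contractZ !contractM contract_even_exp // cdu cpsi mul0r add0r.
rewrite contract_even_exp // mul0r !add0r mulr1 gw (degree_grade ddu) scaleN1r.
rewrite gradeD gradeZ (degree_grade db) (degree_grade dpsi) !scaleN1r scalerN -opprD.
rewrite mulrN scalerN mulrNN -scalerAl mul1r scalerDr -addrA; congr (_ + _).
rewrite -scalerAr mulrDl -scalerAl !mulrA -!wC -!mulrA (degree1_anticomm dpsi ddu).
rewrite mulrN scalerN scalerBr !scalerA mulrC addrCA subrr addr0.
by [].
Qed.

End ContactAlgebra.

Section Pullback.
Context {R : comNzRingType} {V W : Type}.

Definition ext_pull (f : V -> W) (a : shuffle_alg R W) : shuffle_alg R V :=
  fun s => a (map f s).

Lemma ext_pullM f a b : ext_pull f (a * b) = ext_pull f a * ext_pull f b.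
Proof.
apply: ext_eqP => s; rewrite /ext_pull !ext_mulE.
elim: s a b => [|x s IHs] a b //=; rewrite !IHs; congr (_ + shuffle _ _ _).
by apply: ext_eqP => t; rewrite /grade size_map.
Qed.

Lemma ext_pull1 f : ext_pull f 1 = 1.
Proof. by apply: ext_eqP => -[]. Qed.

Lemma ext_pull_exp f a n : ext_pull f (a ^+ n) = ext_pull f a ^+ n.
Proof.
elim: n => [|n IHn]; first by rewrite !expr0 ext_pull1.
by rewrite !exprS ext_pullM IHn.
Qed.

Lemma ext_pullD f a b : ext_pull f (a + b) = ext_pull f a + ext_pull f b.
Proof. by []. Qed.

Lemma ext_pullZ f (k : R) a : ext_pull f (k *: a) = k *: ext_pull f a.
Proof. by []. Qed.

Lemma degree_pull f k a : degree k a -> degree k (ext_pull f a).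
Proof. by move=> da s sk; apply: da; rewrite size_map. Qed.

Lemma pull_contact_top f n (u : R) w b du : ext_pull f (u *: w ^+ n + n%:R *: (w ^+ n.-1 * (b * du))) =
  u *: (ext_pull f w) ^+ n + n%:R *: (ext_pull f w ^+ n.-1 * (ext_pull f b * ext_pull f du)).
Proof. by rewrite ext_pullD !ext_pullZ !ext_pullM !ext_pull_exp. Qed.

End Pullback.

(** * Forms of top degree *)

Section TopForms.
Context {R : realType} {m : nat}.
Local Notation V := 'rV[R]_m.
Local Notation ext := (shuffle_alg R V).
Implicit Types (a b c : ext) (x y : V) (s t : seq V).

Lemma skew_move a s x t u : skew a ->
  a (u ++ s ++ x :: t) = (-1) ^+ size s * a (u ++ x :: s ++ t).
Proof.
move=> ka; elim: s u => [|y s IHs] u /=; first by rewrite mul1r.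
rewrite -cat_rcons IHs cat_rcons ka exprS mulN1r mulNr mulrN //.
Qed.

Lemma skew_perm0 a s t : skew a -> perm_eq s t -> a t = 0 -> a s = 0.
Proof.
elim: s t a => [|x s IHs] t a ka; first by rewrite perm_sym => /perm_nilP ->.
move=> pst; have xt : x \in t by rewrite -(perm_mem pst) mem_head.
move: pst; case/splitPr: xt => t1 t2 pst.
have := skew_move t1 x t2 [::] ka => /= -> /eqP.
rewrite mulf_eq0 signr_eq0 /= => /eqP at0.
apply: (IHs (t1 ++ t2) (ext_contract x a)) => //; first exact: skew_contract.
by move: pst; rewrite perm_sym -[x :: t2]cat1s perm_catCA /= perm_cons perm_sym.
Qed.

Lemma skew_dup0 a s : skew a -> ~~ uniq s -> a s = 0.
Proof.
elim: s a => //= x s IHs a ka; rewrite negb_and negbK => /orP[|us]; last first.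
  exact (IHs (ext_contract x a) (skew_contract x ka) us).
case/splitPr => s1 s2.
have := skew_move s1 x s2 [:: x] ka => /= ->.
have := ka [::] x x (s1 ++ s2) => /= /eqP.
by rewrite -addr_eq0 -mulr2n mulrn_eq0 /= => /eqP ->; rewrite mulr0.
Qed.

Lemma multilin_sum a s t I (r : seq I) (k : I -> R) (x : I -> V) : multilin a ->
  a (s ++ (\sum_(i <- r) k i *: x i) :: t) =
  \sum_(i <- r) k i * a (s ++ x i :: t).
Proof.
move=> ma; elim: r => [|i r IHr]; last by rewrite !big_cons ma IHr.
rewrite !big_nil; have := ma s (-1) 0 0 t.
by rewrite scaler0 addr0 mulN1r addNr.
Qed.

Definition std_frame : seq V := [seq delta_mx 0 i | i <- enum 'I_m].

(** Arguments are expanded in the standard basis one at a time; the basis vectors that result either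
    repeat, which gives 0, or permute the standard frame. *)
Lemma std_frame0 a : multilin a -> skew a -> a std_frame = 0 ->
  forall s, size s = m -> a s = 0.
Proof.
move=> ma ka a0.
have basis (l : seq 'I_m) : size l = m -> a [seq delta_mx 0 i | i <- l] = 0.
  move=> sl; case: (boolP (uniq l)) => ul; last first.
    apply: skew_dup0 => //; apply: contra ul; rewrite map_inj_uniq // => i j.
    move=> /rowP /(_ j); rewrite !mxE eqxx /=; case: eqVneq => //= _ /eqP.
    by rewrite eqxx eq_sym oner_eq0.
  apply: (skew_perm0 ka) a0; apply: perm_map.
  apply: uniq_perm => //; first exact: enum_uniq.
  have sub : {subset l <= enum 'I_m} by move=> i _; rewrite mem_enum.
  by apply: (uniq_min_size ul sub _).2; rewrite sl size_enum_ord.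
(* [l] records the arguments that have already been replaced by basis vectors. *)
suff gen s (l : seq 'I_m) : (size l + size s)%N = m ->
    a ([seq delta_mx 0 i | i <- l] ++ s) = 0 by move=> s; apply: (gen s [::]).
elim: s l => [|x s IHs] l; first by rewrite addn0 cats0; apply: basis.
move=> sz; rewrite (row_sum_delta x) multilin_sum // big1 // => i _.
have := IHs (rcons l i); rewrite map_rcons cat_rcons size_rcons addSnnS => -> //.
by rewrite mulr0.
Qed.

(** The top-degree forms make up a line. The cross-multiplied equation involves no generator of it
    and covers forms that vanish. *)
Lemma top_proportional a b s t : multilin a -> skew a -> multilin b -> skew b ->
  size s = m -> size t = m -> a s * b t = a t * b s.
Proof.
move=> ma ka mb kb.
have step c d r : multilin c -> skew c -> multilin d -> skew d -> size r = m ->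
    c std_frame * d r = d std_frame * c r.
  move=> mc kc md kd sr; apply/eqP; rewrite -subr_eq0 -mulNr; apply/eqP.
  have f0 : ((c std_frame : R) *: d + (- d std_frame : R) *: c) std_frame = 0.
    by rewrite ext_addE !ext_scaleE mulNr mulrC subrr.
  apply: (std_frame0 _ _ f0 sr); first by apply: multilinD; apply: multilinZ.
  by apply: skewD; apply: skewZ.
move=> ss st; case: (eqVneq (a std_frame) 0) => [a0|an0].
  by rewrite !(std_frame0 ma ka a0) // !mul0r.
apply: (mulfI an0); rewrite mulrCA [RHS]mulrCA !(step a b) //.
by rewrite mulrCA [RHS]mulrCA mulrC [_ * a s]mulrC; ring.
Qed.

(** If coordinate j of x is nonzero, then x may replace vector j of the standard frame at the cost
    of this factor. Applied to the n-th power of a 2-form, it derives non-degeneracy from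
    non-vanishing of the power. *)
Lemma top_nondegenerate a x : multilin a -> skew a -> x != 0 ->
  (forall s, (size s).+1 = m -> a (x :: s) = 0) -> forall s, size s = m -> a s = 0.
Proof.
move=> ma ka /rV0Pn[j xj] ax; apply: std_frame0 => //.
have /splitPr : j \in enum 'I_m by rewrite mem_enum.
move defe : (enum 'I_m) => e ee; case: ee defe => e1 e2 defe.
have sz : (size e1 + size e2).+1 = m.
  by rewrite -addnS -[(size e2).+1]/(size (j :: e2)) -size_cat -defe size_enum_ord.
pose f := fun i : 'I_m => delta_mx 0 i : V.
have : a (map f e1 ++ x :: map f e2) = 0.
  have := skew_move (map f e1) x (map f e2) [::] ka => /= ->.
  by rewrite ax ?mulr0 // size_cat !size_map.
rewrite {1}(row_sum_delta x) multilin_sum // (bigD1 j) //= big1 => [|i ij].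
  rewrite addr0 => /eqP; rewrite mulf_eq0 (negbTE xj) /= => /eqP.
  by rewrite /std_frame defe map_cat.
rewrite (skew_dup0 ka) ?mulr0 // -[f i :: _]/(map f (i :: e2)) -map_cat.
apply/negP => /map_uniq ue.
have : i \in enum 'I_m by rewrite mem_enum.
rewrite defe mem_cat inE (negbTE ij) /= => ie.
move: ue; rewrite cat_uniq /= => /and3P[_ /norP[ni _] /andP[ni2 _]].
by move: ie; rewrite (negbTE ni) (negbTE ni2).
Qed.

End TopForms.

(** * Smooth maps between normed spaces *)

Section DirectionalDerivatives.
Context {R : realType}.
Implicit Types U V W : normedModType R.

Lemma near_eq_differentiable V W (f g : V -> W) (x : V) :
  (\forall y \near x, f y = g y) -> differentiable f x -> differentiable g x.
Proof.
move=> fg df; apply/diffP => /=.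
have fgx : f x = g x by exact: nbhs_singleton fg.
(* [diffP] speaks of the canonical differential of g, which is a chosen map; it suffices that some
   linear map has the defining properties, and the differential of f has them. *)
apply: (@getPex _ (fun (df : {linear V -> W}) => continuous df /\
  forall y, g y = g (lim (nbhs x)) + df (y - lim (nbhs x))
                  +o_(y \near x) (y - lim (nbhs x)))).
exists ('d f x); split; first by move=> y; exact: diff_continuous.
have /diffP[_ fo] := df.
pose A := fun y => f (lim (nbhs x)) + 'd f x (y - lim (nbhs x)).
pose A' := fun y => g (lim (nbhs x)) + 'd f x (y - lim (nbhs x)).
pose e := fun y => y - lim (nbhs x).
have {}fo : f = A +o_ (nbhs x) e by apply/eqaddoE/funext => y; exact: fo.
suff go : g = A' +o_ (nbhs x) e.
  by move=> y; have := congr1 (fun h => h y) go.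
apply/eqaddoP => eps eps0; have /eqaddoP/(_ _ eps0) fe := fo.
have AA' : A = A' by rewrite /A /A' lim_id // fgx.
near=> y; rewrite -AA' !fctE; have <- : f y = g y by near: y.
by near: y.
Unshelve. all: by end_near. Qed.

Lemma derive_comp U V W (F : U -> V) (g : V -> W) (x v : U) :
  differentiable F x -> differentiable g (F x) ->
  'D_v (fun y => g (F y)) x = 'D_('D_v F x) g (F x).
Proof.
move=> dF dg; rewrite !deriveE //; last exact: differentiable_comp.
by rewrite diff_comp.
Qed.

Lemma derive_lin V W (f : V -> W) (x : V) (k : R) v w : differentiable f x ->
  'D_(k *: v + w) f x = k *: 'D_v f x + 'D_w f x.
Proof. by move=> df; rewrite !deriveE // linearP. Qed.

End DirectionalDerivatives.

Section CkClosure.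
Context {R : realType}.
Implicit Types V W : normedModType R.

Lemma Ck_on_sub V W k (U U' : set V) (f : V -> W) :
  U' `<=` U -> Ck_on k U f -> Ck_on k U' f.
Proof.
move=> sU; elim: k f => [|k IHk] f /=; first by move=> cf x /sU /cf.
by move=> [df Df]; split=> [x /sU /df //|v]; apply: IHk.
Qed.

Lemma Ck_on_eq V W k (U : set V) (f g : V -> W) : open U ->
  (forall x, U x -> f x = g x) -> Ck_on k U f -> Ck_on k U g.
Proof.
move=> oU; elim: k f g => [|k IHk] f g fg /=.
  move=> cf x Ux; have fgx : {near x, f =1 g}.
    by apply: filterS (open_nbhs_nbhs (conj oU Ux)) => y /fg.
  rewrite /prop_for /continuous_at -(fg _ Ux).
  exact: cvg_trans (near_eq_cvg fgx) (cf x Ux).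
have nfg x : U x -> \forall y \near x, f y = g y.
  by move=> Ux; apply: filterS (open_nbhs_nbhs (conj oU Ux)) => y /fg.
move=> [df Df]; split=> [x Ux|v].
  exact: near_eq_differentiable (nfg x Ux) (df x Ux).
apply: (IHk (fun x => 'D_v f x)) => // x Ux.
exact: near_eq_derive (nfg x Ux).
Qed.

Lemma Ck_on_pred V W k (U : set V) (f : V -> W) : Ck_on k.+1 U f -> Ck_on k U f.
Proof.
elim: k f => [|k IHk] f /= [df Df].
  by move=> x Ux; apply: differentiable_continuous; apply: df.
by split=> // v; apply: IHk.
Qed.

Lemma Ck_onD V W k (U : set V) (f g : V -> W) : open U ->
  Ck_on k U f -> Ck_on k U g -> Ck_on k U (fun x => f x + g x).
Proof.
move=> oU; elim: k f g => [|k IHk] f g /=.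
  by move=> cf cg x Ux; apply: continuousD; [apply: cf|apply: cg].
move=> [df Df] [dg Dg]; split=> [x Ux|v].
  by apply: differentiableD; [apply: df|apply: dg].
apply: Ck_on_eq (IHk _ _ (Df v) (Dg v)) => // x Ux.
by rewrite -deriveD //; apply: diff_derivable; [apply: df|apply: dg].
Qed.

Lemma Ck_on_cst V W k (U : set V) (c : W) : open U -> Ck_on k U (fun=> c).
Proof.
move=> oU; elim: k c => [|k IHk] c /=; first by move=> x _; apply: cst_continuous.
split=> [x _|v]; first exact: differentiable_cst.
by apply: Ck_on_eq (IHk 0) => // x _; rewrite derive_cst.
Qed.

Lemma Ck_onM V k (U : set V) (f g : V -> R) : open U ->
  Ck_on k U f -> Ck_on k U g -> Ck_on k U (fun x => f x * g x).
Proof.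
move=> oU; elim: k f g => [|k IHk] f g.
  by move=> cf cg x Ux; apply: continuousM; [apply: cf|apply: cg].
move=> Cf Cg; have [df Df] := Cf; have [dg Dg] := Cg; split=> [x Ux|v].
  by apply: differentiableM; [apply: df|apply: dg].
have Cf' := Ck_on_pred Cf; have Cg' := Ck_on_pred Cg.
apply: Ck_on_eq (Ck_onD oU (IHk _ _ Cf' (Dg v)) (IHk _ _ Cg' (Df v))) => // x Ux.
by rewrite -deriveM //; apply: diff_derivable; [apply: df|apply: dg].
Qed.

Lemma Ck_on_sum V k (U : set V) (I : Type) (r : seq I) (f : I -> V -> R) : open U ->
  (forall i, Ck_on k U (f i)) -> Ck_on k U (fun x => \sum_(i <- r) f i x).
Proof.
move=> oU Cf; elim: r => [|i r IHr].
  by apply: Ck_on_eq (Ck_on_cst k 0 oU) => // x _; rewrite big_nil.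
by apply: Ck_on_eq (Ck_onD oU (Cf i) IHr) => // x _; rewrite big_cons.
Qed.

Lemma Ck_onV V k (U : set V) (f : V -> R) : open U ->
  (forall x, U x -> f x != 0) -> Ck_on k U f -> Ck_on k U (fun x => (f x)^-1).
Proof.
move=> oU f0; elim: k => [|k IHk].
  by move=> cf x Ux; apply: continuousV; [apply: f0|apply: cf].
move=> Cf; have [df Df] := Cf; split=> [x Ux|v].
  by apply: differentiableV; [apply: df|apply: f0].
have CV := IHk (Ck_on_pred Cf).
have CN := Ck_onM oU (Ck_on_cst k (-1 : R) oU) (Df v).
apply: Ck_on_eq (Ck_onM oU CN (Ck_onM oU CV CV)) => // x Ux.
rewrite (deriveV (f0 x Ux)); last exact: diff_derivable (df x Ux).
by rewrite mulN1r mulrC mulrN scaleNr -invfM.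
Qed.

End CkClosure.

Section Coordinates.
Context {R : realType}.
Implicit Types (V W : normedModType R) (m n : nat).

Lemma differentiable_rV_coord V n (F : V -> 'rV[R]_n) (j : 'I_n) x :
  differentiable F x -> differentiable (fun y => F y 0 j) x.
Proof.
move=> dF; apply: (@differentiable_comp _ _ _ _ F (fun M : 'rV[R]_n => M 0 j)) => //.
exact: differentiable_coord.
Qed.

Lemma derive_rV_coord V n (F : V -> 'rV[R]_n) (j : 'I_n) x v :
  differentiable F x -> 'D_v F x 0 j = 'D_v (fun y => F y 0 j) x.
Proof.
move=> dF; have dFv : derivable F x v by exact: diff_derivable.
by rewrite derive_mx // mxE.
Qed.

Lemma Ck_on_rV_coord V n k (U : set V) (F : V -> 'rV[R]_n) (j : 'I_n) : open U ->
  Ck_on k U F -> Ck_on k U (fun x => F x 0 j).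
Proof.
move=> oU; elim: k F => [|k IHk] F /=.
  move=> cF x Ux; apply: (@continuous_comp _ _ _ F (fun M : 'rV_n => M 0 j)).
    exact: cF.
  exact: coord_continuous.
move=> [dF DF]; split=> [x Ux|v]; first exact/differentiable_rV_coord/dF.
by apply: Ck_on_eq (IHk _ (DF v)) => // x Ux; rewrite derive_rV_coord //; apply: dF.
Qed.

Lemma derive_rV_sum n W (g : 'rV[R]_n -> W) y w : differentiable g y ->
  'D_w g y = \sum_j w 0 j *: 'D_(delta_mx 0 j) g y.
Proof.
move=> dg; rewrite {1}(row_sum_delta w) deriveE // linear_sum.
by apply: eq_bigr => j _; rewrite linearZ deriveE.
Qed.

(** The chain rule yields the derivative of g in the direction ['D_v F x], which varies with x,
    whereas [Ck_on] controls fixed directions. Expanding this direction in the standard basis gives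
    products to which the induction hypothesis applies. *)
Lemma Ck_on_comp V n k (U : set V) (U' : set 'rV[R]_n) (F : V -> 'rV[R]_n)
    (g : 'rV[R]_n -> R) : open U -> open U' -> (forall x, U x -> U' (F x)) ->
  smooth_on U F -> smooth_on U' g -> Ck_on k U (fun x => g (F x)).
Proof.
move=> oU oU' UF sF; elim: k g => [|k IHk] g sg.
  move=> x Ux; apply: continuous_comp; first exact: (sF 0%N).
  exact/(sg 0%N)/UF.
have dF x : U x -> differentiable F x by exact: (sF 1%N).1.
have dg y : U' y -> differentiable g y by exact: (sg 1%N).1.
split=> [x Ux|v]; first by apply: differentiable_comp; [exact: dF|exact/dg/UF].
have sDg j : smooth_on U' (fun y => 'D_(delta_mx 0 j) g y).
  by move=> i; apply: (sg i.+1).2.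
have CF j := Ck_on_rV_coord j oU ((sF k.+1).2 v).
have := Ck_on_sum (index_enum 'I_n) oU (fun j => Ck_onM oU (CF j) (IHk _ (sDg j))).
apply: Ck_on_eq => // x Ux.
have dgx := dg _ (UF x Ux); have dFx := dF x Ux.
by rewrite (derive_comp v dFx dgx) (derive_rV_sum _ dgx).
Qed.

End Coordinates.

Section SmoothOn.
Context {R : realType}.
Implicit Types (V W : normedModType R) (m n : nat).

Lemma smooth_differentiable V W (U : set V) (f : V -> W) x :
  smooth_on U f -> U x -> differentiable f x.
Proof. by move=> /(_ 1%N) [df _] /df. Qed.

Lemma smooth_continuous V W (U : set V) (f : V -> W) x :
  smooth_on U f -> U x -> {for x, continuous f}.
Proof. by move=> /(_ 0%N) cf /cf. Qed.

Lemma smooth_derive V W (U : set V) (f : V -> W) v :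
  smooth_on U f -> smooth_on U (fun x => 'D_v f x).
Proof. by move=> sf k; apply: (sf k.+1).2. Qed.

Lemma smooth_on_sub V W (U U' : set V) (f : V -> W) :
  U' `<=` U -> smooth_on U f -> smooth_on U' f.
Proof. by move=> sU sf k; apply: Ck_on_sub (sf k). Qed.

Lemma smooth_on_eq V W (U : set V) (f g : V -> W) : open U ->
  (forall x, U x -> f x = g x) -> smooth_on U f -> smooth_on U g.
Proof. by move=> oU fg sf k; apply: Ck_on_eq (sf k). Qed.

Lemma smooth_onD V W (U : set V) (f g : V -> W) : open U ->
  smooth_on U f -> smooth_on U g -> smooth_on U (fun x => f x + g x).
Proof. by move=> oU sf sg k; apply: Ck_onD. Qed.

Lemma smooth_on_cst V W (U : set V) (c : W) : open U -> smooth_on U (fun=> c).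
Proof. by move=> oU k; apply: Ck_on_cst. Qed.

Lemma smooth_onM V (U : set V) (f g : V -> R) : open U ->
  smooth_on U f -> smooth_on U g -> smooth_on U (fun x => f x * g x).
Proof. by move=> oU sf sg k; apply: Ck_onM. Qed.

Lemma smooth_on_sum V (U : set V) (I : Type) (r : seq I) (f : I -> V -> R) : open U ->
  (forall i, smooth_on U (f i)) -> smooth_on U (fun x => \sum_(i <- r) f i x).
Proof. by move=> oU sf k; apply: Ck_on_sum => // i; apply: sf. Qed.

Lemma smooth_onV V (U : set V) (f : V -> R) : open U ->
  (forall x, U x -> f x != 0) -> smooth_on U f -> smooth_on U (fun x => (f x)^-1).
Proof. by move=> oU f0 sf k; apply: Ck_onV. Qed.

Lemma smooth_on_coord V n (U : set V) (F : V -> 'rV[R]_n) (j : 'I_n) : open U ->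
  smooth_on U F -> smooth_on U (fun x => F x 0 j).
Proof. by move=> oU sF k; apply: Ck_on_rV_coord. Qed.

Lemma smooth_on_comp V n (U : set V) (U' : set 'rV[R]_n) (F : V -> 'rV[R]_n)
    (g : 'rV[R]_n -> R) : open U -> open U' -> (forall x, U x -> U' (F x)) ->
  smooth_on U F -> smooth_on U' g -> smooth_on U (fun x => g (F x)).
Proof. by move=> oU oU' UF sF sg k; apply: Ck_on_comp sF sg. Qed.

End SmoothOn.

(** * Symmetry of second derivatives *)

Section Schwarz.
Context {R : realType} {V : normedModType R}.
Implicit Types (f : V -> R) (x v w : V).

Lemma is_derive_line f x v (t : R) : differentiable f (x + t *: v) ->
  is_derive t 1 (fun s : R => f (x + s *: v)) ('D_v f (x + t *: v)).
Proof.
move=> df; have dl : is_diff t (fun s : R => x + s *: v) (fun s => 0 + s *: v).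
  exact: is_diffD.
have dc : differentiable (fun s : R => f (x + s *: v)) t.
  by apply: differentiable_comp.
apply: DeriveDef; first exact: diff_derivable.
rewrite (derive_comp (F := fun s : R => x + s *: v)) //; congr ('D_ _ f _).
by rewrite deriveE // diff_val add0r scale1r.
Qed.

Lemma MVT_line f x v (h : R) : 0 < h ->
  (forall t : R, 0 <= t <= h -> differentiable f (x + t *: v)) ->
  exists2 t : R, 0 <= t <= h & f (x + h *: v) - f x = 'D_v f (x + t *: v) * h.
Proof.
move=> h0 df.
have [||t + E] := @MVT R (fun s => f (x + s *: v)) (fun s => 'D_v f (x + s *: v)) 0 h h0.
- by move=> t; rewrite in_itv /= => /andP[/ltW t0 /ltW th]; apply/is_derive_line/df/andP.
- apply: continuous_in_subspaceT => t; rewrite inE /= in_itv /= => th.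
  have := is_derive_line (df t th) => /@ex_derive/derivable1_diffP.
  exact: differentiable_continuous.
rewrite in_itv /= => /andP[t0 th]; exists t; first by rewrite !ltW.
by move: E; rewrite scale0r addr0 subr0.
Qed.

(** Mean value theorem twice: in direction v for the increment of f along h w, then in direction w
    for the derivative ['D_v f]. *)
Lemma second_difference f x v w (h : R) : 0 < h ->
  (forall s t : R, 0 <= s <= h -> 0 <= t <= h ->
     differentiable f (x + s *: v + t *: w) /\
     differentiable (fun y => 'D_v f y) (x + s *: v + t *: w)) ->
  exists s t : R, [/\ 0 <= s <= h, 0 <= t <= h &
    f (x + h *: v + h *: w) - f (x + h *: v) - (f (x + h *: w) - f x) =
    'D_w (fun y => 'D_v f y) (x + s *: v + t *: w) * h * h].
Proof.
move=> h0 df; have hh : 0 <= h <= h by rewrite ltW /=.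
have zh : 0 <= (0 : R) <= h by rewrite lexx ltW.
pose g y := f (y + h *: w) - f y.
have dft (s : R) : 0 <= s <= h -> differentiable (fun y => f (y + h *: w)) (x + s *: v).
  by move=> sh; apply: differentiable_comp => //; exact: (df s h sh hh).1.
have df0 (s : R) : 0 <= s <= h -> differentiable f (x + s *: v).
  by move=> sh; have := (df s 0 sh zh).1; rewrite scale0r addr0.
have [|s sh E] := @MVT_line g x v h h0.
  by move=> t th; apply: differentiableB; [exact: dft|exact: df0].
have E' : 'D_v g (x + s *: v) =
    'D_v f (x + s *: v + h *: w) - 'D_v f (x + s *: v).
  rewrite deriveB; [|exact/diff_derivable/dft|exact/diff_derivable/df0].
  congr (_ - _); rewrite (derive_comp (F := fun y => y + h *: w)) //.
    by congr ('D_ _ f _); rewrite deriveD // derive_id derive_cst addr0.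
  exact: (df s h sh hh).1.
have [|t th Et] := @MVT_line (fun y => 'D_v f y) (x + s *: v) w h h0.
  by move=> t th; exact: (df s t sh th).2.
exists s, t; split=> //.
by move: E; rewrite E' Et /g => <-; rewrite addrAC.
Qed.

(** The second difference over a small parallelogram is symmetric in v and w. Hence the two mixed
    derivatives take a common value at suitable points near x, possibly different ones, and their
    continuity at x does the rest. *)
Lemma derive_comm (U : set V) f x v w : open U -> smooth_on U f -> U x ->
  'D_v (fun y => 'D_w f y) x = 'D_w (fun y => 'D_v f y) x.
Proof.
move=> oU sf Ux; set A := fun y => _; pose A2 := fun y => 'D_v A y.
set B := fun y => 'D_v f y; pose B2 := fun y => 'D_w B y.
rewrite -[LHS]/(A2 x) -[RHS]/(B2 x); apply/eqP; rewrite -subr_eq0 -normr_le0.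
apply/ler_addgt0Pl => e e0; rewrite addr0.
have sA : smooth_on U A by apply: smooth_derive.
have sB : smooth_on U B by apply: smooth_derive.
have cA : {for x, continuous A2} by apply: (smooth_continuous (smooth_derive v sA)).
have cB : {for x, continuous B2} by apply: (smooth_continuous (smooth_derive w sB)).
have e2 : 0 < e / 2 by rewrite divr_gt0.
have nU : nbhs x U by exact: open_nbhs_nbhs.
have nA : \forall y \near x, `|A2 x - A2 y| <= e / 2.
  by move/cvgrPdist_le : cA => /(_ _ e2).
have nB : \forall y \near x, `|B2 x - B2 y| <= e / 2.
  by move/cvgrPdist_le : cB => /(_ _ e2).
have nN : nbhs x (U `&` ([set y | `|A2 x - A2 y| <= e / 2] `&`
    [set y | `|B2 x - B2 y| <= e / 2])).
  exact: (filterI nU (filterI nA nB)).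
have [r /= r0 rN] := (nbhs_ballP _ _).1 nN.
(* The summand 1 keeps M positive; for h = r / M / 2 the parallelogram with sides h v and h w stays
   in the ball of radius r. *)
pose M := `|v| + `|w| + 1.
have M0 : 0 < M by rewrite /M; have := normr_ge0 v; have := normr_ge0 w; lra.
pose h := r / M / 2.
have h0 : 0 < h by rewrite !divr_gt0.
have inN (s t : R) : 0 <= s <= h -> 0 <= t <= h -> ball x r (x + s *: v + t *: w).
  move=> /andP[s0 sh] /andP[t0 th]; rewrite -ball_normE /ball_ /=.
  rewrite -addrA opprD addNKr normrN.
  apply: le_lt_trans (ler_normD _ _) _; rewrite !normrZ !ger0_norm //.
  apply: (@le_lt_trans _ _ (h * M)).
    rewrite /M !mulrDr mulr1.
    have : s * `|v| <= h * `|v| by rewrite ler_wpM2r.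
    have : t * `|w| <= h * `|w| by rewrite ler_wpM2r.
    lra.
  by rewrite /h mulrAC divfK ?gt_eqF //; lra.
have [s [t [sh th Es]]] := @second_difference f x v w h h0
  (fun s t sh th => conj (smooth_differentiable sf (rN _ (inN s t sh th)).1)
                         (smooth_differentiable sB (rN _ (inN s t sh th)).1)).
have swap (a b : R) : x + a *: w + b *: v = x + b *: v + a *: w by rewrite addrAC.
have [|s' [t' [sh' th' Et]]] := @second_difference f x w v h h0.
  move=> a b ah bh; rewrite swap; have Uy := (rN _ (inN b a bh ah)).1.
  by split; [exact: smooth_differentiable sf Uy|exact: smooth_differentiable sA Uy].
have [_ [_ bB]] := rN _ (inN s t sh th).
have [_ [bA _]] := rN _ (inN t' s' th' sh').
have AB : A2 (x + t' *: v + s' *: w) = B2 (x + s *: v + t *: w).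
  have hn : h != 0 by rewrite gt_eqF.
  have Es' : f (x + h *: v + h *: w) - f (x + h *: v) - (f (x + h *: w) - f x) =
    B2 (x + s *: v + t *: w) * h * h := Es.
  have Et' : f (x + h *: w + h *: v) - f (x + h *: w) - (f (x + h *: v) - f x) =
    A2 (x + s' *: w + t' *: v) * h * h := Et.
  have key (p q a b c d : R) : a - b - (c - d) = p * h * h ->
      a - c - (b - d) = q * h * h -> p = q.
    move=> E1 E2; apply: (mulIf hn); apply: (mulIf hn); rewrite -E1 -E2.
    by rewrite !opprB addrACA [RHS]addrACA [- b - _]addrC.
  have -> : A2 (x + t' *: v + s' *: w) = A2 (x + s' *: w + t' *: v).
    by congr A2; exact: addrAC.
  have Efx : f (x + h *: w + h *: v) = f (x + h *: v + h *: w).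
    by congr f; exact: addrAC.
  rewrite Efx in Et'; exact: key Et' Es'.
have fin (a b p q : R) : `|a - p| <= e / 2 -> `|b - q| <= e / 2 -> p = q ->
    `|a - b| <= e.
  move=> ap bq pq; rewrite -(subrK p a) -addrA.
  apply: le_trans (ler_normD _ _) _; rewrite (splitr e); apply: lerD => //.
  by rewrite pq distrC.
exact: fin bA bB AB.
Qed.

End Schwarz.

(** * One-forms in coordinates and their exterior derivative *)

Section FlatForms.
Context {R : realType}.

Definition flat_d m (eta : 'rV[R]_m -> 'rV[R]_m -> R) (x v w : 'rV[R]_m) : R :=
  'D_v (fun y => eta y w) x - 'D_w (fun y => eta y v) x.

Definition flat_smooth m (U : set 'rV[R]_m) (eta : 'rV[R]_m -> 'rV[R]_m -> R) :=
  (forall x, U x -> forall (k : R) v w,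
     eta x (k *: v + w) = k * eta x v + eta x w) /\
  (forall v, smooth_on U (fun x => eta x v)).

Definition flat_pull m n (F : 'rV[R]_m -> 'rV[R]_n) (eta : 'rV[R]_n -> 'rV[R]_n -> R) :=
  fun x v => eta (F x) ('D_v F x).

Lemma flat_lin0 n (U : set 'rV[R]_n) eta y : flat_smooth U eta -> U y -> eta y 0 = 0.
Proof.
move=> [lin_eta _] Uy; have := lin_eta y Uy (-1) 0 0.
by rewrite scaler0 addr0 mulN1r addNr.
Qed.

Lemma flat_coord n (U : set 'rV[R]_n) eta y w : flat_smooth U eta -> U y ->
  eta y w = \sum_j w 0 j * eta y (delta_mx 0 j).
Proof.
move=> se Uy; rewrite {1}(row_sum_delta w).
elim: (index_enum _) => [|j r IHr]; first by rewrite !big_nil (flat_lin0 se Uy).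
by rewrite !big_cons se.1 // IHr.
Qed.

Variables (m n : nat) (U : set 'rV[R]_m) (U' : set 'rV[R]_n).
Variables (F : 'rV[R]_m -> 'rV[R]_n) (eta : 'rV[R]_n -> 'rV[R]_n -> R).
Hypotheses (oU : open U) (oU' : open U') (UF : forall x, U x -> U' (F x)).
Hypotheses (sF : smooth_on U F) (se : flat_smooth U' eta).

Lemma flat_pull_smooth : flat_smooth U (flat_pull F eta).
Proof.
split=> [x Ux k v w|v].
  by rewrite /flat_pull derive_lin ?se.1 //; [exact: UF|exact: smooth_differentiable Ux].
have : smooth_on U (fun x => \sum_j 'D_v F x 0 j * eta (F x) (delta_mx 0 j)).
  apply: smooth_on_sum => // j; apply: smooth_onM => //.
    by apply: smooth_on_coord => //; apply: smooth_derive.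
  exact: (smooth_on_comp (g := fun y => eta y (delta_mx 0 j)) oU oU' UF sF (se.2 _)).
apply: smooth_on_eq => // x Ux.
by rewrite /flat_pull (flat_coord _ se (UF Ux)).
Qed.

(** Besides the expected terms, each half of [flat_d] contains second derivatives of F; these cancel
    in the difference because mixed derivatives commute. *)
Lemma flat_d_pull x v w : U x ->
  flat_d (flat_pull F eta) x v w = flat_d eta (F x) ('D_v F x) ('D_w F x).
Proof.
move=> Ux.
have dF y : U y -> differentiable F y by exact: smooth_differentiable.
have dDF a y : U y -> differentiable (fun z => 'D_a F z) y.
  by move=> Uy; exact: smooth_differentiable (smooth_derive a sF) Uy.
have de a y : U' y -> differentiable (fun z => eta z a) y.
  by move=> Uy; exact: smooth_differentiable (se.2 a) Uy.
(* Leibniz rule in coordinates: the first sum differentiates the coefficients of eta, the second one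
   the components of ['D_b F]. *)
have half a b : 'D_a (fun y => flat_pull F eta y b) x =
    \sum_j 'D_b F x 0 j * 'D_('D_a F x) (fun y => eta y (delta_mx 0 j)) (F x) +
    \sum_j 'D_a (fun y => 'D_b F y) x 0 j * eta (F x) (delta_mx 0 j).
  have -> : 'D_a (fun y => flat_pull F eta y b) x =
      'D_a (\sum_j fun y => 'D_b F y 0 j * eta (F y) (delta_mx 0 j)) x.
    apply: near_eq_derive; apply: filterS (open_nbhs_nbhs (conj oU Ux)) => y Uy.
    by rewrite fct_sumE /flat_pull (flat_coord _ se (UF Uy)).
  have dc j : derivable (fun y => 'D_b F y 0 j) x a.
    exact/diff_derivable/differentiable_rV_coord/dDF.
  have dg j : differentiable (fun y => eta (F y) (delta_mx 0 j)) x.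
    apply: (@differentiable_comp _ _ _ _ F (fun y => eta y (delta_mx 0 j))).
      exact: dF.
    exact/de/UF.
  rewrite derive_sum => [|j]; last first.
    by apply: derivableM; [exact: dc|exact/diff_derivable/dg].
  rewrite -big_split /=; apply: eq_bigr => j _.
  have dgx : derivable (fun y => eta (F y) (delta_mx 0 j)) x a.
    exact/diff_derivable/dg.
  have E1 : 'D_a (fun y => 'D_b F y 0 j * eta (F y) (delta_mx 0 j)) x =
    'D_b F x 0 j * 'D_a (fun y => eta (F y) (delta_mx 0 j)) x +
    eta (F x) (delta_mx 0 j) * 'D_a (fun y => 'D_b F y 0 j) x.
    exact: (deriveM (dc j) dgx).
  have E2 : 'D_a (fun y => eta (F y) (delta_mx 0 j)) x =
      'D_('D_a F x) (fun y => eta y (delta_mx 0 j)) (F x).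
    exact: derive_comp (dF x Ux) (de _ _ (UF Ux)).
  have E3 : 'D_a (fun y => 'D_b F y) x 0 j = 'D_a (fun y => 'D_b F y 0 j) x.
    exact: derive_rV_coord (dDF b x Ux).
  by rewrite E1 E2 E3 [eta _ _ * _]mulrC.
have lead a b : \sum_j 'D_b F x 0 j * 'D_a (fun y => eta y (delta_mx 0 j)) (F x) =
    'D_a (fun y => eta y ('D_b F x)) (F x).
  have -> : 'D_a (fun y => eta y ('D_b F x)) (F x) =
      'D_a (\sum_j ('D_b F x 0 j *: fun y => eta y (delta_mx 0 j))) (F x).
    apply: near_eq_derive; apply: filterS (open_nbhs_nbhs (conj oU' (UF Ux))) => y Uy.
    by rewrite fct_sumE (flat_coord _ se Uy).
  rewrite derive_sum => [|j].
    by apply: eq_bigr => j _; rewrite deriveZ //; exact/diff_derivable/de/UF.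
  by apply: derivableZ; exact/diff_derivable/de/UF.
have C j : 'D_w (fun y => 'D_v F y) x 0 j = 'D_v (fun y => 'D_w F y) x 0 j.
  have coordD a b : 'D_a (fun y => 'D_b F y) x 0 j =
      'D_a (fun y => 'D_b (fun z => F z 0 j) y) x.
    rewrite (derive_rV_coord _ _ (dDF b x Ux)).
    apply: near_eq_derive; apply: filterS (open_nbhs_nbhs (conj oU Ux)) => y Uy.
    exact: derive_rV_coord (dF y Uy).
  have sFj : smooth_on U (fun z => F z 0 j) by exact: smooth_on_coord.
  exact: etrans (coordD w v) (etrans (derive_comm w v oU sFj Ux) (esym (coordD v w))).
have S : \sum_j 'D_w (fun y => 'D_v F y) x 0 j * eta (F x) (delta_mx 0 j) =
    \sum_j 'D_v (fun y => 'D_w F y) x 0 j * eta (F x) (delta_mx 0 j).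
  by apply: eq_bigr => j _; apply: (congr1 (fun z : R => z * eta (F x) (delta_mx 0 j))); exact: C.
have fin (p q l1 l2 m1 m2 s1 s2 : R) :
    p = l1 + s1 -> q = l2 + s2 -> l1 = m1 -> l2 = m2 -> s2 = s1 -> p - q = m1 - m2.
  by move=> -> -> -> -> ->; rewrite opprD addrACA subrr addr0.
exact: fin (half v w) (half w v) (lead _ _) (lead _ _) S.
Qed.

End FlatForms.

(** * Forms on manifolds *)

Section SmoothLocal.
Context {R : realType} {V W : normedModType R}.

(** [Ck_on] imposes its conditions at each point separately, so they may be checked on a different
    set around each point. *)
Lemma smooth_on_local (U : set V) (f : V -> W) :
  (forall x, U x -> exists2 N, N x & smooth_on N f) -> smooth_on U f.
Proof.
move=> loc k; elim: k f loc => [|k IHk] f loc.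
  by move=> x /loc[N Nx sf]; apply: (sf 0%N).
split=> [x /loc[N Nx sf]|v]; first exact: (sf 1%N).1.
apply: IHk => x /loc[N Nx sf]; exists N => //; exact: smooth_derive.
Qed.

End SmoothLocal.

Lemma open_near (T : topologicalType) (U : set T) (P : T -> Prop) x :
  open U -> U x -> (forall y, U y -> P y) -> \forall y \near x, P y.
Proof. by move=> oU Ux UP; apply: filterS UP _; apply: open_nbhs_nbhs. Qed.

Section Charts.
Context {R : realType} {m : nat} {T : topologicalType}.
Variable X : smooth_manifold R m T.
Implicit Types (c : chart R m T) (O : set T) (p q : T).

Lemma open_cod c : open (chart_cod c). Proof. exact: (@chart_cod_open _ _ _ c). Qed.

Lemma open_dom c : open (chart_dom c). Proof. exact: (@chart_dom_open _ _ _ c). Qed.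

Lemma open_chart_preimage c O : open O ->
  open (chart_cod c `&` chart_bwd c @^-1` O).
Proof.
move=> oO; rewrite openE => x [cx Ox]; apply: filterI.
  by apply: open_nbhs_nbhs; split => //; exact: open_cod.
exact: (chart_bwd_cont cx) (open_nbhs_nbhs (conj oO Ox)).
Qed.

Definition transition_dom c c' : set 'rV[R]_m :=
  chart_cod c `&` chart_bwd c @^-1` chart_dom c'.

Definition transition c c' : 'rV[R]_m -> 'rV[R]_m := chart_fwd c' \o chart_bwd c.

Lemma open_transition_dom c c' : open (transition_dom c c').
Proof. exact/open_chart_preimage/open_dom. Qed.

Lemma smooth_transition c c' : atlas X c -> atlas X c' ->
  smooth_on (transition_dom c c') (transition c c').
Proof. exact: atlas_compat. Qed.

Lemma change_of_coordinates (W : normedModType R) c c' (g : T -> W) x v :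
  atlas X c -> atlas X c' -> transition_dom c c' x ->
  differentiable (g \o chart_bwd c') (transition c c' x) ->
  differentiable (g \o chart_bwd c) x /\
  'D_v (g \o chart_bwd c) x =
  'D_('D_v (transition c c') x) (g \o chart_bwd c') (transition c c' x).
Proof.
move=> ac ac' Ux dg.
have dt : differentiable (transition c c') x.
  exact: smooth_differentiable (smooth_transition ac ac') Ux.
have near_eq : \forall y \near x,
    (g \o chart_bwd c') (transition c c' y) = (g \o chart_bwd c) y.
  apply: (open_near (@open_transition_dom c c') Ux) => y [_ cy].
  by rewrite /= /transition /= chart_fwdK.
split; first by apply: near_eq_differentiable near_eq _; apply: differentiable_comp.
by rewrite -(derive_comp v dt dg); apply/esym; exact: near_eq_derive near_eq.
Qed.

Lemma tangent_of_chart_transition c c' x v :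
  atlas X c -> atlas X c' -> transition_dom c c' x ->
  tangent_of_chart X c (chart_bwd c x) v =
  tangent_of_chart X c' (chart_bwd c x) ('D_v (transition c c') x).
Proof.
move=> ac ac' Ux; rewrite /tangent_of_chart (chart_bwdK Ux.1).
set q := chart_bwd c x; have aq := chart_at_atlas X q.
have Uq : transition_dom c' (chart_at X q) (transition c c' x).
  split; first exact: chart_fwd_cod Ux.2.
  by rewrite /transition /= chart_fwdK; [exact: chart_at_dom|exact: Ux.2].
have dq : differentiable (chart_fwd (chart_at X q) \o chart_bwd c') (transition c c' x).
  exact: smooth_differentiable (smooth_transition ac' aq) Uq.
exact: (change_of_coordinates v ac ac' Ux dq).2.
Qed.

Lemma tangent_of_chart_at p v : tangent_of_chart X (chart_at X p) p v = v.
Proof.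
rewrite /tangent_of_chart; set c := chart_at X p.
have cp : chart_dom c p by exact: chart_at_dom.
rewrite -[RHS](derive_id (chart_fwd c p) v); apply: near_eq_derive.
by apply: (open_near (@open_cod c) (chart_fwd_cod cp)) => y cy; rewrite /= chart_bwdK.
Qed.

Lemma differentiable_tangent_of_chart c x : atlas X c -> chart_cod c x ->
  differentiable (chart_fwd (chart_at X (chart_bwd c x)) \o chart_bwd c) x.
Proof.
move=> ac cx; apply: (smooth_differentiable (smooth_transition ac (chart_at_atlas X _))).
by split=> //=; apply: chart_at_dom.
Qed.

Lemma tangent_of_chart_lin c x (k : R) v w : atlas X c -> chart_cod c x ->
  tangent_of_chart X c (chart_bwd c x) (k *: v + w) =
  k *: tangent_of_chart X c (chart_bwd c x) v + tangent_of_chart X c (chart_bwd c x) w.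
Proof.
move=> ac cx; rewrite /tangent_of_chart chart_bwdK //.
exact: derive_lin (differentiable_tangent_of_chart ac cx).
Qed.

Lemma fun_ord1 (A : Type) (v : 'I_1 -> A) : v = fun=> v ord0.
Proof. by apply/funext => i; rewrite (ord1 i). Qed.

Lemma alternating1P (V : lmodType R) (a : covector V 1) :
  alternating a <->
  forall (k : R) x y, a (fun=> k *: x + y) = k * a (fun=> x) + a (fun=> y).
Proof.
split=> [[lin_a _] k x y|lin_a].
  have E z : (fun j : 'I_1 => if j == ord0 then z else 0) = fun=> z.
    by apply/funext => j; rewrite (ord1 j).
  by have := lin_a (fun=> 0) ord0 k x y; rewrite !E.
split=> [v i k x y|v i j]; last by rewrite (ord1 i) (ord1 j) eqxx.
have E z : (fun j : 'I_1 => if j == i then z else v j) = fun=> z.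
  by apply/funext => j; rewrite (ord1 j) (ord1 i).
by rewrite !E lin_a.
Qed.

Definition local1 c (w : dform m T 1) : 'rV[R]_m -> 'rV[R]_m -> R :=
  fun x v => form_in_chart X c w x (fun=> v).

Definition chart_preimage c O : set 'rV[R]_m := chart_cod c `&` chart_bwd c @^-1` O.

Lemma flat_smooth_local1 O c (w : dform m T 1) : smooth_form X O w -> atlas X c ->
  flat_smooth (chart_preimage c O) (local1 c w).
Proof.
move=> [alt_w sw] ac; split=> [x [cx Ox] k v v'|v]; last exact: sw.
rewrite /local1 /form_in_chart.
have /alternating1P lin_w := alt_w _ Ox.
by rewrite -lin_w; congr (w _ _); apply/funext => _; exact: tangent_of_chart_lin.
Qed.

Lemma local1_transition c c' (w : dform m T 1) x v :
  atlas X c -> atlas X c' -> transition_dom c c' x ->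
  local1 c w x v = flat_pull (transition c c') (local1 c' w) x v.
Proof.
move=> ac ac' Ux; rewrite /flat_pull /local1 /form_in_chart.
have -> : chart_bwd c' (transition c c' x) = chart_bwd c x.
  by rewrite /transition /= chart_fwdK //; exact: Ux.2.
by congr (w _ _); apply/funext => _; exact: tangent_of_chart_transition.
Qed.

Lemma ext_d1E (w : dform m T 1) p v :
  ext_d X w p v =
  flat_d (local1 (chart_at X p) w) (chart_fwd (chart_at X p) p) (v ord0) (v ord_max).
Proof.
set c := chart_at X p; set x := chart_fwd c p.
have E (i : 'I_2) : 'D_(v i) (fun y => form_in_chart X c w y (fun j => v (lift i j))) x =
    'D_(v i) (fun y => local1 c w y (v (lift i ord0))) x.
  apply: (congr1 (fun h => derive h x (v i))); apply/funext => y.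
  exact: (congr1 (form_in_chart X c w y) (fun_ord1 _)).
have l0 : lift ord0 ord0 = ord_max :> 'I_2 by exact/val_inj.
have l1 : lift ord_max ord0 = ord0 :> 'I_2 by exact/val_inj.
rewrite -[LHS]/(\sum_(i < 2) (-1) ^+ i *
  'D_(v i) (fun y => form_in_chart X c w y (fun j => v (lift i j))) x).
rewrite big_ord_recl big_ord1 l0 (E ord0) (E ord_max) l0 l1 expr0 mul1r.
by rewrite expr1 mulN1r.
Qed.

Lemma near_eq_flat_d (eta eta' : 'rV[R]_m -> 'rV[R]_m -> R) x v w :
  (\forall y \near x, forall a, eta y a = eta' y a) ->
  flat_d eta x v w = flat_d eta' x v w.
Proof.
move=> E; rewrite /flat_d; congr (_ - _); apply: near_eq_derive;
  by apply: filterS E => y ->.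
Qed.

(** An instance of [flat_d_pull]: near x one local expression of w is the pull-back of the other
    under the transition map. *)
Lemma flat_d_transition O c c' (w : dform m T 1) x v v' : open O -> smooth_form X O w ->
  atlas X c -> atlas X c' -> transition_dom c c' x -> O (chart_bwd c x) ->
  flat_d (local1 c w) x v v' =
  flat_d (local1 c' w) (transition c c' x)
    ('D_v (transition c c') x) ('D_v' (transition c c') x).
Proof.
move=> oO sw ac ac' Ux Ox.
pose U := transition_dom c c' `&` chart_preimage c O.
have oU : open U.
  by apply: openI; [exact: open_transition_dom|exact: open_chart_preimage].
have UU' y : U y -> chart_preimage c' O (transition c c' y).
  move=> [[cy c'y] [_ Oy]]; split; first exact: chart_fwd_cod.
  by rewrite /transition /= chart_fwdK.
have sU : smooth_on U (transition c c').
  by apply: smooth_on_sub (smooth_transition ac ac') => y [].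
have Ux' : U x by split=> //; split=> //; exact: Ux.1.
rewrite -(flat_d_pull oU (@open_chart_preimage c' O oO) UU' sU
  (flat_smooth_local1 sw ac') v v' Ux').
apply: near_eq_flat_d; apply: (open_near oU Ux') => y [Uy _] a.
exact: local1_transition.
Qed.

(** [ext_d] uses at each point the preferred chart of that point. Here a single chart computes it on
    a whole open set, so that [ext_d X w] can itself be differentiated. *)
Lemma form_in_chart_ext_d O c (w : dform m T 1) x (v : 'I_2 -> 'rV[R]_m) :
  open O -> smooth_form X O w -> atlas X c -> chart_preimage c O x ->
  form_in_chart X c (ext_d X w) x v = flat_d (local1 c w) x (v ord0) (v ord_max).
Proof.
move=> oO sw ac [cx Ox]; rewrite /form_in_chart ext_d1E.
set q := chart_bwd c x; have aq := chart_at_atlas X q.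
have Ux : transition_dom c (chart_at X q) x by split=> //; exact: chart_at_dom.
rewrite (flat_d_transition _ _ oO sw ac aq Ux Ox).
by rewrite /tangent_of_chart /q (chart_bwdK cx).
Qed.

End Charts.

Section FlatDerivative.
Context {R : realType} {m : nat}.
Variables (U : set 'rV[R]_m) (eta : 'rV[R]_m -> 'rV[R]_m -> R).
Hypotheses (oU : open U) (se : flat_smooth U eta).

Lemma flat_dC x v w : flat_d eta x v w = - flat_d eta x w v.
Proof. by rewrite /flat_d opprB. Qed.

Lemma flat_d_lin x (k : R) v v' w : U x ->
  flat_d eta x (k *: v + v') w = k * flat_d eta x v w + flat_d eta x v' w.
Proof.
move=> Ux; have de a : differentiable (fun y => eta y a) x.
  exact: smooth_differentiable (se.2 a) Ux.
have E1 : 'D_(k *: v + v') (fun y => eta y w) x =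
    k * 'D_v (fun y => eta y w) x + 'D_v' (fun y => eta y w) x.
  exact: derive_lin.
have E2 : 'D_w (fun y => eta y (k *: v + v')) x =
    k * 'D_w (fun y => eta y v) x + 'D_w (fun y => eta y v') x.
  transitivity ('D_w ((k *: fun y => eta y v) + (fun y => eta y v')) x).
    by apply: near_eq_derive; apply: (open_near oU Ux) => y Uy; rewrite se.1.
  rewrite deriveD; [|exact/derivableZ/diff_derivable|exact/diff_derivable].
  by rewrite deriveZ //; exact/diff_derivable.
have fin (a b c d e f : R) : a = k * c + d -> b = k * e + f ->
  a - b = k * (c - e) + (d - f) by move=> -> ->; ring.
exact: fin E1 E2.
Qed.

Lemma smooth_flat_d v w : smooth_on U (fun x => flat_d eta x v w).
Proof.
have s1 := smooth_derive v (se.2 w); have s2 := smooth_derive w (se.2 v).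
have s3 := smooth_onM oU (smooth_on_cst (-1 : R) oU) s2.
apply: smooth_on_eq (smooth_onD oU s1 s3) => // x _.
by rewrite /flat_d mulN1r.
Qed.

(** The six second derivatives cancel in pairs by [derive_comm]. *)
Lemma flat_dd x a b c : U x ->
  'D_a (fun y => flat_d eta y b c) x - 'D_b (fun y => flat_d eta y a c) x +
  'D_c (fun y => flat_d eta y a b) x = 0.
Proof.
move=> Ux.
have E p q r : 'D_p (fun y => flat_d eta y q r) x =
    'D_p (fun y => 'D_q (fun z => eta z r) y) x -
    'D_p (fun y => 'D_r (fun z => eta z q) y) x.
  apply: deriveB; apply/diff_derivable.
    exact: smooth_differentiable (smooth_derive q (se.2 r)) Ux.
  exact: smooth_differentiable (smooth_derive r (se.2 q)) Ux.
have S p q r : 'D_p (fun y => 'D_q (fun z => eta z r) y) x =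
    'D_q (fun y => 'D_p (fun z => eta z r) y) x.
  exact: derive_comm oU (se.2 r) Ux.
have fin (p1 p2 p3 q1 q2 r1 r2 s1 s2 : R) : p1 = q1 - q2 -> p2 = r1 - r2 ->
  p3 = s1 - s2 -> q1 = r1 -> q2 = s1 -> r2 = s2 -> p1 - p2 + p3 = 0.
  by move=> -> -> -> -> -> ->; ring.
exact: fin (E a b c) (E b a c) (E c a b) (S _ _ _) (S _ _ _) (S _ _ _).
Qed.

End FlatDerivative.

Section Forms.
Context {R : realType} {m : nat} {T : topologicalType}.
Variable X : smooth_manifold R m T.
Implicit Types (c : chart R m T) (O : set T) (p q : T).

Lemma ord2P (i : 'I_2) : i = ord0 \/ i = ord_max.
Proof. by case: i => -[|[|//]] i; [left|right]; apply/val_inj. Qed.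

Lemma open_preim c O : open O -> open (chart_preimage c O).
Proof. exact: open_chart_preimage. Qed.

Lemma chart_at_preimage O p : O p ->
  chart_preimage (chart_at X p) O (chart_fwd (chart_at X p) p).
Proof.
move=> Op; have cp := chart_at_dom X p.
by split; [exact: chart_fwd_cod|rewrite /= chart_fwdK].
Qed.

Lemma form_in_chart_at k (w : dform m T k) p v :
  form_in_chart X (chart_at X p) w (chart_fwd (chart_at X p) p) v = w p v.
Proof.
rewrite /form_in_chart chart_fwdK; last exact: chart_at_dom.
by congr (w p _); apply/funext => i; rewrite tangent_of_chart_at.
Qed.

Lemma smooth_form_sub O O' k (w : dform m T k) :
  O' `<=` O -> smooth_form X O w -> smooth_form X O' w.
Proof.
move=> sO [aw sw]; split=> [p /sO /aw //|c ac v].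
by apply: smooth_on_sub (sw c ac v) => x [cx /sO].
Qed.

Lemma smooth_form_local O k (w : dform m T k) :
  (forall p, O p -> exists2 N, N p & smooth_form X N w) -> smooth_form X O w.
Proof.
move=> loc; split=> [p /loc[N Np [aw _]]|c ac v]; first exact: aw.
apply: smooth_on_local => x [cx /loc[N Np [_ sw]]].
by exists (chart_preimage c N) => //; exact: sw.
Qed.

Lemma smooth_formD O k (w w' : dform m T k) : open O ->
  smooth_form X O w -> smooth_form X O w' ->
  smooth_form X O (fun p v => w p v + w' p v).
Proof.
move=> oO [aw sw] [aw' sw']; split=> [p Op|c ac v]; last first.
  by apply: smooth_onD; [exact: open_preim|exact: sw|exact: sw'].
have [la va] := aw _ Op; have [la' va'] := aw' _ Op.
split=> [v i k' x y|v i j ij vij]; first by rewrite la la'; ring.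
by rewrite (va v i j) // (va' v i j) // addr0.
Qed.

Lemma smooth_formM O k (f : T -> R) (w : dform m T k) : open O ->
  smooth_fun X O f -> smooth_form X O w ->
  smooth_form X O (fun p v => f p * w p v).
Proof.
move=> oO sf [aw sw]; split=> [p Op|c ac v]; last first.
  by apply: smooth_onM; [exact: open_preim|exact: sf|exact: sw].
have [la va] := aw _ Op.
split=> [v i k' x y|v i j ij vij]; first by rewrite la; ring.
by rewrite (va v i j) // mulr0.
Qed.

Lemma smooth_fun_cst O (k : R) : open O -> smooth_fun X O (fun=> k).
Proof. by move=> oO c ac; apply: smooth_on_cst; exact: open_preim. Qed.

Lemma smooth_form_scale O k (a : R) (w : dform m T k) : open O ->
  smooth_form X O w -> smooth_form X O (form_scale a w).
Proof. by move=> oO; apply: smooth_formM => //; exact: smooth_fun_cst. Qed.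

Lemma form_in_chart_derivable O c k (w : dform m T k) x v a :
  smooth_form X O w -> atlas X c -> chart_preimage c O x ->
  derivable (fun y => form_in_chart X c w y v) x a.
Proof.
move=> [_ sw] ac Ox; apply: diff_derivable.
exact: smooth_differentiable (sw c ac v) Ox.
Qed.

Lemma ext_dD O k (w w' : dform m T k) p v :
  smooth_form X O w -> smooth_form X O w' -> O p ->
  ext_d X (fun p v => w p v + w' p v) p v = ext_d X w p v + ext_d X w' p v.
Proof.
move=> sw sw' Op; rewrite /ext_d -big_split /=; apply: eq_bigr => i _.
have ac := chart_at_atlas X p; have Ux := chart_at_preimage Op.
rewrite -mulrDr; apply: (congr1 (fun z : R => (-1) ^+ i * z)).
have d1 := form_in_chart_derivable (v := fun j => v (lift i j)) (a := v i) sw ac Ux.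
have d2 := form_in_chart_derivable (v := fun j => v (lift i j)) (a := v i) sw' ac Ux.
exact: (deriveD d1 d2).
Qed.

Lemma ext_dZ O k (a : R) (w : dform m T k) p v :
  smooth_form X O w -> O p ->
  ext_d X (form_scale a w) p v = a * ext_d X w p v.
Proof.
move=> sw Op; rewrite /ext_d big_distrr /=; apply: eq_bigr => i _.
have ac := chart_at_atlas X p; have Ux := chart_at_preimage Op.
rewrite [RHS]mulrCA; apply: (congr1 (fun z : R => (-1) ^+ i * z)).
have d1 := form_in_chart_derivable (v := fun j => v (lift i j)) (a := v i) sw ac Ux.
exact: (deriveZ a d1).
Qed.

Lemma ext_d_mul O (f : T -> R) (w : dform m T 1) p v :
  smooth_fun X O f -> smooth_form X O w -> O p ->
  ext_d X (fun p v => f p * w p v) p v =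
  differential X f p (v ord0) * w p (fun=> v ord_max) -
  differential X f p (v ord_max) * w p (fun=> v ord0) + f p * ext_d X w p v.
Proof.
move=> sf sw Op; have ac := chart_at_atlas X p; have Ux := chart_at_preimage Op.
rewrite !ext_d1E /flat_d.
set c := chart_at X p; set x := chart_fwd c p.
have bx : chart_bwd c x = p by apply: chart_fwdK; exact: chart_at_dom.
have df a : derivable (f \o chart_bwd c) x a.
  by apply: diff_derivable; exact: smooth_differentiable (sf c ac) Ux.
have dw a b : derivable (fun y => local1 X c w y a) x b.
  exact: form_in_chart_derivable sw ac Ux.
have E a b : 'D_a (fun y => local1 X c (fun p v => f p * w p v) y b) x =
    f p * 'D_a (fun y => local1 X c w y b) x + w p (fun=> b) * differential X f p a.
  have := deriveM (df a) (dw b a); rewrite /= bx.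
  by rewrite [local1 X c w x b]form_in_chart_at; apply.
have fin (a b c1 c2 d1 d2 e1 e2 k : R) :
  a = k * c1 + d1 * e1 -> b = k * c2 + d2 * e2 ->
  a - b = e1 * d1 - e2 * d2 + k * (c1 - c2) by move=> -> ->; ring.
exact: fin (E _ _) (E _ _).
Qed.

Lemma alternating_ext_d O (w : dform m T 1) p : open O -> smooth_form X O w -> O p ->
  alternating (ext_d X w p).
Proof.
move=> oO sw Op; have ac := chart_at_atlas X p; have Ux := chart_at_preimage Op.
have se := flat_smooth_local1 sw ac; have oU := @open_preim (chart_at X p) O oO.
split=> [v i k x y|v i j ij vij]; rewrite !ext_d1E.
  case: (ord2P i) => ->; rewrite eqxx.
    by rewrite (flat_d_lin oU se).
  rewrite ![flat_d _ _ (v ord0) _]flat_dC (flat_d_lin oU se) //=.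
  by rewrite opprD mulrN.
have -> : v ord0 = v ord_max.
  by move: ij vij; case: (ord2P i) (ord2P j) => -> [] ->.
by rewrite /flat_d subrr.
Qed.

Lemma smooth_ext_d O (w : dform m T 1) : open O -> smooth_form X O w ->
  smooth_form X O (ext_d X w).
Proof.
move=> oO sw; split=> [p Op|c ac v]; first exact: alternating_ext_d sw Op.
have oU := @open_preim c O oO.
apply: smooth_on_eq (smooth_flat_d oU (flat_smooth_local1 sw ac) (v ord0) (v ord_max)).
  exact: oU.
by move=> x Ux; rewrite (form_in_chart_ext_d _ oO sw ac Ux).
Qed.

Lemma ext_d_ext_d O (w : dform m T 1) p v : open O -> smooth_form X O w -> O p ->
  ext_d X (ext_d X w) p v = 0.
Proof.
move=> oO sw Op; have ac := chart_at_atlas X p; have Ux := chart_at_preimage Op.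
have se := flat_smooth_local1 sw ac; have oU := @open_preim (chart_at X p) O oO.
set c := chart_at X p; set x := chart_fwd c p.
have E (i : 'I_3) : 'D_(v i) (fun y => form_in_chart X c (ext_d X w) y
      (fun j => v (lift i j))) x =
    'D_(v i) (fun y => flat_d (local1 X c w) y
      (v (lift i ord0)) (v (lift i ord_max))) x.
  apply: near_eq_derive; apply: (open_near oU Ux) => y Uy.
  exact: (form_in_chart_ext_d _ oO sw ac Uy).
pose i1 : 'I_3 := Ordinal (isT : (1 < 3)%N); pose i2 : 'I_3 := Ordinal (isT : (2 < 3)%N).
have alt3 (D : 'I_3 -> R) a b d : D ord0 = a -> D i1 = b -> D i2 = d -> a - b + d = 0 ->
    \sum_(i < 3) (-1) ^+ i * D i = 0.
  move=> <- <- <- D0; rewrite !big_ord_recl big_ord0.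
  have -> : lift ord0 ord0 = i1 :> 'I_3 by exact/val_inj.
  have -> : lift ord0 (lift ord0 ord0) = i2 :> 'I_3 by exact/val_inj.
  rewrite -[LHS]/((-1) ^+ 0 * D ord0 + ((-1) ^+ 1 * D i1 + ((-1) ^+ 2 * D i2 + 0))).
  by rewrite -[RHS]D0; ring.
have l00 : lift (ord0 : 'I_3) ord0 = i1 by exact/val_inj.
have l01 : lift (ord0 : 'I_3) ord_max = i2 by exact/val_inj.
have l10 : lift i1 ord0 = ord0 by exact/val_inj.
have l11 : lift i1 ord_max = i2 by exact/val_inj.
have l20 : lift i2 ord0 = ord0 by exact/val_inj.
have l21 : lift i2 ord_max = i1 by exact/val_inj.
have E0 := E ord0; rewrite l00 l01 in E0.
have E1 := E i1; rewrite l10 l11 in E1.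
have E2 := E i2; rewrite l20 l21 in E2.
exact: alt3 E0 E1 E2 (flat_dd oU se (v ord0) (v i1) (v i2) Ux).
Qed.

End Forms.

Lemma near_chart_bwd (R : realType) (m : nat) (T : topologicalType)
    (c : chart R m T) p (P : T -> Prop) : chart_dom c p ->
  (\forall q \near p, P q) -> \forall y \near chart_fwd c p, P (chart_bwd c y).
Proof.
move=> cp nP; have := chart_bwd_cont (chart_fwd_cod cp).
by rewrite /prop_for /continuous_at (chart_fwdK cp) => /(_ _ nP).
Qed.

(** * Smooth maps, tangent maps and pull-backs *)

Section Maps.
Context {R : realType} {m n : nat} {T S : topologicalType}.
Variables (X : smooth_manifold R m T) (Y : smooth_manifold R n S).
Implicit Types (O : set T) (p q : T).

Definition map_in_charts (c : chart R m T) (c' : chart R n S) (F : T -> S) : 'rV[R]_m -> 'rV[R]_n :=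
  chart_fwd c' \o F \o chart_bwd c.

Definition map_dom (c : chart R m T) (c' : chart R n S) O (F : T -> S) : set 'rV[R]_m :=
  chart_cod c `&` chart_bwd c @^-1` (O `&` F @^-1` chart_dom c').

Lemma open_setI_preimage O (F : T -> S) (D : set S) : open O -> open D ->
  (forall p, O p -> {for p, continuous F}) -> open (O `&` F @^-1` D).
Proof.
move=> oO oD cF; rewrite openE => p [Op Dp]; apply: filterI.
  exact: (open_near oO Op).
exact: (cF p Op) (open_nbhs_nbhs (conj oD Dp)).
Qed.

Lemma open_map_dom c c' O (F : T -> S) : open O ->
  (forall p, O p -> {for p, continuous F}) -> open (map_dom c c' O F).
Proof.
move=> oO cF; apply: open_chart_preimage; apply: open_setI_preimage => //.
exact: open_dom.
Qed.

(** The pointwise condition under which the chain rule for tangent maps holds. For [Phi t] it comes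
    from the smoothness of the action in (t, x), restricted to a slice. *)
Definition mdifferentiable (F : T -> S) p : Prop :=
  {for p, continuous F} /\
  differentiable (map_in_charts (chart_at X p) (chart_at Y (F p)) F)
    (chart_fwd (chart_at X p) p).

Lemma smooth_map_mdifferentiable O (F : T -> S) p :
  smooth_map X Y O F -> O p -> mdifferentiable F p.
Proof.
move=> [cF sF] Op; split; first exact: cF.
have cp := chart_at_dom X p.
have U : map_dom (chart_at X p) (chart_at Y (F p)) O F (chart_fwd (chart_at X p) p).
  split; first exact: chart_fwd_cod.
  by rewrite /= chart_fwdK //; split => //; exact: chart_at_dom.
apply: smooth_differentiable U.
by apply: sF; exact: chart_at_atlas.
Qed.

Lemma tangent_mapE (F : T -> S) p v :
  tangent_map X Y F p v =
  'D_v (map_in_charts (chart_at X p) (chart_at Y (F p)) F) (chart_fwd (chart_at X p) p).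
Proof. by []. Qed.

Lemma near_eq_tangent_map (F G : T -> S) p v :
  (\forall q \near p, F q = G q) -> tangent_map X Y F p v = tangent_map X Y G p v.
Proof.
move=> FG; have Fp : F p = G p by exact: nbhs_singleton FG.
rewrite !tangent_mapE Fp; apply: near_eq_derive.
set c := chart_at X p; have cp : chart_dom c p by exact: chart_at_dom.
by apply: filterS (near_chart_bwd cp FG) => y Fy; rewrite /map_in_charts /= Fy.
Qed.

(** Passes from the preferred charts at q and F q, which define the tangent map, to arbitrary charts
    of the two atlases. *)
Lemma tangent_map_chart O (F : T -> S) c c' x v :
  open O -> smooth_map X Y O F -> atlas X c -> atlas Y c' -> map_dom c c' O F x ->
  tangent_map X Y F (chart_bwd c x) (tangent_of_chart X c (chart_bwd c x) v) =
  tangent_of_chart Y c' (F (chart_bwd c x)) ('D_v (map_in_charts c c' F) x).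
Proof.
move=> oO sF ac ac' Ux; have [cx [Ox c'x]] := Ux.
set q := chart_bwd c x; have aq := chart_at_atlas X q.
have aF := chart_at_atlas Y (F q).
have xq : chart_fwd c q = x by exact: chart_bwdK.
have Uq : transition_dom c (chart_at X q) x by split=> //; exact: chart_at_dom.
have [_ dF] := smooth_map_mdifferentiable sF Ox.
rewrite -/q in dF.
have [_ E1] := change_of_coordinates v ac aq Uq dF.
rewrite tangent_mapE /tangent_of_chart xq.
rewrite -[RHS]/('D_('D_v (map_in_charts c c' F) x)
  (transition c' (chart_at Y (F q))) (map_in_charts c c' F x)).
have dr : differentiable (map_in_charts c c' F) x.
  by apply: smooth_differentiable Ux; apply: sF.2.
have Ut : transition_dom c' (chart_at Y (F q)) (map_in_charts c c' F x).
  split; first exact: chart_fwd_cod.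
  by rewrite /map_in_charts /= chart_fwdK //; exact: chart_at_dom.
have dt : differentiable (transition c' (chart_at Y (F q))) (map_in_charts c c' F x).
  by apply: smooth_differentiable (smooth_transition ac' aF) Ut.
rewrite -(derive_comp v dr dt).
transitivity ('D_v ((chart_fwd (chart_at Y (F q)) \o F) \o chart_bwd c) x).
  by rewrite E1.
apply: near_eq_derive; apply: (open_near (@open_map_dom c c' O F oO sF.1) Ux).
by move=> y [cy [Oy c'y]]; rewrite /transition /map_in_charts /= chart_fwdK.
Qed.

Lemma local1_pullback O (F : T -> S) (w : @dform R n S 1) c c' x v :
  open O -> smooth_map X Y O F -> atlas X c -> atlas Y c' -> map_dom c c' O F x ->
  local1 X c (pullback_form X Y F w) x v =
  flat_pull (map_in_charts c c' F) (local1 Y c' w) x v.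
Proof.
move=> oO sF ac ac' Ux.
rewrite /local1 /flat_pull /form_in_chart /pullback_form.
have -> : chart_bwd c' (map_in_charts c c' F x) = F (chart_bwd c x).
  by rewrite /map_in_charts /= chart_fwdK //; have [_ []] := Ux.
congr (w _ _); apply/funext => _.
exact: tangent_map_chart oO sF ac ac' Ux.
Qed.

Section PullbackAt.
Variables (O : set T) (O' : set S) (F : T -> S) (w : @dform R n S 1).
Hypotheses (oO : open O) (oO' : open O') (sF : smooth_map X Y O F).
Hypothesis sw : smooth_form Y O' w.
Variables (c : chart R m T) (c' : chart R n S).
Hypotheses (ac : atlas X c) (ac' : atlas Y c').

Let U := map_dom c c' (O `&` F @^-1` O') F.

Let oU : open U.
Proof.
apply: open_map_dom => [|p [Op _]]; last exact: sF.1.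
by apply: open_setI_preimage => //; exact: sF.1.
Qed.

Let sU : smooth_on U (map_in_charts c c' F).
Proof.
by apply: smooth_on_sub (sF.2 c c' ac ac') => x [cx [[Ox _] c'x]].
Qed.

Let UU' x : U x -> chart_preimage c' O' (map_in_charts c c' F x).
Proof.
move=> [cx [[Ox O'x] c'x]]; split; first exact: chart_fwd_cod.
by rewrite /map_in_charts /= chart_fwdK.
Qed.

Lemma flat_smooth_pullback :
  flat_smooth U (flat_pull (map_in_charts c c' F) (local1 Y c' w)).
Proof.
by apply: (flat_pull_smooth oU (@open_preim _ _ _ c' O' oO') UU' sU);
   exact: flat_smooth_local1.
Qed.

Lemma flat_d_pullback x v v' : U x ->
  flat_d (local1 X c (pullback_form X Y F w)) x v v' =
  flat_d (local1 Y c' w) (map_in_charts c c' F x)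
    ('D_v (map_in_charts c c' F) x) ('D_v' (map_in_charts c c' F) x).
Proof.
move=> Ux.
rewrite -(flat_d_pull oU (@open_preim _ _ _ c' O' oO') UU' sU
  (flat_smooth_local1 sw ac') v v' Ux).
apply: near_eq_flat_d; apply: (open_near oU Ux) => y [cy [[Oy _] c'y]] a.
by apply: (local1_pullback _ _ oO sF).
Qed.

Lemma smooth_local1_pullback v :
  smooth_on U (fun x => local1 X c (pullback_form X Y F w) x v).
Proof.
apply: smooth_on_eq (flat_smooth_pullback.2 v) => // x [cx [[Ox _] c'x]].
by apply/esym/(local1_pullback _ _ oO sF).
Qed.

End PullbackAt.

Lemma smooth_pullback O (O' : set S) (F : T -> S) (w : @dform R n S 1) :
  open O -> open O' -> smooth_map X Y O F -> smooth_form Y O' w ->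
  smooth_form X (O `&` F @^-1` O') (pullback_form X Y F w).
Proof.
move=> oO oO' sF sw; split=> [p [Op O'p]|c ac v].
  apply/alternating1P => k x y; rewrite /pullback_form.
  have /alternating1P <- := sw.1 _ O'p; congr (w _ _); apply/funext => _.
  exact: derive_lin (smooth_map_mdifferentiable sF Op).2.
rewrite (fun_ord1 v); apply: smooth_on_local => x [cx Ox].
set c' := chart_at Y (F (chart_bwd c x)).
exists (map_dom c c' (O `&` F @^-1` O') F).
  by split=> //; split=> //; exact: chart_at_dom.
by apply: (smooth_local1_pullback oO oO' sF sw ac); exact: chart_at_atlas.
Qed.

Lemma ext_d_pullback O (O' : set S) (F : T -> S) (w : @dform R n S 1) p v :
  open O -> open O' -> smooth_map X Y O F -> smooth_form Y O' w -> O p -> O' (F p) ->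
  ext_d X (pullback_form X Y F w) p v = pullback_form X Y F (ext_d Y w) p v.
Proof.
move=> oO oO' sF sw Op O'p; rewrite /pullback_form !ext_d1E.
set c := chart_at X p; set c' := chart_at Y (F p); set x := chart_fwd c p.
have cp : chart_dom c p by exact: chart_at_dom.
have bx : chart_bwd c x = p by exact: chart_fwdK.
have Ux : map_dom c c' (O `&` F @^-1` O') F x.
  split; first exact: chart_fwd_cod.
  by rewrite /= bx; split=> //; exact: chart_at_dom.
have ac : atlas X c by exact: chart_at_atlas.
have ac' : atlas Y c' by exact: chart_at_atlas.
rewrite (flat_d_pullback oO oO' sF sw ac ac' _ _ Ux).
by rewrite !tangent_mapE -/c -/c' -/x {1}/map_in_charts /= bx.
Qed.

Lemma differential_comp O (F : T -> S) (f : S -> R) p v :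
  smooth_map X Y O F -> O p -> smooth_fun Y setT f ->
  differential X (f \o F) p v = differential Y f (F p) (tangent_map X Y F p v).
Proof.
move=> sF Op sf; have [cF dF] := smooth_map_mdifferentiable sF Op.
rewrite /differential tangent_mapE.
set c := chart_at X p; set c' := chart_at Y (F p); set x := chart_fwd c p.
have cp : chart_dom c p by exact: chart_at_dom.
have cFp : chart_dom c' (F p) by exact: chart_at_dom.
have bx : chart_bwd c x = p by exact: chart_fwdK.
have rx : map_in_charts c c' F x = chart_fwd c' (F p) by rewrite /map_in_charts /= bx.
have df : differentiable (f \o chart_bwd c') (map_in_charts c c' F x).
  rewrite rx; apply: (smooth_differentiable (sf c' (chart_at_atlas _ _))).
  by split=> //; exact: chart_fwd_cod.
rewrite -rx -(derive_comp v dF df); apply: near_eq_derive.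
have nF : \forall q \near p, chart_dom c' (F q).
  exact: (cF _ (open_nbhs_nbhs (conj (@open_dom _ _ _ c') cFp))).
apply: filterS (near_chart_bwd cp nF) => y Fy.
by rewrite /map_in_charts /= chart_fwdK.
Qed.

End Maps.

Section ChainRule.
Context {R : realType} {m n k : nat} {T S Q : topologicalType}.
Variables (X : smooth_manifold R m T) (Y : smooth_manifold R n S).
Variable Z : smooth_manifold R k Q.

Lemma near_map_in_charts (F : T -> S) (G : S -> Q) p : {for p, continuous F} ->
  let c := chart_at X p in let c' := chart_at Y (F p) in
  let c'' := chart_at Z (G (F p)) in
  \forall y \near chart_fwd c p,
    map_in_charts c' c'' G (map_in_charts c c' F y) = map_in_charts c c'' (G \o F) y.
Proof.
move=> cF c c' c''; have cp : chart_dom c p by exact: chart_at_dom.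
have nF : \forall q \near p, chart_dom c' (F q).
  apply: (cF _ (open_nbhs_nbhs (conj (@open_dom _ _ _ c') _))).
  exact: chart_at_dom.
apply: filterS (near_chart_bwd cp nF) => y Fy.
by rewrite /map_in_charts /= chart_fwdK.
Qed.

Lemma map_in_charts_at (F : T -> S) p :
  map_in_charts (chart_at X p) (chart_at Y (F p)) F (chart_fwd (chart_at X p) p) =
  chart_fwd (chart_at Y (F p)) (F p).
Proof. by rewrite /map_in_charts /= chart_fwdK //; exact: chart_at_dom. Qed.

Lemma tangent_map_comp (F : T -> S) (G : S -> Q) p v :
  mdifferentiable X Y F p -> mdifferentiable Y Z G (F p) ->
  tangent_map X Z (G \o F) p v = tangent_map Y Z G (F p) (tangent_map X Y F p v).
Proof.
move=> [cF dF] [cG dG]; rewrite !tangent_mapE.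
rewrite -(near_eq_derive v (near_map_in_charts G cF)).
rewrite -map_in_charts_at; apply: derive_comp => //.
by rewrite map_in_charts_at.
Qed.

Lemma tangent_map_id p v : tangent_map X X id p v = v.
Proof. exact: tangent_of_chart_at. Qed.

End ChainRule.

(** * Circle bundles *)

Section RowEmbedding.
Context {R : realType}.

(** The action is smooth in the coordinates (t, x), joined into one row vector. This map and the one
    of the next lemma parametrise the slices on which t, respectively x, is constant. *)
Lemma differentiable_row_mxr m n (a : 'rV[R]_m) (x : 'rV[R]_n) :
  differentiable (fun y : 'rV[R]_n => row_mx a y) x.
Proof.
have -> : (fun y : 'rV[R]_n => row_mx a y) =
    cst (row_mx a 0) +
    \sum_(j < n) (fun y : 'rV[R]_n => y 0 j *: row_mx 0 (delta_mx 0 j)).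
  apply/funext => y; rewrite fctE fct_sumE /=.
  transitivity (row_mx a 0 + row_mx 0 y); first by rewrite add_row_mx addr0 add0r.
  rewrite {1}(row_sum_delta y); congr (_ + _).
  elim: (index_enum _) => [|j r IHr]; first by rewrite !big_nil row_mx0.
  by rewrite !big_cons -IHr scale_row_mx add_row_mx scaler0 addr0.
apply: differentiableD; first exact: differentiable_cst.
apply: differentiable_sum => j; apply: differentiableZl.
exact: differentiable_coord.
Qed.

Lemma differentiable_row_mxl n (y : 'rV[R]_n) (t : R) :
  differentiable (fun s : R => row_mx (s%:M : 'rV[R]_1) y) t.
Proof.
have -> : (fun s : R => row_mx (s%:M : 'rV[R]_1) y) =
    cst (row_mx 0 y) + (fun s : R => s *: row_mx 1%:M 0).
  apply/funext => s; rewrite fctE /= scale_row_mx add_row_mx add0r scaler0 addr0.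
  by rewrite scale_scalar_mx mulr1.
apply: differentiableD; first exact: differentiable_cst.
exact: (differentiableZl (k := @id R)).
Qed.

End RowEmbedding.

Section KernelLine.
Context {F : fieldType} {m : nat}.

(* For the tangent map of a circle bundle projection, this dimension count
   replaces the inverse of a local trivialisation. *)
Lemma kernel_line (f : 'rV[F]_m.+1 -> 'rV[F]_m) (g : 'rV[F]_m -> 'rV[F]_m.+1)
    (x w : 'rV[F]_m.+1) :
  (forall k a b, f (k *: a + b) = k *: f a + f b) ->
  (forall v, f (g v) = v) -> x != 0 -> f x = 0 -> f w = 0 ->
  exists k, w = k *: x.
Proof.
move=> lin_f gK x0 fx fw.
pose A := \matrix_i f (delta_mx 0 i).
have fA a : f a = a *m A.
  have f0 : f 0 = 0 by have := lin_f (-1) 0 0; rewrite scaler0 addr0 scaleN1r addNr.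
  rewrite {1}(row_sum_delta a) mulmx_sum_row.
  elim: (index_enum _) => [|j r IHr]; first by rewrite !big_nil.
  by rewrite !big_cons lin_f IHr rowK.
pose G := \matrix_i g (delta_mx 0 i).
have GA : G *m A = 1%:M.
  by apply/row_matrixP => i; rewrite row_mul rowK -fA gK rowE mulmx1.
have rA : \rank A = m.
  apply/eqP; rewrite eqn_leq rank_leq_col /=.
  by rewrite -{1}(mxrank1 F m) -GA mxrankM_maxr.
have kx : (x <= kermx A)%MS by apply/sub_kermxP; rewrite -fA.
have kw : (w <= kermx A)%MS by apply/sub_kermxP; rewrite -fA.
have rx : \rank x = 1%N by rewrite rank_rV x0.
have eqk : (x == kermx A)%MS.
  by rewrite -(geq_leqif (mxrank_leqif_eq kx)) rx mxrank_ker rA subSnn.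
by apply/sub_rVP; apply: submx_trans kw _; rewrite (eqmxP eqk).
Qed.

End KernelLine.

Section CircleBundle.
Context {R : realType} {m : nat} {TM TB : topologicalType}.
Variables (M : smooth_manifold R m.+1 TM) (B : smooth_manifold R m TB).
Variables (prj : TM -> TB) (Phi : R -> TM -> TM).
Hypothesis bundle : principal_circle_bundle M B prj Phi.

Lemma prj_smooth : smooth_map M B setT prj.
Proof. by case: bundle. Qed.

Lemma prj_Phi t p : prj (Phi t p) = prj p.
Proof. by case: bundle => _ _ ->. Qed.

Lemma prj_mdifferentiable p : mdifferentiable M B prj p.
Proof. exact: smooth_map_mdifferentiable prj_smooth _. Qed.

Lemma Phi0 p : Phi 0 p = p.
Proof. by case: bundle => _ [-> _]. Qed.

Lemma Phi_continuous : continuous (fun tp : R * TM => Phi tp.1 tp.2).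
Proof. by case: bundle => _ []. Qed.

Definition action_in_charts (c c' : chart R m.+1 TM) (y : 'rV[R]_(1 + m.+1)) :=
  chart_fwd c' (Phi (lsubmx y 0 0) (chart_bwd c (rsubmx y))).

Lemma differentiable_action t p :
  let c := chart_at M p in let c' := chart_at M (Phi t p) in
  differentiable (action_in_charts c c') (row_mx (t%:M : 'rV[R]_1) (chart_fwd c p)).
Proof.
move=> c c'; case: bundle => _ [_ _ _ _ sPhi] _ _.
have cp : chart_dom c p by exact: chart_at_dom.
apply: (smooth_differentiable (sPhi c c' (chart_at_atlas _ _) (chart_at_atlas _ _))).
rewrite /= row_mxKl row_mxKr mxE eqxx chart_fwdK //.
by split; [exact: chart_fwd_cod|exact: chart_at_dom].
Qed.

Lemma Phi_mdifferentiable t p : mdifferentiable M M (Phi t) p.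
Proof.
split.
  apply: (@continuous_comp _ _ _ (fun q => (t, q)) (fun tp : R * TM => Phi tp.1 tp.2)).
    exact: (cvg_pair (cvg_cst _) cvg_id).
  exact: (@Phi_continuous (t, p)).
have -> : map_in_charts (chart_at M p) (chart_at M (Phi t p)) (Phi t) =
    fun x => action_in_charts (chart_at M p) (chart_at M (Phi t p))
               (row_mx (t%:M : 'rV[R]_1) x).
  apply/funext => x.
  by rewrite /map_in_charts /action_in_charts /= row_mxKl row_mxKr mxE eqxx.
apply: (@differentiable_comp _ _ _ _ (fun x => row_mx (t%:M : 'rV[R]_1) x)).
  exact: differentiable_row_mxr.
exact: differentiable_action.
Qed.

Lemma orbit_differentiable p :
  differentiable (fun t : R => chart_fwd (chart_at M p) (Phi t p)) 0.
Proof.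
set c := chart_at M p; have cp : chart_dom c p by exact: chart_at_dom.
have -> : (fun t : R => chart_fwd c (Phi t p)) =
    fun t => action_in_charts c c (row_mx (t%:M : 'rV[R]_1) (chart_fwd c p)).
  apply/funext => t.
  by rewrite /action_in_charts /= row_mxKl row_mxKr mxE eqxx chart_fwdK.
apply: (@differentiable_comp _ _ _ _
  (fun t : R => row_mx (t%:M : 'rV[R]_1) (chart_fwd c p))).
  exact: differentiable_row_mxl.
by have := @differentiable_action 0 p; rewrite /= Phi0.
Qed.

(** The projection is constant along each orbit. *)
Lemma tangent_prj_generator p : tangent_map M B prj p (generator M Phi p) = 0.
Proof.
set c := chart_at M p; have cp : chart_dom c p by exact: chart_at_dom.
rewrite tangent_mapE /generator derive1E -/c.
have g0 : chart_fwd c (Phi 0 p) = chart_fwd c p by rewrite Phi0.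
have dprj : differentiable (map_in_charts c (chart_at B (prj p)) prj)
    (chart_fwd c (Phi 0 p)) by rewrite g0; exact: (prj_mdifferentiable p).2.
rewrite -g0 -(derive_comp (1 : R) (orbit_differentiable p) dprj).
rewrite -[RHS](derive_cst (chart_fwd (chart_at B (prj p)) (prj p)) (0 : R) (1 : R)).
apply: near_eq_derive.
have cPhi : {for 0, continuous (fun t => Phi t p)}.
  apply: (@continuous_comp _ _ _ (fun t => (t, p)) (fun tp : R * TM => Phi tp.1 tp.2)).
    exact: (cvg_pair cvg_id (cvg_cst _)).
  exact: (@Phi_continuous (0, p)).
have nc : \forall q \near Phi 0 p, chart_dom c q.
  by rewrite Phi0; exact: (open_near (@open_dom _ _ _ c) cp).
have nt : \forall t \near (0 : R), chart_dom c (Phi t p) by exact: (cPhi _ nc).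
apply: filterS nt => t ct.
by rewrite /map_in_charts /= chart_fwdK // prj_Phi.
Qed.

Definition local_section (U : set TB) (sigma : TB -> TM) : Prop :=
  [/\ open U, smooth_map B M U sigma, (forall q, U q -> prj (sigma q) = q) &
      forall p, U (prj p) -> exists t, p = Phi t (sigma (prj p))].

Lemma local_section_exists b : exists U sigma, U b /\ local_section U sigma.
Proof.
case: bundle => _ _ _ /(_ b)[U [sigma [c [s [[oU Ub] [ss ps] _ _ orb]]]]].
by exists U, sigma.
Qed.

Lemma tangent_prj_section U sigma b v : local_section U sigma -> U b ->
  tangent_map M B prj (sigma b) (tangent_map B M sigma b v) = v.
Proof.
move=> [oU ss ps _] Ub.
rewrite -(tangent_map_comp v (smooth_map_mdifferentiable ss Ub)); last first.
  exact: prj_mdifferentiable.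
rewrite -[RHS](tangent_map_id B b v); apply: near_eq_tangent_map.
by apply: (open_near oU Ub) => q Uq; exact: ps.
Qed.

Lemma tangent_prj_Phi t p v :
  tangent_map M B prj (Phi t p) (tangent_map M M (Phi t) p v) =
  tangent_map M B prj p v.
Proof.
rewrite -(tangent_map_comp v (Phi_mdifferentiable t p)); last first.
  exact: prj_mdifferentiable.
have -> : prj \o Phi t = prj by apply/funext => q; exact: prj_Phi.
by [].
Qed.

(** The tangent map of a local section is a right inverse at the point of the section over [prj p],
    and the action carries it to p. *)
Lemma tangent_prj_lift p : exists g : 'rV[R]_m -> 'rV[R]_m.+1,
  forall v, tangent_map M B prj p (g v) = v.
Proof.
have [U [sigma [Ub ls]]] := local_section_exists (prj p).
have [_ _ _ /(_ p Ub)[t pt]] := ls.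
exists (fun v => tangent_map M M (Phi t) (sigma (prj p))
                   (tangent_map B M sigma (prj p) v)) => v.
rewrite [X in tangent_map M B prj X]pt tangent_prj_Phi.
exact: tangent_prj_section ls Ub.
Qed.

Lemma tangent_prj_lin p (k : R) v w :
  tangent_map M B prj p (k *: v + w) =
  k *: tangent_map M B prj p v + tangent_map M B prj p w.
Proof. exact: derive_lin (prj_mdifferentiable p).2. Qed.

Lemma tangent_prj_kernel p w : generator M Phi p != 0 ->
  tangent_map M B prj p w = 0 -> exists k, w = k *: generator M Phi p.
Proof.
move=> g0 w0; have [g gK] := tangent_prj_lift p.
exact: (kernel_line (tangent_prj_lin p) gK g0 (tangent_prj_generator p) w0).
Qed.

Section Descent.
Variable theta : @dform R m.+1 TM 1.
Hypotheses (smooth_theta : smooth_form M setT theta).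
Hypotheses (inv_theta : invariant_form M Phi theta).
Hypothesis generator_neq0 : forall p, generator M Phi p != 0.
Hypothesis hor_theta : forall p, theta p (fun=> generator M Phi p) = 0.

(** By invariance the right-hand side is theta at p on another vector with the same projection as w.
    The two vectors differ by a multiple of the generator, on which theta vanishes. *)
Lemma horizontal_section U sigma p w : local_section U sigma -> U (prj p) ->
  theta p (fun=> w) =
  theta (sigma (prj p))
    (fun=> tangent_map B M sigma (prj p) (tangent_map M B prj p w)).
Proof.
move=> ls Ub; have [_ _ _ /(_ p Ub)[t pt]] := ls.
set v := tangent_map B M sigma (prj p) (tangent_map M B prj p w).
rewrite -[RHS](inv_theta t) /pullback_form -pt.
set w' := tangent_map M M (Phi t) (sigma (prj p)) v.
have lin_theta : forall (k : R) x y,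
    theta p (fun=> k *: x + y) = k * theta p (fun=> x) + theta p (fun=> y).
  by apply/alternating1P; exact: smooth_theta.1.
have Tw' : tangent_map M B prj p w' = tangent_map M B prj p w.
  rewrite [X in tangent_map M B prj X w']pt /w' tangent_prj_Phi.
  exact: tangent_prj_section ls Ub.
have [k wk] : exists k, (-1) *: w' + w = k *: generator M Phi p.
  by apply: tangent_prj_kernel => //; rewrite tangent_prj_lin Tw' scaleN1r addNr.
have : theta p (fun=> (-1) *: w' + w) = 0.
  rewrite wk -[k *: _]addr0 lin_theta hor_theta mulr0 add0r.
  have := lin_theta (-1) 0 0; rewrite scaler0 addr0 mulN1r addNr; exact.
by rewrite lin_theta mulN1r addrC => /eqP; rewrite subr_eq0 => /eqP.
Qed.

Lemma descend_form : exists lambda : @dform R m TB 1,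
  smooth_form B setT lambda /\
  forall p v, theta p v = pullback_form M B prj lambda p v.
Proof.
have ch b : exists Us : set TB * (TB -> TM), Us.1 b /\ local_section Us.1 Us.2.
  by have [U [sigma H]] := local_section_exists b; exists (U, sigma).
have [s Hs] := choice ch.
(* A section is chosen at each b with no regularity in b. By [lambdaE] any section around b gives
   the same value, so near every point lambda is the pull-back of theta by one smooth section. *)
pose lambda : @dform R m TB 1 := fun b v =>
  theta ((s b).2 b) (fun i => tangent_map B M (s b).2 b (v i)).
have lambdaE U sigma b v : local_section U sigma -> U b ->
    lambda b v = pullback_form B M sigma theta b v.
  move=> ls Ub; rewrite (fun_ord1 v) /lambda /pullback_form.
  have [Sb lsb] := Hs b; have ps : prj (sigma b) = b by have [_ _ -> ] := ls.
  have Sb' : (s b).1 (prj (sigma b)) by rewrite ps.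
  rewrite (horizontal_section _ lsb Sb') (tangent_prj_section _ ls Ub).
  by rewrite ps.
exists lambda; split=> [|p v]; last first.
  rewrite (fun_ord1 v) /lambda /pullback_form.
  have [Sb lsb] := Hs (prj p); exact: horizontal_section lsb Sb.
apply: smooth_form_local => b _.
have [U [sigma [Ub ls]]] := local_section_exists b.
have [oU ss _ _] := ls; exists U => //.
have := smooth_pullback oU openT ss smooth_theta.
rewrite preimage_setT setIT => -[aw sw]; split=> [q Uq|c ac v].
  rewrite (_ : lambda q = pullback_form B M sigma theta q); first exact: aw.
  by apply/funext => v; exact: lambdaE ls Uq.
apply: smooth_on_eq (sw c ac v) => [|x [cx Ux]]; first exact: open_preim.
by rewrite /form_in_chart (lambdaE _ _ _ _ ls Ux).
Qed.

End Descent.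

End CircleBundle.

(** * Positivity of top-degree forms *)

Section CovectorProducts.
Context {R : realType} {V : lmodType R}.

Lemma eval_cov1 (a : covector V 1) x : eval_cov a [:: x] = a (fun=> x).
Proof. by rewrite /eval_cov; congr (a _); apply/funext => i; rewrite (ord1 i). Qed.

Lemma cov_ext1 (a : covector V 1) x : cov_ext a [:: x] = a (fun=> x).
Proof. by rewrite cov_extE // eval_cov1. Qed.

Lemma cov_ext_mul1 (a b : covector V 1) :
  cov_ext (fun v : 'I_2 -> V =>
    a (fun=> v ord0) * b (fun=> v ord_max) - a (fun=> v ord_max) * b (fun=> v ord0)) =
  cov_ext a * cov_ext b.
Proof.
apply: ext_eqP => s; case: (eqVneq (size s) 2%N) => [|s2]; last first.
  by rewrite (degreeM (degree_cov a) (degree_cov b) s2) degree_cov.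
case: s => [|x [|y [|z s]]] // _.
have da := degree_cov a; have db := degree_cov b.
rewrite deg1_mul_cons // (contract_deg1 _ db) -scalerAr ext_scaleE mulr1.
by rewrite cov_extE // /eval_cov /= !cov_ext1 [_ * a _]mulrC.
Qed.

Lemma cov_extD k (a b : covector V k) :
  cov_ext (fun v => a v + b v) = cov_ext a + cov_ext b.
Proof.
apply: ext_eqP => s; rewrite ext_addE /cov_ext.
by case: ifP => // _; rewrite addr0.
Qed.

Lemma cov_ext_pull (W : lmodType R) k (f : W -> V) (a : covector V k) :
  cov_ext (fun v : 'I_k -> W => a (fun i => f (v i))) = ext_pull f (cov_ext a).
Proof.
apply: ext_eqP => s; rewrite /ext_pull /cov_ext size_map; case: eqP => // sk.
rewrite /eval_cov; congr (a _); apply/funext => i.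
by rewrite (nth_map 0) // sk.
Qed.

End CovectorProducts.

Section TopPositivity.
Context {R : realType} {m : nat}.
Local Notation ext := (shuffle_alg R 'rV[R]_m).

(** A change of frame multiplies the product of two top-degree forms by the square of a determinant,
    which leaves its sign unchanged. *)
Lemma top_positive (a vol : ext) s0 s : multilin a -> skew a -> multilin vol -> skew vol ->
  size s0 = m -> size s = m -> 0 < a s0 * vol s0 -> vol s != 0 -> 0 < a s * vol s.
Proof.
move=> ma ka mv kv sz0 sz pos vs.
have E := top_proportional ma ka mv kv sz sz0.
have v0 : vol s0 != 0 by apply: contraTneq pos => ->; rewrite mulr0 ltxx.
have sq0 : 0 < vol s0 * vol s0 by rewrite -expr2 exprn_even_gt0.
have sq : 0 < vol s * vol s by rewrite -expr2 exprn_even_gt0.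
rewrite -(pmulr_lgt0 _ sq0) mulrACA E.
have -> : a s0 * vol s * (vol s * vol s0) = a s0 * vol s0 * (vol s * vol s) by ring.
exact: mulr_gt0.
Qed.

End TopPositivity.

Section DifferentialForm.
Context {R : realType} {m : nat} {T : topologicalType}.
Variable X : smooth_manifold R m T.

Definition d_fun (f : T -> R) : dform m T 1 := fun p v => differential X f p (v ord0).

Lemma differential_lin O (f : T -> R) p (k : R) v w : smooth_fun X O f -> O p ->
  differential X f p (k *: v + w) = k * differential X f p v + differential X f p w.
Proof.
move=> sf Op; apply: derive_lin.
exact: smooth_differentiable (sf _ (chart_at_atlas X p)) (chart_at_preimage X Op).
Qed.

Lemma smooth_d_fun O (f : T -> R) : open O -> smooth_fun X O f ->
  smooth_form X O (d_fun f).
Proof.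
move=> oO sf; split=> [p Op|c ac v].
  by apply/alternating1P => k x y; exact: differential_lin sf Op.
have oU := @open_preim _ _ _ c O oO.
apply: smooth_on_eq (smooth_derive (v ord0) (sf c ac)) => // x [cx Ox].
rewrite /form_in_chart /d_fun /differential.
set q := chart_bwd c x; have aq := chart_at_atlas X q.
have Ux : transition_dom c (chart_at X q) x by split=> //; exact: chart_at_dom.
have dq : differentiable (f \o chart_bwd (chart_at X q)) (transition c (chart_at X q) x).
  exact: smooth_differentiable (sf _ aq) (chart_at_preimage X Ox).
rewrite (change_of_coordinates (v ord0) ac aq Ux dq).2.
by rewrite /tangent_of_chart (chart_bwdK cx).
Qed.

Lemma smooth_fun_continuous (f : T -> R) : smooth_fun X setT f -> continuous f.
Proof.
move=> sf p; set c := chart_at X p; have cp : chart_dom c p by exact: chart_at_dom.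
have ac : atlas X c by exact: chart_at_atlas.
have cf : {for chart_fwd c p, continuous (f \o chart_bwd c)}.
  by apply: (smooth_continuous (sf c ac)); split=> //; exact: chart_fwd_cod.
have cg : {for p, continuous ((f \o chart_bwd c) \o chart_fwd c)}.
  by apply: continuous_comp => //; exact: chart_fwd_cont.
rewrite /continuous_at; have -> : f p = ((f \o chart_bwd c) \o chart_fwd c) p.
  by rewrite /= chart_fwdK.
apply: cvg_trans cg; apply: near_eq_cvg.
by apply: (open_near (@open_dom _ _ _ c) cp) => q cq; rewrite /= chart_fwdK.
Qed.

Lemma multilin_form O k (w : dform m T k) p : smooth_form X O w -> O p ->
  multilin (cov_ext (w p)).
Proof. by move=> [aw _] Op; apply: multilin_cov; exact: aw. Qed.

Lemma skew_form O k (w : dform m T k) p : smooth_form X O w -> O p ->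
  skew (cov_ext (w p)).
Proof. by move=> [aw _] Op; apply: skew_cov; exact: aw. Qed.

End DifferentialForm.

Section ContinuousFamilies.
Context {R : realType} {m : nat} {T : topologicalType}.
Variable X : smooth_manifold R m T.
Variable b : T.
Local Notation ext := (shuffle_alg R 'rV[R]_m).

(** The values of A at different points belong to tangent spaces read in different charts; pulled
    back along the chart at b they can be compared, and continuity at (b, 0) makes sense. *)
Definition chart_family (A : R -> T -> ext) (z : T * R) : ext :=
  ext_pull (tangent_of_chart X (chart_at X b) z.1) (A z.2 z.1).

Definition continuous_family (A : R -> T -> ext) : Prop :=
  forall s, {for (b, 0 : R), continuous (fun z => chart_family A z s)}.

Lemma continuous_familyD A A' : continuous_family A -> continuous_family A' ->
  continuous_family (fun c q => A c q + A' c q).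
Proof. by move=> cA cA' s; apply: continuousD; [exact: cA|exact: cA']. Qed.

Lemma continuous_familyZ (k : R -> T -> R) A :
  {for (b, 0 : R), continuous (fun z : T * R => k z.2 z.1)} -> continuous_family A ->
  continuous_family (fun c q => k c q *: A c q).
Proof. by move=> ck cA s; apply: continuousM => //; exact: cA. Qed.

Lemma continuous_shuffle (A A' : T * R -> ext) s :
  (forall s, {for (b, 0 : R), continuous (fun z => A z s)}) ->
  (forall s, {for (b, 0 : R), continuous (fun z => A' z s)}) ->
  {for (b, 0 : R), continuous (fun z => shuffle s (A z) (A' z))}.
Proof.
elim: s A A' => [|x s IHs] A A' cA cA' /=.
  by apply: continuousM; [exact: cA|exact: cA'].
apply: continuousD; apply: IHs => // t.
- exact: (cA (x :: t)).
- by apply: continuousM; [exact: cst_continuous|exact: cA].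
- exact: (cA' (x :: t)).
Qed.

Lemma continuous_familyM A A' : continuous_family A -> continuous_family A' ->
  continuous_family (fun c q => A c q * A' c q).
Proof.
move=> cA cA' s.
have -> : (fun z => chart_family (fun c q => A c q * A' c q) z s) =
    fun z => shuffle s (chart_family A z) (chart_family A' z).
  by apply/funext => z; rewrite /chart_family ext_pullM.
exact: continuous_shuffle.
Qed.

Lemma continuous_family_exp A n : continuous_family A ->
  continuous_family (fun c q => A c q ^+ n).
Proof.
move=> cA; elim: n => [|n IHn].
  move=> s; have -> : (fun z => chart_family (fun c q => A c q ^+ 0) z s) =
      cst ((1 : ext) s : R).
    by apply/funext => z; rewrite /chart_family expr0 ext_pull1.
  exact: cst_continuous.
have -> : (fun c q => A c q ^+ n.+1) = fun c q => A c q * A c q ^+ n.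
  by apply/funext => c; apply/funext => q; rewrite exprS.
exact: continuous_familyM.
Qed.

Lemma continuous_family_form O k (w : dform m T k) : open O -> O b ->
  smooth_form X O w -> continuous_family (fun _ q => cov_ext (w q)).
Proof.
move=> oO Ob sw s; set c := chart_at X b; have cb : chart_dom c b by exact: chart_at_dom.
have ac : atlas X c by exact: chart_at_atlas.
case: (eqVneq (size s) k) => [sk|sk]; last first.
  have -> : (fun z => chart_family (fun _ q => cov_ext (w q)) z s) = cst 0.
    apply/funext => z; rewrite /chart_family /ext_pull /cov_ext size_map.
    by rewrite (negbTE sk).
  exact: cst_continuous.
pose v (i : 'I_k) := s`_i.
have cf : {for chart_fwd c b, continuous (fun x => form_in_chart X c w x v)}.
  by apply: (smooth_continuous (sw.2 c ac v)); exact: chart_at_preimage.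
have cg : {for b, continuous ((fun x => form_in_chart X c w x v) \o chart_fwd c)}.
  by apply: continuous_comp => //; exact: chart_fwd_cont.
have ch : {for (b, 0 : R), continuous
    (((fun x => form_in_chart X c w x v) \o chart_fwd c) \o (@fst T R))}.
  by apply: continuous_comp => //; exact: cvg_fst.
have E q a : chart_dom c q -> form_in_chart X c w (chart_fwd c q) v =
    chart_family (fun _ q => cov_ext (w q)) (q, a) s.
  move=> cq; rewrite /chart_family /ext_pull cov_extE ?size_map //=.
  rewrite /form_in_chart (chart_fwdK cq) /eval_cov; congr (w q _).
  by apply/funext => i; rewrite (nth_map 0) // sk.
rewrite /prop_for /continuous_at -(E b 0 cb).
apply: cvg_trans ch; apply: near_eq_cvg.
have nb : \forall z \near (b, 0 : R), chart_dom c z.1.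
  by apply: cvg_fst; exact: (open_near (@open_dom _ _ _ c) cb).
by apply: filterS nb => -[q a] /= cq; rewrite (E q a cq).
Qed.

End ContinuousFamilies.

Section UniformPositivity.
Context {R : realType} {m : nat} {T : topologicalType}.
Variable X : smooth_manifold R m T.
Variable vol : @dform R m T m.
Hypothesis vol_form : volume_form X vol.
Local Notation ext := (shuffle_alg R 'rV[R]_m).

(** The product with vol treats frames of both orientations alike, so no positive frame has to be
    chosen. *)
Definition top_pos (a : ext) (q : T) : Prop := forall s, size s = m ->
  cov_ext (vol q) s != 0 -> 0 < a s * cov_ext (vol q) s.

Lemma vol_neq0 q : exists2 s, size s = m & cov_ext (vol q) s != 0.
Proof.
have [v v0] := vol_form.2 q; pose s := [seq v i | i <- enum 'I_m].
have sz : size s = m by rewrite size_map size_enum_ord.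
exists s => //; rewrite cov_extE // /eval_cov.
suff -> : (fun i : 'I_m => s`_i) = v by [].
by apply/funext => i; rewrite (nth_map i) ?size_enum_ord // nth_ord_enum.
Qed.

(** One frame suffices at each b: carried to nearby q by the chart at b, it keeps the product
    positive for (q, c) near (b, 0), and [top_positive] extends this to all frames. Compactness of K
    makes the range of c uniform. *)
Lemma uniform_positivity (K : set T) (A : R -> T -> ext) : compact K ->
  (forall c q, multilin (A c q) /\ skew (A c q)) ->
  (forall b, K b -> continuous_family X b A) ->
  (forall b, K b -> top_pos (A 0 b) b) ->
  \forall c \near (0 : R), forall q, K q -> top_pos (A c q) q.
Proof.
move=> cK altA cA pA; have mv q := multilin_form vol_form.1 (I : setT q).
have kv q := skew_form vol_form.1 (I : setT q).
move/compact_near_coveringP : cK => /(_ R (nbhs (0 : R)) (fun c q => top_pos (A c q) q)).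
apply=> b Kb.
have [s sz vs] := vol_neq0 b.
pose F (z : T * R) :=
  chart_family X b A z s * chart_family X b (fun _ q => cov_ext (vol q)) z s.
have cF : {for (b, 0 : R), continuous F}.
  apply: continuousM; first exact: cA.
  exact: (continuous_family_form openT (I : setT b) vol_form.1).
have F0 : 0 < F (b, 0).
  rewrite /F /chart_family /= /ext_pull.
  have -> : map (tangent_of_chart X (chart_at X b) b) s = s.
    by apply: map_id_in => v _; exact: tangent_of_chart_at.
  exact: pA.
have nF : \forall z \near (b, 0 : R), 0 < F z.
  exact: (cvgr_gt _ cF _ F0).
apply: filterS nF => -[q c] /= Fqc t st vt.
apply: (top_positive (s0 := map (tangent_of_chart X (chart_at X b) q) s)) Fqc vt => //.
- exact: (altA c q).1.
- exact: (altA c q).2.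
- by rewrite size_map.
Qed.

End UniformPositivity.

Lemma multilin_scale (R : comNzRingType) (V : lmodType R) (a : shuffle_alg R V) s
    (k : R) x t : multilin a -> a (s ++ k *: x :: t) = k * a (s ++ x :: t).
Proof.
move=> ma; have a0 : a (s ++ 0 :: t) = 0.
  by have := ma s (-1) 0 0 t; rewrite scaler0 addr0 mulN1r addNr.
by have := ma s k x 0 t; rewrite a0 !addr0.
Qed.

(** * Connection forms and the contact condition on the base *)

Section Connections.
Context {R : realType} {m : nat} {TM TB : topologicalType}.
Variables (M : smooth_manifold R m.+1 TM) (B : smooth_manifold R m TB).
Variables (prj : TM -> TB) (Phi : R -> TM -> TM).
Hypothesis bundle : principal_circle_bundle M B prj Phi.

Lemma generator_neq0 (psi : dform m.+1 TM 1) p :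
  connection_form M Phi psi -> generator M Phi p != 0.
Proof.
move=> [[alt_psi _] _ norm_psi]; apply/eqP => g0.
have := norm_psi p; rewrite g0 eval_cov1.
have /alternating1P lin := alt_psi p I; have := lin (-1) 0 0.
rewrite scaler0 addr0 mulN1r addNr => -> /eqP.
by rewrite eq_sym oner_eq0.
Qed.

Lemma connection_difference (psi psi' : dform m.+1 TM 1) :
  connection_form M Phi psi -> connection_form M Phi psi' ->
  exists lambda : dform m TB 1, smooth_form B setT lambda /\
    forall p v, psi p v = psi' p v + pullback_form M B prj lambda p v.
Proof.
move=> cpsi cpsi'; have [spsi ipsi npsi] := cpsi; have [spsi' ipsi' npsi'] := cpsi'.
pose theta : dform m.+1 TM 1 := fun p v => psi p v + form_scale (-1) psi' p v.
have stheta : smooth_form M setT theta.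
  by apply: smooth_formD => //; [exact: openT|apply: smooth_form_scale => //; exact: openT].
have itheta : invariant_form M Phi theta.
  move=> t p v; have := ipsi t p v; have := ipsi' t p v.
  by rewrite /pullback_form /theta /form_scale => -> ->.
have [|lambda [sl El]] := descend_form bundle stheta itheta
    (fun p => generator_neq0 p cpsi).
  move=> p; rewrite /theta /form_scale -!eval_cov1 npsi npsi'.
  by rewrite mulr1 subrr.
exists lambda; split=> // p v; rewrite -El /theta /form_scale.
by rewrite mulN1r addrC subrK.
Qed.

Lemma prj_surj b : exists p, prj p = b.
Proof.
have [U [sigma [Ub [_ _ ps _]]]] := local_section_exists bundle b.
by exists (sigma b); exact: ps.
Qed.

End Connections.

Section ContactPositivity.
Context {R : realType} {n : nat} {TM TB : topologicalType}.
Variables (M : smooth_manifold R (n * 2).+1 TM) (B : smooth_manifold R (n * 2) TB).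
Variables (prj : TM -> TB) (Phi : R -> TM -> TM).
Hypothesis bundle : principal_circle_bundle M B prj Phi.
Variables (volB : @dform R (n * 2) TB (n * 2)) (psi alpha : @dform R (n * 2).+1 TM 1).
Variables (u : TB -> R) (beta : @dform R (n * 2) TB 1) (w : @dform R (n * 2) TB 2).
Hypotheses (vol_form : volume_form B volB) (cpsi : connection_form M Phi psi).
Hypothesis alpha_contact : positive_contact_form M
  (form_wedge psi (pullback_form M B prj volB)) alpha.
Hypotheses (su : smooth_fun B setT u) (sbeta : smooth_form B setT beta).
Hypothesis alphaE : forall p v,
  alpha p v = pullback_form M B prj beta p v + u (prj p) * psi p v.
Hypothesis sw : smooth_form B setT w.
Hypothesis dpsi : forall p v, ext_d M psi p v = pullback_form M B prj w p v.

Local Notation E b := (cov_ext (ext_d B beta b)).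
Local Notation W b := (cov_ext (w b)).
Local Notation Be b := (cov_ext (beta b)).
Local Notation dU b := (cov_ext (d_fun B u b)).
Local Notation pull p := (ext_pull (tangent_map M B prj p)).

Lemma cov_alpha p : cov_ext (alpha p) =
  pull p (Be (prj p)) + u (prj p) *: cov_ext (psi p).
Proof.
rewrite -cov_ext_pull -cov_extZ -cov_extD; congr cov_ext.
by apply/funext => v; rewrite alphaE.
Qed.

Lemma smooth_fun_prj : smooth_fun M setT (u \o prj).
Proof.
move=> c ac; have [cprj sprj] := prj_smooth bundle.
apply: smooth_on_local => x [cx _].
set c' := chart_at B (prj (chart_bwd c x)); have ac' : atlas B c' by exact: chart_at_atlas.
exists (map_dom c c' setT prj).
  by split=> //; split=> //; exact: chart_at_dom.
have oU : open (map_dom c c' setT prj) by apply: open_map_dom => //; exact: openT.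
have oV := @open_preim _ _ _ c' setT openT.
have UV y : map_dom c c' setT prj y ->
    chart_preimage c' setT (map_in_charts c c' prj y).
  by move=> [cy [_ c'y]]; split=> //; exact: chart_fwd_cod.
apply: smooth_on_eq (smooth_on_comp oU oV UV (sprj c c' ac ac') (su ac')) => //.
by move=> y [cy [_ c'y]]; rewrite /map_in_charts /= chart_fwdK.
Qed.

Lemma cov_dalpha p : cov_ext (ext_d M alpha p) =
  pull p (E (prj p) + u (prj p) *: W (prj p)) + pull p (dU (prj p)) * cov_ext (psi p).
Proof.
have [spsi _ _] := cpsi.
pose beta' := pullback_form M B prj beta.
have sbeta' : smooth_form M setT beta'.
  have := smooth_pullback openT openT (prj_smooth bundle) sbeta.
  by rewrite preimage_setT setIT.
pose upsi : dform (n * 2).+1 TM 1 := fun p v => (u \o prj) p * psi p v.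
have supsi : smooth_form M setT upsi.
  by apply: smooth_formM spsi; [exact: openT|exact: smooth_fun_prj].
have -> : alpha = fun p v => beta' p v + upsi p v.
  by apply/funext => q; apply/funext => v; exact: alphaE.
have -> : pull p (E (prj p) + u (prj p) *: W (prj p)) +
    pull p (dU (prj p)) * cov_ext (psi p) =
    pull p (E (prj p)) + (pull p (dU (prj p)) * cov_ext (psi p) +
    u (prj p) *: pull p (W (prj p))).
  by rewrite ext_pullD ext_pullZ -addrA [X in _ + X]addrC.
rewrite -!cov_ext_pull -cov_ext_mul1 -cov_extZ -!cov_extD; congr cov_ext.
apply/funext => v; rewrite (ext_dD v sbeta' supsi I).
have d1 : ext_d M beta' p v = pullback_form M B prj (ext_d B beta) p v.
  exact: ext_d_pullback openT openT (prj_smooth bundle) sbeta I I.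
have d2 := ext_d_mul v smooth_fun_prj spsi (I : setT p).
rewrite d1 [ext_d M upsi p v]d2 dpsi.
by rewrite !(differential_comp _ (prj_smooth bundle) (I : setT p) su).
Qed.

(** Both top-degree forms on M are contracted with the generator and evaluated on the lift of a
    frame of B: psi /\ vol gives vol, and alpha /\ (d alpha)^n gives [contact_top]. *)
Lemma contact_positive b :
  top_pos volB (contact_top n (u b) (E b + u b *: W b) (Be b) (dU b)) b.
Proof.
have [p <-] := prj_surj bundle b; have [g gK] := tangent_prj_lift bundle p.
move=> s sz vs; set Q := contact_top _ _ _ _ _; set f := tangent_map M B prj p.
have mapK : map f (map g s) = s.
  by rewrite -map_comp -[RHS]map_id; apply: eq_map => v /=; exact: gK.
set x := generator M Phi p.
have fx : f x = 0 by exact: tangent_prj_generator.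
have [[apsi _] _ norm_psi] := cpsi.
have kvol := skew_form vol_form.1 (I : setT (prj p)).
have mvol := multilin_form vol_form.1 (I : setT (prj p)).
have f0 : f 0 = 0.
  have := tangent_prj_lin bundle p (-1) 0 0.
  by rewrite scaler0 addr0 scaleN1r addNr.
have cpull k (a : covector 'rV[R]_(n * 2) k) : alternating a ->
    ext_contract x (pull p (cov_ext a)) = 0.
  move=> alt_a; apply: ext_eqP => t.
  rewrite /ext_contract /ext_pull /= -/f fx.
  have := multilin_cov alt_a [::] (-1) 0 0 (map f t).
  by rewrite scaler0 addr0 mulN1r addNr.
have psix : cov_ext (psi p) [:: x] = 1 by rewrite cov_ext1 -eval_cov1; exact: norm_psi.
have dpsi1 := degree_cov (psi p).
have covol : cov_ext (pullback_form M B prj volB p) = pull p (cov_ext (volB (prj p))).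
  by rewrite -cov_ext_pull.
pose A := cov_ext (psi p) * pull p (cov_ext (volB (prj p))).
pose C := cov_ext (alpha p) * cov_ext (ext_d M alpha p) ^+ n.
have [salpha pos_alpha] := alpha_contact.
have kda : skew (cov_ext (ext_d M alpha p)).
  by apply: skew_cov; apply: alternating_ext_d salpha I; exact: openT.
have mda : multilin (cov_ext (ext_d M alpha p)).
  by apply: multilin_cov; apply: alternating_ext_d salpha I; exact: openT.
have covA : cov_ext (form_wedge psi (pullback_form M B prj volB) p) = A.
  rewrite /form_wedge cov_ext_wedge ?covol //; first exact: skew_deg1.
  by move=> t y z r; rewrite /ext_pull !map_cat /=; exact: kvol.
have covC : cov_ext (form_wedge alpha (form_exp (ext_d M alpha) n) p) = C.
  rewrite /form_wedge cov_ext_wedge /form_exp ?cov_ext_exp //.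
    exact/skew_deg1/degree_cov.
  exact: skew_exp.
have posAC t : size t = (n * 2).+1 -> 0 < A t -> 0 < C t.
  move=> szt; have := pos_alpha p t szt (fun _ _ => I).
  by rewrite -!cov_extE // covA covC.
have altp := apsi p I; have alta := salpha.1 p I.
have contractA : ext_contract x A = pull p (cov_ext (volB (prj p))).
  rewrite contractM contract_deg1 // psix scale1r mul1r cpull ?mulr0 ?addr0 //.
  exact: vol_form.1.1.
have mpull a : multilin a -> multilin (pull p a).
  move=> ma r k y z t; rewrite /ext_pull !map_cat /=.
  by rewrite (tangent_prj_lin bundle) ma.
have mA : multilin A by apply: multilinM; [exact: multilin_cov|exact: mpull].
have mC : multilin C by apply: multilinM; [exact: multilin_cov|exact: multilin_exp].
have contractC : ext_contract x C = pull p Q.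
  have cb := cpull _ _ (sbeta.1 (prj p) I).
  have cdu := cpull _ _ ((smooth_d_fun openT su).1 (prj p) I).
  have cE := cpull _ _ (alternating_ext_d openT sbeta (I : setT (prj p))).
  have cW := cpull _ _ (sw.1 (prj p) I).
  rewrite /C cov_alpha cov_dalpha contract_contact_form //.
  - by rewrite /Q /contact_top pull_contact_top ext_pullD ext_pullZ.
  - by apply/degree_pull/degreeD; [|apply: degreeZ]; exact: degree_cov.
  - exact/degree_pull/degree_cov.
  - exact/degree_pull/degree_cov.
  - by rewrite ext_pullD ext_pullZ contractD contractZ cE cW scaler0 addr0.
  - by have := congr1 (fun a : shuffle_alg _ _ => a [::]) cb.
  - by have := congr1 (fun a : shuffle_alg _ _ => a [::]) cdu.
(* Scaling the generator by k = vol(s) makes the lifted frame positive for either sign of k: psi /\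
   vol takes the value k^2 on it. *)
pose k : R := cov_ext (volB (prj p)) s.
have scal a : multilin a -> a ((k *: x) :: map g s) = k * ext_contract x a (map g s).
  exact: multilin_scale [::] _ _ _.
have := posAC ((k *: x) :: map g s); rewrite /= size_map sz => /(_ erefl).
rewrite (scal _ mA) (scal _ mC) contractA contractC /ext_pull mapK -/k.
rewrite [k * Q s]mulrC; apply.
by rewrite -expr2 exprn_even_gt0.
Qed.

End ContactPositivity.

Section ContactTopFamily.
Context {R : realType} {n : nat} {T : topologicalType}.
Variable B : smooth_manifold R (n * 2) T.
Variables (volB : @dform R (n * 2) T (n * 2)).
Variables (u : T -> R) (beta : @dform R (n * 2) T 1) (w : @dform R (n * 2) T 2).
Hypotheses (vol_form : volume_form B volB) (B_compact : compact [set: T]).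
Hypotheses (su : smooth_fun B setT u) (sbeta : smooth_form B setT beta).
Hypothesis sw : smooth_form B setT w.

Local Notation E b := (cov_ext (ext_d B beta b)).
Local Notation W b := (cov_ext (w b)).
Local Notation Be b := (cov_ext (beta b)).
Local Notation dU b := (cov_ext (d_fun B u b)).

Definition contact_family (c : R) (q : T) : shuffle_alg R 'rV[R]_(n * 2) :=
  contact_top n (u q + c) (E q + (u q + c) *: W q) (Be q) (dU q).

(** The factor beta du completes a form on ker beta inside the dividing set to top degree. The sum E
    + c W is, up to a scalar, what the symplectic form becomes on this hyperplane. *)
Definition filling_family k (c : R) (q : T) : shuffle_alg R 'rV[R]_(n * 2) :=
  E q ^+ k * (E q + c *: W q) ^+ (n.-1 - k) * (Be q * dU q).

Hypothesis contact_pos : forall b, top_pos volB (contact_family 0 b) b.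

Let sE : smooth_form B setT (ext_d B beta).
Proof. exact: smooth_ext_d openT sbeta. Qed.

Let sdU : smooth_form B setT (d_fun B u).
Proof. exact: smooth_d_fun openT su. Qed.

Let alt_form k (a : dform (n * 2) T k) q : smooth_form B setT a ->
  multilin (cov_ext (a q)) /\ skew (cov_ext (a q)).
Proof.
move=> sa; split; first exact: multilin_form sa (I : setT q).
exact: skew_form sa (I : setT q).
Qed.

Let altM (a b : shuffle_alg R 'rV[R]_(n * 2)) : multilin a /\ skew a ->
  multilin b /\ skew b -> multilin (a * b) /\ skew (a * b).
Proof. by move=> [ma ka] [mb kb]; split; [exact: multilinM|exact: skewM]. Qed.

Let altD (a b : shuffle_alg R 'rV[R]_(n * 2)) : multilin a /\ skew a ->
  multilin b /\ skew b -> multilin (a + b) /\ skew (a + b).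
Proof. by move=> [ma ka] [mb kb]; split; [exact: multilinD|exact: skewD]. Qed.

Let altZ (k : R) (a : shuffle_alg R 'rV[R]_(n * 2)) : multilin a /\ skew a ->
  multilin (k *: a) /\ skew (k *: a).
Proof. by move=> [ma ka]; split; [exact: multilinZ|exact: skewZ]. Qed.

Let altX (a : shuffle_alg R 'rV[R]_(n * 2)) k : multilin a /\ skew a ->
  multilin (a ^+ k) /\ skew (a ^+ k).
Proof. by move=> [ma ka]; split; [exact: multilin_exp|exact: skew_exp]. Qed.

Lemma alt_contact_family c q : multilin (contact_family c q) /\ skew (contact_family c q).
Proof.
have aE := alt_form q sE; have aW := alt_form q sw.
have aB := alt_form q sbeta; have aU := alt_form q sdU.
by apply: altD; apply: altZ; [|apply: altM; [|exact: altM]]; apply: altX;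
   apply: altD => //; exact: altZ.
Qed.

Lemma alt_filling_family k c q :
  multilin (filling_family k c q) /\ skew (filling_family k c q).
Proof.
have aE := alt_form q sE; have aW := alt_form q sw.
have aB := alt_form q sbeta; have aU := alt_form q sdU.
apply: altM; last exact: altM.
by apply: altM; apply: altX => //; apply: altD => //; exact: altZ.
Qed.

Lemma continuous_parameter b : {for (b, 0 : R), continuous (fun z : T * R => z.2)}.
Proof. exact: cvg_snd. Qed.

Lemma continuous_shifted b :
  {for (b, 0 : R), continuous (fun z : T * R => u z.1 + z.2)}.
Proof.
apply: continuousD; last exact: continuous_parameter.
apply: (@continuous_comp _ _ _ (@fst T R) u); first exact: cvg_fst.
exact: smooth_fun_continuous su _.
Qed.

Lemma continuous_form b k (a : dform (n * 2) T k) : smooth_form B setT a ->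
  continuous_family B b (fun _ q => cov_ext (a q)).
Proof. exact: continuous_family_form openT I. Qed.

Lemma continuous_contact_family b : continuous_family B b contact_family.
Proof.
have cE := @continuous_form b _ _ sE; have cW := @continuous_form b _ _ sw.
have cB := @continuous_form b _ _ sbeta; have cU := @continuous_form b _ _ sdU.
have cO : continuous_family B b (fun c q => E q + (u q + c) *: W q).
  by apply: continuous_familyD cE _; apply: continuous_familyZ cW; exact: continuous_shifted.
apply: continuous_familyD.
  apply: (continuous_familyZ (k := fun c q => u q + c)); first exact: continuous_shifted.
  exact: continuous_family_exp.
apply: (continuous_familyZ (k := fun _ _ => n%:R)); first exact: cst_continuous.
apply: continuous_familyM; first exact: continuous_family_exp.
exact: continuous_familyM.
Qed.

Lemma continuous_filling_family k b : continuous_family B b (filling_family k).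
Proof.
have cE := @continuous_form b _ _ sE; have cW := @continuous_form b _ _ sw.
have cB := @continuous_form b _ _ sbeta; have cU := @continuous_form b _ _ sdU.
apply: continuous_familyM; last exact: continuous_familyM.
apply: continuous_familyM; first exact: continuous_family_exp.
apply: continuous_family_exp; apply: continuous_familyD cE _.
by apply: (continuous_familyZ (k := fun c _ => c)) cW; exact: continuous_parameter.
Qed.

Lemma contact_familyE0 q : u q = 0 ->
  contact_family 0 q = n%:R *: (E q ^+ n.-1 * (Be q * dU q)).
Proof.
by move=> uq; rewrite /contact_family /contact_top uq addr0 !scale0r add0r addr0.
Qed.

(** On the dividing set the contact condition is positivity of n times a form, which is impossible
    for n = 0. Thus [n.-1] is a true predecessor there. *)
Lemma dividing_dim_gt0 q : u q = 0 -> (0 < n)%N.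
Proof.
move=> uq; case: posnP => // n0.
have [s sz vs] := vol_neq0 vol_form q.
have := contact_pos sz vs; rewrite contact_familyE0 // [n%:R](_ : _ = 0).
  by rewrite scale0r ext0E mul0r ltxx.
by rewrite n0.
Qed.

(** At c = 0 the families for all k coincide with E^(n-1) beta du, whose positivity is the contact
    condition divided by n. *)
Lemma filling_family_pos q k : u q = 0 -> (k < n)%N ->
  top_pos volB (filling_family k 0 q) q.
Proof.
move=> uq kn s sz vs; have := contact_pos sz vs.
rewrite contact_familyE0 // ext_scaleE -mulrA pmulr_rgt0; last first.
  by rewrite ltr0n; exact: leq_ltn_trans kn.
by rewrite /filling_family scale0r addr0 -exprD subnKC // -ltnS prednK //;
   exact: leq_ltn_trans kn.
Qed.

(** Compactness of B yields the first condition, compactness of the dividing set the second one for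
    each of the finitely many k. The bound is symmetric in c, so one d serves both halves of B. *)
Lemma good_parameter : exists2 d : R, 0 < d & forall c, `|c| < d ->
  (forall q, top_pos volB (contact_family c q) q) /\
  (forall q k, u q = 0 -> (k < n)%N -> top_pos volB (filling_family k c q) q).
Proof.
have G1 : \forall c \near (0 : R), forall q, setT q -> top_pos volB (contact_family c q) q.
  apply: (uniform_positivity vol_form B_compact alt_contact_family) => b _.
    exact: continuous_contact_family.
  exact: contact_pos.
have cG : compact [set q | u q = 0].
  apply: (subclosed_compact _ B_compact) => //.
  have := @closed_comp T R u [set 0]; apply; last exact: closed_eq.
  by move=> x _; exact: smooth_fun_continuous su x.
have G2 : \forall c \near (0 : R), forall k : 'I_n, forall q, u q = 0 ->
    top_pos volB (filling_family k c q) q.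
  apply: (@filter_forall R 'I_n (fun k c => forall q, u q = 0 ->
    top_pos volB (filling_family k c q) q) (nbhs (0 : R))) => k.
  apply: (uniform_positivity vol_form cG (alt_filling_family k)) => b ub.
    exact: continuous_filling_family.
  exact: filling_family_pos.
have [d /= d0 dP] := (nbhs_ballP _ _).1 (filterI G1 G2).
exists d => // c cd; have [|g1 g2] := dP c.
  by rewrite -ball_normE /ball_ /= sub0r normrN.
by split=> [q|q k uq kn]; [exact: g1|exact: (g2 (Ordinal kn))].
Qed.

End ContactTopFamily.

(** * The symplectic forms *)

Section Primitive.
Context {R : realType} {n : nat} {T : topologicalType}.
Variable B : smooth_manifold R (n * 2) T.
Variables (volB : @dform R (n * 2) T (n * 2)).
Variables (u : T -> R) (beta lambda : @dform R (n * 2) T 1).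
Variables (w0 : @dform R (n * 2) T 2).
Hypotheses (vol_form : volume_form B volB).
Hypotheses (su : smooth_fun B setT u) (sbeta : smooth_form B setT beta).
Hypotheses (slambda : smooth_form B setT lambda) (cw0 : closed_form_on B setT w0).
(* eps = 1 treats B_+ and eps = -1 treats B_-. *)
Variables (eps c : R).
Hypotheses (eps2 : eps * eps = 1) (c0 : 0 < eps * c).

(** In the application w0 is the curvature of the connection that represents e, and this is the
    curvature of the connection psi in the decomposition of alpha. *)
Definition curv : dform (n * 2) T 2 := fun p v => w0 p v + ext_d B lambda p v.

(** Absorbing lambda makes [omega] cohomologous to eps w0 itself, although the contact condition
    involves [curv]. *)
Definition primitive : dform (n * 2) T 1 :=
  fun p v => lambda p v + (u p + c)^-1 * beta p v.

Definition omega : dform (n * 2) T 2 :=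
  form_scale eps (fun p v => w0 p v + ext_d B primitive p v).

(** Forms on a closed domain have to extend smoothly to an open neighbourhood; this is one of the
    half space on which beta / (u + c) has no pole. *)
Definition collar : set T := [set p | 0 < eps * (u p + c)].

Lemma smooth_w0 : smooth_form B setT w0.
Proof.
have [[N [_ sN sw]] _] := cw0.
exact: smooth_form_sub sN sw.
Qed.

Lemma smooth_curv : smooth_form B setT curv.
Proof.
apply: smooth_formD smooth_w0 _; first exact: openT.
exact: smooth_ext_d openT slambda.
Qed.

Lemma open_collar : open collar.
Proof.
have := @open_comp T R (fun p => eps * (u p + c)) [set x | 0 < x]; apply.
  move=> p _; apply: cvgM; first exact: cvg_cst.
  by apply: cvgD; [exact: smooth_fun_continuous su p|exact: cvg_cst].
exact: open_gt.
Qed.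

Lemma collar_neq0 p : collar p -> u p + c != 0.
Proof. by rewrite /collar /=; apply: contraTneq => ->; rewrite mulr0 ltxx. Qed.

Lemma half_space_collar : [set p | 0 <= eps * u p] `<=` collar.
Proof. by move=> p /= up; rewrite /collar /= mulrDr ltr_wpDl. Qed.

Lemma smooth_inv_u : smooth_fun B collar (fun p => (u p + c)^-1).
Proof.
move=> ch ach; have oU := @open_preim _ _ _ ch collar open_collar.
apply: (@smooth_onV _ _ _ (fun x => u (chart_bwd ch x) + c) oU).
  by move=> x [_ Ox]; exact: collar_neq0.
apply: smooth_onD => //; last exact: smooth_on_cst.
by apply: smooth_on_sub (su ach) => x [].
Qed.

Let sbetaO : smooth_form B collar beta.
Proof. exact: smooth_form_sub sbeta. Qed.

Let slambdaO : smooth_form B collar lambda.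
Proof. exact: smooth_form_sub slambda. Qed.

Let sfbeta : smooth_form B collar (fun p v => (u p + c)^-1 * beta p v).
Proof. exact: smooth_formM open_collar smooth_inv_u sbetaO. Qed.

Lemma smooth_primitive : smooth_form B collar primitive.
Proof. exact: smooth_formD open_collar slambdaO sfbeta. Qed.

Lemma smooth_exact_shift : smooth_form B collar (fun p v => w0 p v + ext_d B primitive p v).
Proof.
apply: smooth_formD; first exact: open_collar.
  exact: smooth_form_sub smooth_w0.
exact: smooth_ext_d open_collar smooth_primitive.
Qed.

Lemma smooth_omega : smooth_form B collar omega.
Proof. exact: smooth_form_scale open_collar smooth_exact_shift. Qed.

Lemma ext_d_omega p v : collar p -> ext_d B omega p v = 0.
Proof.
move=> Op; rewrite /omega (ext_dZ eps v smooth_exact_shift Op).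
have sw : smooth_form B collar w0 by exact: smooth_form_sub smooth_w0.
have sd := smooth_ext_d open_collar smooth_primitive.
rewrite (ext_dD v sw sd Op) (ext_d_ext_d v open_collar smooth_primitive Op).
by rewrite cw0.2 // addr0 mulr0.
Qed.

Local Notation E b := (cov_ext (ext_d B beta b)).
Local Notation W b := (cov_ext (curv b)).
Local Notation Be b := (cov_ext (beta b)).
Local Notation dU b := (cov_ext (d_fun B u b)).

Lemma differential_inv p v : collar p ->
  differential B (fun p => (u p + c)^-1) p v = - (u p + c) ^- 2 * differential B u p v.
Proof.
move=> Op; have ac := chart_at_atlas B p; set ch := chart_at B p.
have Ux := chart_at_preimage B (I : setT p); rewrite /differential -/ch.
have bx : chart_bwd ch (chart_fwd ch p) = p by apply: chart_fwdK; exact: chart_at_dom.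
pose f := fun x => u (chart_bwd ch x) + c.
have du : derivable (u \o chart_bwd ch) (chart_fwd ch p) v.
  by apply: diff_derivable; exact: smooth_differentiable (su ac) Ux.
have df : derivable f (chart_fwd ch p) v.
  by apply: derivableD du _; exact: derivable_cst.
have f0 : f (chart_fwd ch p) != 0 by rewrite /f bx; exact: collar_neq0.
have := deriveV f0 df; rewrite /f bx => E.
apply: etrans E _; apply: (congr1 (fun z : R => - (u p + c) ^- 2 * z)).
have : 'D_v f (chart_fwd ch p) =
    'D_v (u \o chart_bwd ch) (chart_fwd ch p) + 'D_v (cst c) (chart_fwd ch p).
  by apply: deriveD du _; exact: derivable_cst.
by rewrite derive_cst addr0.
Qed.

Lemma cov_omega p : collar p ->
  cov_ext (omega p) = eps *: (W p + ((u p + c)^-1 *: E p +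
                                     (u p + c) ^- 2 *: (Be p * dU p))).
Proof.
move=> Op; rewrite /omega /form_scale cov_extZ; congr (_ *: _).
have -> : (u p + c) ^- 2 *: (Be p * dU p) = (- (u p + c) ^- 2) *: (dU p * Be p).
  rewrite (degree1_anticomm (degree_cov (beta p)) (degree_cov (d_fun B u p))).
  by rewrite scalerN scaleNr.
rewrite -cov_ext_mul1 -!cov_extZ -!cov_extD; congr cov_ext; apply/funext => v.
rewrite /curv -addrA; congr (_ + _).
rewrite (ext_dD v slambdaO sfbeta Op); congr (_ + _).
rewrite (ext_d_mul v smooth_inv_u sbetaO Op) !(differential_inv _ Op) addrC.
by congr (_ + _); rewrite /d_fun; ring.
Qed.

(** Sign bookkeeping: for eps^2 = 1 one has eps^n v^-(n+1) = eps (eps v)^-(n+1), and eps v > 0 on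
    the collar. So the n-th power of [omega] acquires exactly the sign eps, whatever the parity of
    n. *)
Lemma cov_omega_exp p : collar p ->
  cov_ext (omega p) ^+ n =
  (eps * (eps * (u p + c)) ^- n.+1) *: contact_family B u beta curv c p.
Proof.
move=> Op; have v0 := collar_neq0 Op.
rewrite (cov_omega Op) exprZn.
rewrite (exp_exact_perturbation _ v0 (degree_cov _) (degree_cov _) (degree_cov _)
  (degree_cov _)) scalerA; congr (_ *: _).
have eps0 : eps != 0 by apply: contraTneq (oner_neq0 R) => e0; rewrite -eps2 e0 mulr0 eqxx.
have epsV : eps^-1 = eps by apply: (mulfI eps0); rewrite mulfV.
have epsVn : (eps ^+ n.+1)^-1 = eps * eps ^+ n by rewrite -exprVn epsV exprS.
by rewrite exprMn invfM epsVn !mulrA eps2 mul1r.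
Qed.

Hypothesis good : forall q, top_pos volB (contact_family B u beta curv c q) q.

Lemma omega_top p s : collar p -> size s = (n * 2)%N -> cov_ext (volB p) s != 0 ->
  0 < (eps * cov_ext (volB p) s) * (cov_ext (omega p) ^+ n) s.
Proof.
move=> Op sz vs; rewrite (cov_omega_exp Op) ext_scaleE.
set Q := contact_family _ _ _ _ _ _ s; set v := cov_ext (volB p) s.
have -> : eps * v * (eps * (eps * (u p + c)) ^- n.+1 * Q) =
    (eps * eps) * (eps * (u p + c)) ^- n.+1 * (Q * v) by ring.
rewrite eps2 mul1r mulr_gt0 ?invr_gt0 ?exprn_gt0 //.
exact: good.
Qed.

Lemma omega_exact_on (D : set T) : D `<=` collar -> form_on B D primitive.
Proof.
by move=> DO; exists collar; split; [exact: open_collar|exact: DO|exact: smooth_primitive].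
Qed.

Lemma skew_omega p : collar p -> skew (cov_ext (omega p)).
Proof. by move=> Op; exact: skew_form smooth_omega Op. Qed.

Lemma symplectic_omega (D : set T) : D `<=` collar ->
  symplectic_on B D (form_scale eps volB) omega.
Proof.
move=> DO; split.
- split; last by move=> p /DO Op v; exact: ext_d_omega.
  by exists collar; split; [exact: open_collar|exact: DO|exact: smooth_omega].
(* A vector in the kernel of [omega] is also annihilated by its n-th power, a form of top degree,
   which would then vanish. *)
- move=> p /DO Op x x0; apply: contrapT => nd.
  have kx : ext_contract x (cov_ext (omega p)) = 0.
    apply: ext_eqP => -[|y [|z s]].
    + by rewrite [RHS]ext0E; exact: degree_cov.
    + rewrite [RHS]ext0E /ext_contract cov_extE //; apply/eqP/negPn/negP => E.
      by apply: nd; exists y.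
    + by rewrite [RHS]ext0E; exact: degree_cov.
  have kxn := contract_even_exp n (degree_cov _) kx.
  have [s sz vs] := vol_neq0 vol_form p.
  have mo := multilin_form smooth_omega Op.
  have := omega_top Op sz vs.
  rewrite (top_nondegenerate (multilin_exp n mo) (skew_exp n (skew_omega Op)) x0) //.
    by rewrite mulr0 ltxx.
  by move=> t _; have := congr1 (fun a : shuffle_alg _ _ => a t) kxn.
- move=> p /DO Op s sz _ vs.
  have szn : size s = (n * 2)%N by [].
  rewrite -cov_extE // /form_exp cov_ext_exp; last exact: skew_omega.
  move: vs; rewrite -cov_extE // /form_scale cov_extZ ext_scaleE => vs.
  have vs0 : cov_ext (volB p) s != 0.
    by apply: contraTneq vs => ->; rewrite mulr0 ltxx.
  by have := omega_top Op sz vs0; rewrite pmulr_rgt0.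
Qed.

Lemma cohomologous_trans (D : set T) (a b d : @dform R (n * 2) T 2) :
  cohomologous_on B D a b -> cohomologous_on B D b d -> cohomologous_on B D a d.
Proof.
move=> [l [N [oO DO sl]] El] [l' [N' [oO' DO' sl']] El'].
have oOO : open (N `&` N') by exact: openI.
have s1 : smooth_form B (N `&` N') l by apply: smooth_form_sub sl => q [].
have s2 : smooth_form B (N `&` N') l' by apply: smooth_form_sub sl' => q [].
exists (fun p v => l p v + l' p v).
  exists (N `&` N'); split=> //; first by move=> q Dq; split; [exact: DO|exact: DO'].
  exact: smooth_formD.
move=> p Dp v; rewrite (ext_dD v s1 s2); last by split; [exact: DO|exact: DO'].
by rewrite -(El p Dp) -(El' p Dp) addrA subrK.
Qed.

(** Since eps^2 = 1, the scaled form is -k w0 - k d(primitive). Classes are sets of representatives,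
    so the equality is two inclusions, each by transitivity through -k w0. *)
Lemma deRham_omega (D : set T) (k : R) : D `<=` collar ->
  deRham_class B D (form_scale (- (eps * k)) omega) =
  restrict_class B D (deRham_class B setT (form_scale (- k) w0)).
Proof.
move=> DO.
have relE p v : form_scale (- (eps * k)) omega p v - form_scale (- k) w0 p v =
    - k * ext_d B primitive p v.
  rewrite /omega /form_scale mulrA mulNr mulrAC eps2 mul1r; ring.
have prim_on := omega_exact_on DO.
have rel a : exists2 l, form_on B D l &
    forall p, D p -> forall v, ext_d B l p v = a * ext_d B primitive p v.
  exists (form_scale a primitive).
    exists collar; split; [exact: open_collar|exact: DO|].
    exact: smooth_form_scale open_collar smooth_primitive.
  by move=> p /DO Op v; rewrite (ext_dZ a v smooth_primitive Op).
apply/seteqP; split=> w' [cw' coh]; split=> //.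
  exists (form_scale (- k) w0).
    split.
      split.
        exists setT; split=> //; first exact: openT.
        exact: smooth_form_scale openT smooth_w0.
      move=> p _ v; rewrite (ext_dZ (- k) v smooth_w0 I) cw0.2 //.
      exact: mulr0.
    (* The zero 1-form, written as a multiple of lambda so that its smoothness and its derivative
       are available. *)
    exists (form_scale 0 lambda).
      by exists setT; split=> //; [exact: openT|exact: smooth_form_scale openT slambda].
    by move=> p _ v; rewrite (ext_dZ 0 v slambda I) mul0r subrr.
  apply: cohomologous_trans coh _.
  have [l fl El] := rel (- k); exists l => // p Dp v.
  by rewrite (El p Dp) -relE.
have [w1 [cw1 [l [N [oO TO sl]] El]] coh1] := coh.
apply: cohomologous_trans coh1 _.
apply: (@cohomologous_trans D _ (form_scale (- k) w0)).
  exists l; last by move=> p _ v; exact: El.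
  by exists N; split=> // q _; exact: TO.
have [l' fl' El'] := rel k; exists l' => // p Dp v.
by rewrite (El' p Dp) -opprB relE mulNr opprK.
Qed.

End Primitive.

(** * The dividing set as a boundary *)

Section Direction.
Context {R : realType} {V : normedModType R}.

Lemma near_line_continuous (x v : V) :
  (fun t : R => t *: v + x) t @[t --> 0^'+] --> x.
Proof.
rewrite -[X in _ --> X]add0r -(scale0r v); apply: cvgD; last exact: cvg_cst.
by apply: cvgZr_tmp; exact: cvg_at_right_filter (@cvg_id _ _).
Qed.

Lemma derive_pos_near (h : V -> R) x v : differentiable h x -> h x = 0 ->
  0 < 'D_v h x -> \forall t \near (0 : R)^'+, 0 < h (t *: v + x).
Proof.
move=> dh hx pos; have dv : derivable h x v by exact: diff_derivable.
have cvh : t^-1 *: (h (t *: v + x) - h x) @[t --> 0^'+] --> 'D_v h x.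
  exact: (cvg_dnbhs_at_right dv).
have npos : \forall t \near (0 : R)^'+, 0 < t^-1 *: (h (t *: v + x) - h x).
  exact: (cvgr_gt _ cvh _ pos).
have nt : \forall t \near (0 : R)^'+, 0 < t by exact: nbhs_right_gt.
apply: filterS2 npos nt => t pth t0; have ti : 0 < t^-1 by rewrite invr_gt0.
by move: pth; rewrite hx subr0 -[_ *: _]/(_ * _) (pmulr_rgt0 _ ti).
Qed.

Lemma at_right_ex (P Q S : R -> Prop) :
  (\forall t \near (0 : R)^'+, P t) -> (\forall t \near (0 : R)^'+, Q t) ->
  (\forall t \near (0 : R)^'+, S t) -> exists t, [/\ P t, Q t & S t].
Proof.
move=> nP nQ nS; suff : \forall t \near (0 : R)^'+, [/\ P t, Q t & S t].
  move=> nPQS; exact: (@filter_ex _ _ (at_right_proper_filter (0 : R)) _ nPQS).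
by apply: filterS3 nP nQ nS => t.
Qed.

End Direction.

Section LinearComparison.
Context {R : realFieldType} {V : lmodType R}.

(** Adding multiples of v in ker a to a vector with a > 0 does not change a; so b is bounded below
    along a whole line in direction v, hence constant on it. *)
Lemma half_space_kernel (a b : V -> R) :
  (forall k x y, a (k *: x + y) = k * a x + a y) ->
  (forall k x y, b (k *: x + y) = k * b x + b y) ->
  (exists v, a v != 0) -> (forall v, 0 < a v -> 0 <= b v) ->
  forall v, a v = 0 -> b v = 0.
Proof.
move=> la lb [v0 av0] ab v av.
have z (f : V -> R) : (forall k x y, f (k *: x + y) = k * f x + f y) -> f 0 = 0.
  by move=> lf; have := lf (-1) 0 0; rewrite scaler0 addr0 mulN1r addNr.
have [v1 pv1] : exists v1, 0 < a v1.
  exists (a v0 *: v0); have := la (a v0) v0 0; rewrite addr0 (z a la) addr0 => ->.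
  by rewrite -expr2 exprn_even_gt0.
have key k : 0 <= k * b v + b v1.
  by rewrite -lb; apply: ab; rewrite la av mulr0 add0r.
(* The multiple is chosen so that b would take the value -1. *)
apply/eqP; apply: contraT => bv; have := key (- (b v1 + 1) / b v).
by rewrite divfK //; lra.
Qed.

End LinearComparison.

Section Boundary.
Context {R : realType} {m : nat} {T : topologicalType}.
Variable X : smooth_manifold R m T.
Implicit Types (f g : T -> R) (D : set T) (p : T).

Definition chart_ray p (v : 'rV[R]_m) (t : R) : T :=
  chart_bwd (chart_at X p) (t *: v + chart_fwd (chart_at X p) p).

Lemma chart_ray_cvg p v : chart_ray p v t @[t --> 0^'+] --> p.
Proof.
set c := chart_at X p; have cp : chart_dom c p by exact: chart_at_dom.
have cb := chart_bwd_cont (chart_fwd_cod cp).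
rewrite /prop_for /continuous_at (chart_fwdK cp) in cb.
move=> A nA; have nl := @near_line_continuous R _ (chart_fwd c p) v.
exact: (nl _ (cb _ nA)).
Qed.

Lemma chart_ray_pos f p v O : smooth_fun X O f -> O p -> f p = 0 ->
  0 < differential X f p v -> \forall t \near 0^'+, 0 < f (chart_ray p v t).
Proof.
move=> sf Op fp; apply: derive_pos_near.
  exact: smooth_differentiable (sf _ (chart_at_atlas X p)) (chart_at_preimage X Op).
by rewrite /= chart_fwdK //; exact: chart_at_dom.
Qed.

Lemma differentialZ O (k : R) f p v : smooth_fun X O f -> O p ->
  differential X (fun q => k * f q) p v = k * differential X f p v.
Proof.
move=> sf Op; have df := smooth_differentiable (sf _ (chart_at_atlas X p))
  (chart_at_preimage X Op).
have dfv : derivable (f \o chart_bwd (chart_at X p)) (chart_fwd (chart_at X p) p) v.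
  exact: diff_derivable.
exact: (deriveZ k dfv).
Qed.

Lemma chart_ray_neg f p v O : open O -> smooth_fun X O f -> O p -> f p = 0 ->
  differential X f p v < 0 -> \forall t \near 0^'+, f (chart_ray p v t) < 0.
Proof.
move=> oO sf Op fp df.
have sNf : smooth_fun X O (fun q => -1 * f q).
  move=> c ac; have oU := @open_preim _ _ _ c O oO.
  exact: smooth_onM oU (smooth_on_cst (-1 : R) oU) (sf c ac).
have := @chart_ray_pos (fun q => -1 * f q) p v O sNf Op.
rewrite fp mulr0 (differentialZ _ _ sf Op) mulN1r oppr_gt0 => /(_ erefl df).
by apply: filterS => t; rewrite mulN1r oppr_gt0.
Qed.

Section HalfSpace.
Variable g : T -> R.
Hypothesis sg : smooth_fun X setT g.
Local Notation D := [set p | 0 <= g p].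
Hypothesis dg : forall p, g p = 0 -> exists v, differential X g p v != 0.

Lemma half_space_defining p : g p = 0 -> boundary_defining X D p g.
Proof.
move=> gp; exists setT; split=> //; first exact: openT.
- by rewrite setIT; apply/seteqP; split=> q /=; [|case].
- by split=> //; exact: dg.
Qed.

Lemma differential_linT O f p : smooth_fun X O f -> O p -> forall (k : R) v w,
  differential X f p (k *: v + w) = k * differential X f p v + differential X f p w.
Proof. by move=> sf Op k v w; exact: differential_lin sf Op. Qed.

(** If df(v) > 0 and dg(v) < 0, a short ray from p in direction v would contain points with f > 0
    and g < 0, although f and g cut out the same half space near p. *)
Lemma defining_half_space O f p : open O -> O p -> smooth_fun X O f -> f p = 0 ->
  g p = 0 -> (forall q, O q -> (0 <= g q) = (0 <= f q)) ->
  (forall v, 0 < differential X f p v -> 0 <= differential X g p v) /\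
  (forall v, 0 < differential X g p v -> 0 <= differential X f p v).
Proof.
move=> oO Op sf fp gp E.
have nO v : \forall t \near 0^'+, O (chart_ray p v t).
  by apply: (@chart_ray_cvg p v); exact: (open_near oO Op).
split=> v pos; rewrite leNgt; apply/negP => neg.
- have [t [Ot g0 f0]] := at_right_ex (nO v)
    (chart_ray_neg openT sg (I : setT p) gp neg) (chart_ray_pos sf Op fp pos).
  by have := E _ Ot; rewrite (ltW f0) leNgt g0.
- have [t [Ot g0 f0]] := at_right_ex (nO v)
    (chart_ray_pos sg (I : setT p) gp pos) (chart_ray_neg oO sf Op fp neg).
  by have := E _ Ot; rewrite (ltW g0) leNgt f0.
Qed.

(** [boundary_tangent] and [outward] admit any defining function f, so df has to be related to dg.
    As neither is negative where the other is positive, they have the same kernel and the same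
    negative side. *)
Lemma defining_compare p f : g p = 0 -> boundary_defining X D p f ->
  (forall v, differential X f p v = 0 -> differential X g p v = 0) /\
  (forall v, differential X f p v < 0 -> differential X g p v < 0).
Proof.
move=> gp [N [oN Np sf DN [fp df]]].
have E q : N q -> (0 <= g q) = (0 <= f q).
  move=> Nq; apply/idP/idP => h.
    have : (D `&` N) q by split.
    by rewrite DN => -[].
  have : [set q | N q /\ 0 <= f q] q by split.
  by rewrite -DN => -[].
have [fg gf] := defining_half_space oN Np sf fp gp E.
have lf := differential_linT sf Np; have lg := differential_linT sg (I : setT p).
have kfg := half_space_kernel lf lg df fg.
have kgf := half_space_kernel lg lf (dg gp) gf.
have opp (h : 'rV[R]_m -> R) : (forall k x y, h (k *: x + y) = k * h x + h y) ->
    forall v, h (- v) = - h v.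
  move=> lh v; have h0 : h 0 = 0.
    by have := lh (-1) 0 0; rewrite scaler0 addr0 mulN1r addNr.
  by have := lh (-1) v 0; rewrite addr0 scaleN1r h0 addr0 mulN1r.
split=> // v fv; rewrite lt_neqAle; apply/andP; split.
  by apply: contraTneq fv => /kgf ->; rewrite ltxx.
have := fg (- v); rewrite (opp _ lf) (opp _ lg) oppr_gt0 oppr_ge0.
exact.
Qed.

Lemma open_pos : open [set p | 0 < g p].
Proof.
have := @open_comp T R g [set x | 0 < x]; apply; last exact: open_gt.
by move=> p _; exact: smooth_fun_continuous sg p.
Qed.

Lemma closed_half_space : closed D.
Proof.
have := @closed_comp T R g [set x | 0 <= x]; apply; last exact: closed_ge.
by move=> p _; exact: smooth_fun_continuous sg p.
Qed.

Lemma boundary_half_space : boundary D = [set p | g p = 0].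
Proof.
apply/seteqP; split=> p.
  move=> [Dp nI] /=; apply/eqP; move: Dp => /=; rewrite le_eqVlt => /orP[/eqP ->//|gp].
  exfalso; apply: nI; apply: (open_near open_pos gp) => q; exact: ltW.
move=> /= gp; split; first by rewrite /= gp.
move=> nD; have [v dv] := dg gp.
(* A ray in a direction with dg < 0 leaves the half space at once, so p is no interior point. *)
have [v1 dv1] : exists v1, differential X g p v1 < 0.
  exists (- differential X g p v *: v).
  have lg := differential_linT sg (I : setT p).
  have := lg (- differential X g p v) v 0; rewrite addr0 => ->.
  have -> : differential X g p 0 = 0.
    by have := lg (-1) 0 0; rewrite scaler0 addr0 mulN1r addNr.
  by rewrite addr0 mulNr oppr_lt0 -expr2 exprn_even_gt0.
have n2 : \forall t \near (0 : R)^'+, 0 <= g (chart_ray p v1 t).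
  by have cr := @chart_ray_cvg p v1; exact: (cr _ nD).
have [t [/= g0 g1 _]] := at_right_ex (chart_ray_neg openT sg (I : setT p) gp dv1) n2 n2.
by move: g1; rewrite leNgt g0.
Qed.

Lemma regular_half_space : regular_domain X D.
Proof.
split; first exact: closed_half_space.
by rewrite boundary_half_space => p gp; exists g; exact: half_space_defining.
Qed.

Lemma boundary_tangent_half_space p v : g p = 0 -> boundary_tangent X D p v ->
  differential X g p v = 0.
Proof. by move=> gp [f df fv]; exact: (defining_compare gp df).1. Qed.

Lemma outward_half_space p v : g p = 0 -> outward X D p v ->
  differential X g p v < 0.
Proof. by move=> gp [f df fv]; exact: (defining_compare gp df).2. Qed.

End HalfSpace.

End Boundary.

(** * The weak filling conditions *)

Section WeakFilling.
Context {R : realType} {n : nat} {T : topologicalType}.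
Variable B : smooth_manifold R (n * 2) T.
Variables (volB : @dform R (n * 2) T (n * 2)).
Variables (u : T -> R) (beta lambda : @dform R (n * 2) T 1).
Variables (w0 : @dform R (n * 2) T 2).
Hypotheses (vol_form : volume_form B volB) (B_compact : compact [set: T]).
Hypotheses (su : smooth_fun B setT u) (sbeta : smooth_form B setT beta).
Hypotheses (slambda : smooth_form B setT lambda) (cw0 : closed_form_on B setT w0).
Variables (eps c : R).
Hypotheses (eps2 : eps * eps = 1) (c0 : 0 < eps * c).

Local Notation E b := (cov_ext (ext_d B beta b)).
Local Notation W b := (cov_ext (curv B lambda w0 b)).
Local Notation Be b := (cov_ext (beta b)).
Local Notation dU b := (cov_ext (d_fun B u b)).
Local Notation om := (omega B u beta lambda w0 eps c).

Hypothesis contact_pos :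
  forall q, top_pos volB (contact_family B u beta (curv B lambda w0) 0 q) q.
Hypothesis good : forall q, top_pos volB (contact_family B u beta (curv B lambda w0) c q) q.
Hypothesis good_filling : forall q k, u q = 0 -> (k < n)%N ->
  top_pos volB (filling_family B u beta (curv B lambda w0) k c q) q.

Let sw := smooth_curv slambda cw0.

Let eps_neq0 : eps != 0.
Proof. by apply: contraTneq (oner_neq0 R) => e0; rewrite -eps2 e0 mulr0 eqxx. Qed.

Let g p := eps * u p.

Let sg : smooth_fun B setT g.
Proof.
move=> ch ach; have oU := @open_preim _ _ _ ch setT openT.
exact: smooth_onM oU (smooth_on_cst (eps : R) oU) (su ach).
Qed.

Let g0 p : g p = 0 -> u p = 0.
Proof. by rewrite /g => /eqP; rewrite mulf_eq0 (negbTE eps_neq0) => /eqP. Qed.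

Let gE p v : differential B g p v = eps * differential B u p v.
Proof. exact: differentialZ su I. Qed.

Definition dividing_top q := E q ^+ n.-1 * (Be q * dU q).

Lemma dividing_top_alt q : multilin (dividing_top q) /\ skew (dividing_top q).
Proof.
have := alt_filling_family su sbeta sw n.-1 0 q.
by rewrite /filling_family subnn expr0 mulr1.
Qed.

Lemma dividing_top_pos q : u q = 0 -> top_pos volB (dividing_top q) q.
Proof.
move=> uq; have n0 := dividing_dim_gt0 vol_form contact_pos uq.
have := filling_family_pos contact_pos uq (_ : (n.-1 < n)%N).
by rewrite /filling_family subnn expr0 mulr1 prednK //; exact.
Qed.

Lemma top_pos_neq0 a q s : multilin a -> skew a -> size s = (n * 2)%N -> a s != 0 ->
  cov_ext (volB q) s != 0.
Proof.
move=> ma ka sz as0; have [t tz vt] := vol_neq0 vol_form q.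
have E1 := top_proportional ma ka (multilin_form vol_form.1 (I : setT q))
  (skew_form vol_form.1 (I : setT q)) sz tz.
by apply: contraNneq as0 => vs; move: E1; rewrite vs mulr0 => /eqP;
   rewrite mulf_eq0 (negbTE vt) orbF.
Qed.

Lemma dividing_factor_neq0 q : u q = 0 -> Be q * dU q != 0.
Proof.
move=> uq; apply/eqP => z; have [s sz vs] := vol_neq0 vol_form q.
have := dividing_top_pos uq sz vs.
by rewrite /dividing_top z mulr0 ext0E mul0r ltxx.
Qed.

(** On the dividing set the contact condition contains the factor beta du, so du cannot vanish
    there: 0 is a regular value of u. *)
Lemma dg p : g p = 0 -> exists v, differential B g p v != 0.
Proof.
move=> gp; apply: contrapT => nv; have /eqP := dividing_factor_neq0 (g0 gp); apply.
have -> : dU p = 0; last by rewrite mulr0.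
apply: ext_eqP => s; rewrite ext0E /cov_ext; case: ifP => // _.
apply/eqP; rewrite -(mulrI_eq0 _ (mulfI eps_neq0)); apply/negPn/negP => dv.
by apply: nv; exists (s`_(@ord0 0)); rewrite gE.
Qed.

Lemma beta_du_pair q : u q = 0 -> exists x y,
  Be q [:: x] * dU q [:: y] - Be q [:: y] * dU q [:: x] != 0.
Proof.
move=> uq; apply: contrapT => nxy; have /eqP := dividing_factor_neq0 uq; apply.
have db := degree_cov (beta q); have ddu := degree_cov (d_fun B u q).
apply: ext_eqP => -[|x [|y [|z s]]]; rewrite ext0E; try exact: (degreeM db ddu).
rewrite -[Be q * dU q]mulr1 deg1_mul2_cons2 //.
have -> : Be q [:: x] * dU q [:: y] - Be q [:: y] * dU q [:: x] = 0.
  by apply/eqP/negPn/negP => h; apply: nxy; exists x, y.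
exact: mul0r.
Qed.

(** The term beta du in the symplectic form contributes only summands divisible by beta, and these
    vanish on arguments in ker beta. *)
Lemma filling_restriction q k s : u q = 0 -> (k < n)%N ->
  (forall z, List.In z s -> Be q [:: z] = 0) ->
  (cov_ext (ext_d B beta q) ^+ k * cov_ext (om q) ^+ (n.-1 - k)) s =
  (eps * c^-1) ^+ (n.-1 - k) * (E q ^+ k * (E q + c *: W q) ^+ (n.-1 - k)) s.
Proof.
move=> uq kn kill.
have c_neq0 : c != 0 by apply: contraTneq c0 => ->; rewrite mulr0 ltxx.
have Oq : collar u eps c q by rewrite /collar /= uq add0r.
have db := degree_cov (beta q); have ddu := degree_cov (d_fun B u q).
have dEW : degree 2 (E q + c *: W q).
  by apply: degreeD; [|apply: degreeZ]; exact: degree_cov.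
rewrite (cov_omega w0 su sbeta slambda Oq) uq add0r.
have -> : W q + (c^-1 *: E q + c ^- 2 *: (Be q * dU q)) =
    c^-1 *: ((E q + c *: W q) + c^-1 *: (Be q * dU q)).
  by rewrite !scalerDr !scalerA mulVf // scale1r addrA [W q + _]addrC -invfM -expr2.
rewrite scalerA exprZn -scalerAr ext_scaleE; congr (_ * _).
rewrite exp_add_sqr0 //; last exact: deg1_prod_sqr0.
rewrite mulrDr ext_addE -scalerAr ext_scaleE mulrA.
rewrite -(degree2_comm _ (degreeM db ddu)) -mulrA (deg1_mul_kill _ db kill).
by rewrite mulr0 addr0.
Qed.

Local Notation D := [set p | 0 <= g p].

Lemma half_space_sub_collar : D `<=` collar u eps c.
Proof. exact: half_space_collar. Qed.

(** Completing s by x, y with d = (beta du)(x, y) nonzero gives a frame of B on which any a beta du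
    takes the value d a(s). [dividing_top] and [filling_family] both have the sign of vol on this
    frame, so their first factors have the same sign on s. *)
Lemma filling_inequality q k s : u q = 0 -> (k < n)%N -> size s = (n.-1 * 2)%N ->
  (forall z, List.In z s -> Be q [:: z] = 0) ->
  (forall z, List.In z s -> dU q [:: z] = 0) ->
  0 < (E q ^+ n.-1) s ->
  0 < (E q ^+ k * cov_ext (om q) ^+ (n.-1 - k)) s.
Proof.
move=> uq kn sz kb kdu pos; rewrite filling_restriction //.
have n0 := dividing_dim_gt0 vol_form contact_pos uq.
have ec0 : 0 < eps * c^-1.
  have -> : eps * c^-1 = (eps * c)^-1; last by rewrite invr_gt0.
  by rewrite invfM; congr (_ * _); apply: (mulfI eps_neq0); rewrite eps2 mulfV.
rewrite pmulr_rgt0 ?exprn_gt0 //.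
have [x [y dxy]] := beta_du_pair uq.
set d := (X in X != 0) in dxy.
have db := degree_cov (beta q); have ddu := degree_cov (d_fun B u q).
pose t := x :: y :: s.
have szt : size t = (n * 2)%N by rewrite /= sz -[in RHS](prednK n0) mulSn.
have expand a : (a * (Be q * dU q)) t = d * a s.
  by rewrite -(degree2_comm _ (degreeM db ddu)) deg1_mul2_cons2.
have [mt kt] := dividing_top_alt q.
have vt : cov_ext (volB q) t != 0.
  apply: (@top_pos_neq0 _ q _ mt kt szt).
  by rewrite /dividing_top expand mulf_neq0 // gt_eqF.
have p1 := dividing_top_pos uq szt vt.
have p2 := good_filling uq kn szt vt.
rewrite /dividing_top expand mulrAC pmulr_lgt0 // in p1.
by move: p2; rewrite /filling_family expand mulrAC pmulr_rgt0.
Qed.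

(** On the frame nu, s the form E^(n-1) beta du equals -du(nu) times the value of beta E^(n-1) on s.
    For an outward nu the sign of du(nu) is -eps, which matches the orientation eps vol; so ker beta
    is positive as seen from either half. *)
Lemma contact_inequality q nu s : u q = 0 -> eps * differential B u q nu < 0 ->
  (size s).+1 = (n * 2)%N ->
  (forall z, List.In z s -> dU q [:: z] = 0) ->
  0 < eps * cov_ext (volB q) (nu :: s) ->
  0 < (Be q * E q ^+ n.-1) s.
Proof.
move=> uq dnu sz kdu vs.
have db := degree_cov (beta q); have ddu := degree_cov (d_fun B u q).
have dE := degree_cov (ext_d B beta q).
have vs0 : cov_ext (volB q) (nu :: s) != 0.
  by apply: contraTneq vs => ->; rewrite mulr0 ltxx.
have := dividing_top_pos uq (_ : size (nu :: s) = (n * 2)%N) vs0.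
rewrite /dividing_top -(degree2_comm _ (degreeM db ddu)).
rewrite (degree1_anticomm db ddu) mulNr -mulrA ext_oppE.
rewrite deg1_mul_cons // (deg1_mul_kill _ ddu kdu) subr0 => /(_ sz).
have -> : dU q [:: nu] = differential B u q nu by rewrite cov_ext1.
set X := (Be q * _) s; set v := cov_ext (volB q) _ in vs *; set a := differential B u q nu.
have -> : - (a * X) * v = (- (eps * a) * (eps * v)) * X.
  have -> : - (eps * a) * (eps * v) * X = - ((eps * eps) * (a * X)) * v by ring.
  by rewrite eps2 mul1r.
by rewrite pmulr_rgt0 // mulr_gt0 // oppr_gt0.
Qed.

Lemma filling_data : weak_filling B D (form_scale eps volB) om [set p | u p = 0] beta.
Proof.
have bD : boundary D = [set p | u p = 0].
  rewrite (boundary_half_space sg dg); apply/seteqP; split=> p /=; first exact: g0.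
  by rewrite /g => ->; rewrite mulr0.
have gz p : u p = 0 -> g p = 0 by rewrite /g => ->; rewrite mulr0.
have tang p v : u p = 0 -> boundary_tangent B D p v -> dU p [:: v] = 0.
  move=> up tv; have := boundary_tangent_half_space sg dg (gz p up) tv.
  rewrite gE => /eqP; rewrite mulf_eq0 (negbTE eps_neq0) => /eqP.
  by rewrite cov_ext1.
(* Passes from boolean membership in the filling conditions to the [List.In] of the algebraic
   lemmas. *)
have inP (s : seq 'rV[R]_(n * 2)) (P : 'rV[R]_(n * 2) -> Prop) :
    (forall x, x \in s -> P x) -> forall x, List.In x s -> P x.
  elim: s => [|y s IHs] sP x //= [<-|xs]; first by apply: sP; rewrite mem_head.
  by apply: IHs xs => z zs; apply: sP; rewrite inE zs orbT.
have sub := half_space_sub_collar.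
have kE q : skew (E q).
  by apply: skew_cov; exact: alternating_ext_d openT sbeta (I : setT q).
split.
- split; last exact: regular_half_space sg dg.
  by apply: (subclosed_compact (closed_half_space sg) B_compact).
- by rewrite bD.
- exact: symplectic_omega.
- split; first by exists setT; split=> //; exact: openT.
  move=> p up nu out s sz tan vs.
  have du : eps * differential B u p nu < 0.
    by rewrite -gE; exact: (outward_half_space sg dg (gz p up) out).
  have n0 := dividing_dim_gt0 vol_form contact_pos up.
  have szs : size s = (1 + n.-1 * 2)%N.
    by apply: succn_inj; rewrite sz -[in LHS](prednK n0) mulSn.
  rewrite -cov_extE // /form_wedge cov_ext_wedge.
  + rewrite /form_exp cov_ext_exp //.
    apply: (contact_inequality up du sz).
      by move=> z /(inP _ _ tan); exact: tang.
    by move: vs; rewrite -cov_extE // /form_scale cov_extZ.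
  + exact/skew_deg1/degree_cov.
  + by rewrite /form_exp cov_ext_exp //; exact: skew_exp.
- move=> p up k kn s sz ker pos.
  have n0 := dividing_dim_gt0 vol_form contact_pos up.
  have Op : collar u eps c p by apply: sub; rewrite /= gz.
  have ko := skew_omega su sbeta slambda cw0 Op.
  have kle : (k <= n.-1)%N by rewrite -ltnS prednK.
  have szs : size s = (k * 2 + (n.-1 - k) * 2)%N by rewrite -mulnDl subnKC.
  rewrite -cov_extE // /form_wedge cov_ext_wedge /form_exp ?cov_ext_exp //;
    try exact: skew_exp.
  apply: filling_inequality => //.
  + move=> z /(inP _ _ ker)[_].
    by rewrite -cov_extE.
  + by move=> z /(inP _ _ ker)[tz _]; exact: tang.
  + by move: pos; rewrite -cov_extE // /form_exp cov_ext_exp.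
Qed.

End WeakFilling.

Theorem proposition3p6 (R : realType) (n : nat) (TB TM : topologicalType)
    (B : smooth_manifold R (n * 2) TB) (M : smooth_manifold R (n * 2).+1 TM)
    (volB : dform (n * 2) TB (n * 2))
    (prj : TM -> TB) (Phi : R -> TM -> TM) (e : set (dform (n * 2) TB 2))
    (psi alpha : dform (n * 2).+1 TM 1)
    (u : TB -> R) (beta : dform (n * 2) TB 1)
    (B_closed : compact [set: TB])
    (B_connected : connected [set: TB])
    (B_oriented : volume_form B volB)
    (M_bundle : principal_circle_bundle M B prj Phi)
    (e_euler : real_euler_class M B prj Phi e)
    (psi_connection : connection_form M Phi psi)
    (alpha_invariant : invariant_form M Phi alpha)
    (alpha_contact : positive_contact_form M
       (form_wedge psi (pullback_form M B prj volB)) alpha)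
    (u_smooth : smooth_fun B setT u)
    (u_def : forall p : TM,
       u (prj p) = eval_cov (alpha p) [:: generator M Phi p])
    (beta_smooth : smooth_form B setT beta)
    (alpha_decomp : forall (p : TM) (v : 'I_1 -> 'rV[R]_(n * 2).+1),
       alpha p v = pullback_form M B prj beta p v + u (prj p) * psi p v) :
  let Gamma := [set p : TB | u p = 0] in
  let Bplus := [set p : TB | 0 <= u p] in
  let Bminus := [set p : TB | u p <= 0] in
  let volBopp := form_scale (-1) volB in
  exists omegap omegam : dform (n * 2) TB 2,
    [/\ symplectic_on B Bplus volB omegap,
        symplectic_on B Bminus volBopp omegam,
        deRham_class B Bplus (form_scale (- (2 * pi)^-1) omegap) =
          restrict_class B Bplus e,
        deRham_class B Bminus (form_scale ((2 * pi)^-1) omegam) =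
          restrict_class B Bminus e &
        Gamma !=set0 ->
          weak_filling B Bplus volB omegap Gamma beta /\
          weak_filling B Bminus volBopp omegam Gamma beta].
Proof.
move=> Gamma Bplus Bminus volBopp.
have [psi' [w0 [cpsi' [cw0 dpsi'] ->]]] := e_euler.
have [lambda [slambda psiE]] :=
  connection_difference M_bundle psi_connection cpsi'.
have sw := smooth_curv slambda cw0.
have dpsi p v : ext_d M psi p v = pullback_form M B prj (curv B lambda w0) p v.
  have -> : psi = fun p v => psi' p v + pullback_form M B prj lambda p v.
    by apply/funext => q; apply/funext => z; exact: psiE.
  have spull : smooth_form M setT (pullback_form M B prj lambda).
    have := smooth_pullback openT openT (prj_smooth M_bundle) slambda.
    by rewrite preimage_setT setIT.
  have [spsi' _ _] := cpsi'.
  rewrite (ext_dD v spsi' spull I) dpsi'.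
  by rewrite (ext_d_pullback v openT openT (prj_smooth M_bundle) slambda I I).
have contact_pos q : top_pos volB (contact_family B u beta (curv B lambda w0) 0 q) q.
  rewrite /contact_family addr0.
  exact: (contact_positive M_bundle B_oriented psi_connection alpha_contact
    u_smooth beta_smooth alpha_decomp sw dpsi).
have [d d0 good] := good_parameter B_oriented B_closed u_smooth beta_smooth sw
  contact_pos.
have d2 : 0 < d / 2 by rewrite divr_gt0.
have d2d : d / 2 < d by rewrite ltr_pdivrMr // ltr_pMr // ltr1n.
(* Both halves at once: c = eps d / 2 has the sign of eps and satisfies |c| < d. *)
have main eps : eps * eps = 1 -> `|eps| = 1 ->
    let W := [set p | 0 <= eps * u p] in
    let om := omega B u beta lambda w0 eps (eps * (d / 2)) in
    [/\ symplectic_on B W (form_scale eps volB) om,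
        deRham_class B W (form_scale (- (eps * (2 * pi)^-1)) om) =
          restrict_class B W
            (deRham_class B setT (form_scale (- (2 * pi)^-1) w0)) &
        weak_filling B W (form_scale eps volB) om Gamma beta].
  move=> eps2 abs_eps W om.
  have c0 : 0 < eps * (eps * (d / 2)) by rewrite mulrA eps2 mul1r.
  have [|g1 g2] := good (eps * (d / 2)).
    by rewrite normrM abs_eps mul1r gtr0_norm.
  have sub : W `<=` collar u eps (eps * (d / 2)) by exact: half_space_collar.
  split; first exact: symplectic_omega.
    exact: deRham_omega.
  exact: filling_data.
have [|| sp cp fp] := main 1; [by rewrite mulr1|by rewrite normr1|].
have [|| sm cm fm] := main (-1); [by rewrite mulrNN mulr1|by rewrite normrN1|].
have Ep : [set p | 0 <= 1 * u p] = Bplus by apply/seteqP; split=> p /=; rewrite mul1r.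
have Em : [set p | 0 <= -1 * u p] = Bminus.
  by apply/seteqP; split=> p /=; rewrite mulN1r oppr_ge0.
have Ev : form_scale 1 volB = volB.
  by apply/funext => p; apply/funext => v; rewrite /form_scale mul1r.
have E1 : - (1 * (2 * pi)^-1) = - (2 * pi)^-1 :> R by rewrite mul1r.
have E2 : - (-1 * (2 * pi)^-1) = (2 * pi)^-1 :> R by rewrite mulN1r opprK.
rewrite Ep ?Ev ?E1 in sp cp fp; rewrite Em ?E2 in sm cm fm.
exists (omega B u beta lambda w0 1 (1 * (d / 2))),
  (omega B u beta lambda w0 (-1) (-1 * (d / 2))).
by split.
Qed.
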